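(* If a maximal connected quartic generalised projective special real (GPSR) curve has a limit geometry, then this limit geometry is equivalent to one of the two homogeneous curves $\mathcal{A}$ or $\mathcal{B}$ defined as follows: for a polynomial $h$ with $-\partial^2h_{(1,0)}$ Lorentzian, write $\mathcal{H}(h)$ for the connected component of $\{h=1\}\cap\{\text{hyperbolic points of }h\}\subset\mathbb{R}^2$ containing $(x,y)=(1,0)$, and set $$\mathcal{A}=\mathcal{H}\left(x^4-x^2y^2+\tfrac14y^4\right),\qquad \mathcal{B}=\mathcal{H}\left(x^4-x^2y^2+\tfrac{2\sqrt2}{3\sqrt3}xy^3-\tfrac1{12}y^4\right).$$ Every maximal connected quartic GPSR curve is equivalent to exactly one of the curves $\mathcal{H}$ listed below, and their limit geometries (up to equivalence), together with the number of directions (out of the two possible ones) in which a limit geometry exists, are as follows. Let $U=\frac{1}{24}\left(4+(31+3\sqrt{57})(46+6\sqrt{57})^{-1/3}+(100+12\sqrt{57})(46+6\sqrt{57})^{-2/3}\right)$. Closed curves: (1) $\mathcal{H}=\mathcal{A}$ (homogeneous): limit geometry $\mathcal{A}$, in $2$ directions. (2) $\mathcal{H}=\mathcal{B}$ (homogeneous): limit geometry $\mathcal{B}$, in $2$ directions. (3) $\mathcal{H}=\mathcal{H}\left(x^4-x^2y^2+\frac{2}{3\sqrt3}xy^3\right)$ (not homogeneous): limit geometries $\mathcal{A}$ and $\mathcal{B}$, $2$ directions with a limit geometry. (4) $\mathcal{H}=\mathcal{H}\left(x^4-x^2y^2+Ky^4\right)$, $K<\frac14$ (not homogeneous): limit geometry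 $\mathcal{B}$, in $2$ directions. Non-closed curves (none of them homogeneous): (5) $\mathcal{H}=\mathcal{H}\left(x^4-x^2y^2+Ky^4\right)$, $K>\frac14$: no limit geometry, $0$ directions. (6) $\mathcal{H}=\mathcal{H}\left(x^4-x^2y^2+xy^3+Ky^4\right)$, $K\in\left(-\frac{25}{72},U\right)$: limit geometry $\mathcal{B}$, in exactly $1$ direction. (7) $\mathcal{H}=\mathcal{H}\left(x^4-x^2y^2+xy^3-\frac{25}{72}y^4\right)$: limit geometry $\mathcal{B}$, in exactly $1$ direction. (8) $\mathcal{H}=\mathcal{H}\left(x^4-x^2y^2+xy^3+Uy^4\right)$: limit geometry $\mathcal{A}$, in exactly $1$ direction.
   Context: Let $h:\mathbb{R}^2\to\mathbb{R}$ be a homogeneous quartic polynomial. A point $p$ is a hyperbolic point of $h$ if $-\partial^2h_p$ (minus the Hessian bilinear form) has Lorentzian signature $(1,1)$; $h$ is hyperbolic if such a point exists. A quartic GPSR curve is a one-dimensional submanifold $\mathcal{H}\subset\{h=1\}\subset\mathbb{R}^2$, $h$ a hyperbolic homogeneous quartic polynomial, consisting only of hyperbolic points of $h$. It is maximal connected if it is one connected component of $\{h=1\}\cap\{\text{hyperbolic points of }h\}$, and closed if it is closed in $\mathbb{R}^2$. Two such curves are equivalent if some $A\in\mathrm{GL}(2)$ maps one onto the other. $\mathcal{H}$ is homogeneous if the group of $A\in\mathrm{GL}(2)$ with $A(\mathcal{H})=\mathcal{H}$ acts transitively on $\mathcal{H}$. $h$ is in standard form if $h=x^4-x^2y^2+Lxy^3+Ky^4$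 for some $L,K\in\mathbb{R}$; $\mathcal{H}\subset\{h=1\}$ is in standard form if in addition $(1,0)\in\mathcal{H}$. For every $p\in\mathcal{H}$ there is $A(p)\in\mathrm{GL}(2)$ with $A(p)(1,0)^T=p$ and $A(p)^*h:=h\circ A(p)$ in standard form; for curves $A(p)$ is unique up to the sign of its second column. If $\mathcal{H}$ is maximal connected in standard form, $\mathrm{dom}(\mathcal{H})\subset\mathbb{R}$ denotes the set of $y\in\mathbb{R}$ with $(1,y)^T\in\mathbb{R}_{>0}\cdot\mathcal{H}$. Limit geometry. Let $\mathcal{H}\subset\{h=1\}$ be a maximal connected quartic GPSR curve. Suppose there are $p\in\mathcal{H}$ and $A(p)\in\mathrm{GL}(2)$ with $A(p)(1,0)^T=p$ and $A(p)^*h=h\circ A(p)$ in standard form, with $\widetilde h:=A(p)^*h$ and $\widetilde{\mathcal{H}}:=A(p)^{-1}(\mathcal{H})$ in standard form, and $v\in\mathbb{R}\setminus\{0\}$, such that the affine curve $\gamma(t)=(1,tv)^T$ satisfies $tv\in\mathrm{dom}(\widetilde{\mathcal{H}})$ for all $t\in[0,1)$ and $\widetilde h(\gamma(1))=0$. For $t\in[0,1)$ let $\widetilde p(t)=\widetilde h(\gamma(t))^{-1/4}\gamma(t)\in\widetilde{\mathcal{H}}$ and let $B(t)\in\mathrm{GL}(2)$ depend continuously on $t$ with $B(0)=\mathrm{id}$, $B(t)(1,0)^T=\widetilde p(t)$ and $B(t)^*\widetilde h$ in standard form. If the limit $\widehat h:=\lim_{t\to1}B(t)^*\widetilde h$ exists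 (in the space of quartic polynomials) and $(1,0)$ is a hyperbolic point of $\widehat h$, then the connected component of $\{\widehat h=1\}\cap\{\text{hyperbolic points of }\widehat h\}$ containing $(1,0)$, and every maximal connected quartic GPSR curve equivalent to it, is called a limit geometry of $\mathcal{H}$. The two directions refer to the two choices of sign of $v$ (for a fixed standard form), i.e. to the two ends of $\mathcal{H}$. *)

(* Defs.v *)
From HB Require Import structures.
From mathcomp Require Import all_boot all_order all_algebra.
From mathcomp Require Import all_classical all_reals all_analysis.

Set Implicit Arguments.
Unset Strict Implicit.
Unset Printing Implicit Defensive.

Import Order.TTheory GRing.Theory Num.Theory.
Import numFieldNormedType.Exports.

Local Open Scope classical_set_scope.
Local Open Scope ring_scope.

Section Defs.
Context {R : realType}.
Implicit Types (h : 'cV[R]_2 -> R) (H G : set 'cV[R]_2) (A : 'M[R]_2).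

Definition pt (x y : R) : 'cV[R]_2 := \col_(i < 2) (if i == 0 then x else y).

(* The quartic \sum_i c_i x^(4-i) y^i; the space of homogeneous quartics is
   identified with 'rV[R]_5 (and topologized) through its coefficients. *)
Definition quartic (c : 'rV[R]_5) : 'cV[R]_2 -> R :=
  fun p => \sum_(i < 5) c 0 i * p 0 0 ^+ (4 - i) * p 1 0 ^+ i.

Definition is_quartic h : Prop := exists c, h = quartic c.

Definition pullback A h : 'cV[R]_2 -> R := fun p => h (A *m p).

Definition hessian h (p : 'cV[R]_2) : 'M[R]_2 :=
  \matrix_(i, j) 'D_(delta_mx i 0) ('D_(delta_mx j 0) h) p.

(* Signature (1,1), through Sylvester's normal form diag(1, -1). *)
Definition lorentzian (M : 'M[R]_2) : Prop :=
  exists2 P : 'M[R]_2, P \in unitmx &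
    P^T *m M *m P = diag_mx (\row_(j < 2) (-1) ^+ j).

Definition hyperbolic_point h (p : 'cV[R]_2) : Prop :=
  lorentzian (- hessian h p).

Definition hyperbolic_level h : set 'cV[R]_2 :=
  [set p | h p = 1 /\ hyperbolic_point h p].

(* H is a maximal connected quartic GPSR curve contained in {h = 1}.  By
   Euler's identity 1 is a regular value of h, and hyperbolicity is an open
   condition, so such a component is a one-dimensional submanifold. *)
Definition maximal_gpsr_of h H : Prop :=
  is_quartic h /\
  exists2 p, hyperbolic_level h p & H = connected_component (hyperbolic_level h) p.

Definition maximal_gpsr H : Prop := exists h, maximal_gpsr_of h H.

Definition equivalent H G : Prop :=
  exists2 A, A \in unitmx & mulmx A @` H = G.

Definition homogeneous H : Prop :=
  forall p q, H p -> H q ->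
    exists A, [/\ A \in unitmx, mulmx A @` H = H & A *m p = q].

Definition std_quartic (L K : R) : 'cV[R]_2 -> R := fun p =>
  let x := p 0 0 in let y := p 1 0 in
  x ^+ 4 - x ^+ 2 * y ^+ 2 + L * x * y ^+ 3 + K * y ^+ 4.

Definition standard_form h : Prop := exists L K, h = std_quartic L K.

Definition curve_through_e1 h : set 'cV[R]_2 :=
  connected_component (hyperbolic_level h) (pt 1 0).

Definition dom H : set R :=
  [set y | exists r p, [/\ 0 < r, H p & pt 1 y = r *: p]].

(* A is a matrix A(p) with p = A (1,0)^T on the curve H in {h = 1}. *)
Definition standard_frame h H A : Prop :=
  [/\ A \in unitmx, H (A *m pt 1 0) & standard_form (pullback A h)].

(* The limit quartic hhat is reached from (h, H), both in standard form, along
   the segment t |-> (1, t v). *)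
Definition limit_quartic h H (v : R) (hhat : 'cV[R]_2 -> R) : Prop :=
  [/\ v != 0,
      forall t : R, 0 <= t < 1 -> dom H (t * v),
      h (pt 1 v) = 0 &
      exists B : R -> 'M[R]_2,
        [/\ {within `[0, 1[, continuous B},
            B 0 = 1%:M,
            forall t : R, 0 <= t < 1 ->
              [/\ B t \in unitmx,
                  B t *m pt 1 0 = h (pt 1 (t * v)) `^ (- 4^-1) *: pt 1 (t * v) &
                  standard_form (pullback (B t) h)] &
            exists (c : R -> 'rV[R]_5) (chat : 'rV[R]_5),
              [/\ forall t : R, 0 <= t < 1 -> pullback (B t) h = quartic (c t),
                  c t @[t --> (1 : R)^'-] --> chat &
                  hhat = quartic chat]]].

(* Relative to the frame A of H, the direction v yields the limit geometry
   given by hhat. *)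
Definition limit_along h H A (v : R) (hhat : 'cV[R]_2 -> R) : Prop :=
  limit_quartic (pullback A h) (mulmx A @^-1` H) v hhat /\
  hyperbolic_point hhat (pt 1 0).

Definition limit_geometries H : set (set 'cV[R]_2) :=
  [set G | maximal_gpsr G /\
     exists h A v hhat,
       [/\ maximal_gpsr_of h H, standard_frame h H A, limit_along h H A v hhat &
           equivalent (curve_through_e1 hhat) G]].

(* The two directions are indexed by bool: true for v > 0, false for v < 0. *)
Definition nb_limit_directions h H A : nat :=
  #|[pred s : bool | `[< exists (v : R) hhat, (0 < v) = s /\ limit_along h H A v hhat >]]|.

(* The number of directions admitting a limit geometry is n, whichever standard
   form of H it is computed in. *)
Definition limit_directions H (n : nat) : Prop :=
  forall h A, maximal_gpsr_of h H -> standard_frame h H A ->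
    nb_limit_directions h H A = n.

Definition curveA : set 'cV[R]_2 := curve_through_e1 (std_quartic 0 (1 / 4)).

Definition curveB : set 'cV[R]_2 :=
  curve_through_e1
    (std_quartic (2 * Num.sqrt 2 / (3 * Num.sqrt 3)) (- (1 / 12))).

Definition constU : R :=
  1 / 24 *
  (4 + (31 + 3 * Num.sqrt 57) * (46 + 6 * Num.sqrt 57) `^ (- (1 / 3))
     + (100 + 12 * Num.sqrt 57) * (46 + 6 * Num.sqrt 57) `^ (- (2 / 3))).

End Defs.

Inductive entry (R : realType) : Type :=
| Case1 | Case2 | Case3 | Case4 of R | Case5 of R | Case6 of R | Case7 | Case8.

Arguments Case1 {R}.
Arguments Case2 {R}.
Arguments Case3 {R}.
Arguments Case7 {R}.
Arguments Case8 {R}.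

Definition admissible (R : realType) (e : entry R) : Prop :=
  match e with
  | Case4 K => K < 1 / 4
  | Case5 K => 1 / 4 < K
  | Case6 K => - (25 / 72) < K < constU
  | _ => True
  end.

Definition entry_curve (R : realType) (e : entry R) : set 'cV[R]_2 :=
  match e with
  | Case1 => curveA
  | Case2 => curveB
  | Case3 => curve_through_e1 (std_quartic (2 / (3 * Num.sqrt 3)) 0)
  | Case4 K => curve_through_e1 (std_quartic 0 K)
  | Case5 K => curve_through_e1 (std_quartic 0 K)
  | Case6 K => curve_through_e1 (std_quartic 1 K)
  | Case7 => curve_through_e1 (std_quartic 1 (- (25 / 72)))
  | Case8 => curve_through_e1 (std_quartic 1 constU)
  end.

(* Main.v *)
(* For the standard form [(L, K)] write [f y = h (1, y)] and
   [w = 3 f'^2 - 4 f f''], so that [(1, y)] is hyperbolic iff [w y > 0] when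
   [f y > 0].  The curve is the radial image of the interval [(a, b)] around [0]
   on which [f, w > 0]; it is bounded because [f^(1/4)] is concave there.  At each
   end either [f] vanishes (a "root end") or [f > 0 = w]; the curve is closed iff
   both ends are root ends.

   With [I] and [J] the classical invariants of the binary quartic, moving to
   the standard form at the point over [y] multiplies [I] by [m^2] and [J] by
   [m^3], where [m = 8 f / w] at [y].  As [(I, J)] determines [(L^2, K)], two
   curves are equivalent iff their invariants are related by a value of [m] on the
   interval, and all questions are about the range of [m].  A syzygy shows that
   the new [L^2] is a cubic polynomial in [m] vanishing exactly where the Jacobian
   covariant [t] of [f] and [w] does, and [m' = 24 t / w^2].  Hence either [L = 0] is
   reached, or [m] is monotone, and intermediate values of [m] give the listed
   normal forms.  At a simple or triple root end the invariants tend to [(0, 0)],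
   which is B; at a double root they tend to [(1/3, -1/27)], which is A. *)
Require Import Defs.
From HB Require Import structures.
From mathcomp Require Import all_boot all_order all_algebra.
From mathcomp Require Import all_classical all_reals all_analysis.
From mathcomp Require Import ring lra.
From mathcomp Require polyrcf.

Set Implicit Arguments.
Unset Strict Implicit.
Unset Printing Implicit Defensive.

Import Order.TTheory GRing.Theory Num.Theory.
Import numFieldNormedType.Exports.

Local Open Scope classical_set_scope.
Local Open Scope ring_scope.

(** * Binary quartics and their Hessians *)

Section Quartics.
Context {R : realType}.
Implicit Types (a b c d e x y : R) (p : 'cV[R]_2) (A : 'M[R]_2).

(** The constants of the list come from [G m = 8/27 - 8/3 I m^2 - 16 J m^3], the new [L^2], and from
    the discriminant [D = I^3 - 27 J^2]. For [L = 1], [J] vanishes at [K = - 25/72] and [D] exactly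
    at [K = U]. Near an end with [f > 0 = w] the value [m] is unbounded, and [G m >= 0] forces
    [J <= 0], that is [K >= - 25/72]. If moreover [D >= 0], then [G <= 0] at its critical point
    [m = - I / (9 J)], a value that [m] takes when the other end is a simple root; as [L = 0] is not
    reached, this excludes [K >= U]. A double root has [D = 0], which gives [K = U]. For [L = 0],
    the identity [w - 8 f = 12 (1 - 4 K) y^2] singles out [K = 1/4]. Two obstacles shape the proof.
    The denominator of [m] may vanish at an end, so [m] is compared with a constant through the
    polynomial [8 f - m w]. And the invariants determine [L] only up to sign, whereas a limit
    geometry needs [L] itself to converge; its sign is that of the polynomial [t], which is constant
    close to an end. *)

Definition qform a b c d e : 'cV[R]_2 -> R := fun p =>
  a * p 0 0 ^+ 4 + b * p 0 0 ^+ 3 * p 1 0 + c * p 0 0 ^+ 2 * p 1 0 ^+ 2 +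
  d * p 0 0 * p 1 0 ^+ 3 + e * p 1 0 ^+ 4.

Definition coef_row a b c d e : 'rV[R]_5 := \row_i [:: a; b; c; d; e]`_i.

Lemma quarticE (c : 'rV[R]_5) :
  quartic c = qform (c 0 0) (c 0 1) (c 0 2) (c 0 3) (c 0 4).
Proof.
apply/funext => p; rewrite /quartic /qform !big_ord_recl big_ord0 /=.
rewrite (_ : lift ord0 (lift ord0 (lift ord0 (lift ord0 ord0))) = 4); last exact/val_inj.
rewrite (_ : lift ord0 (lift ord0 (lift ord0 ord0)) = 3); last exact/val_inj.
rewrite (_ : lift ord0 (lift ord0 ord0) = 2); last exact/val_inj.
rewrite (_ : lift ord0 ord0 = 1); last exact/val_inj.
by rewrite addr0 !addrA /= !expr1 !expr0 !mulr1.
Qed.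

Lemma quartic_coef_row a b c d e : quartic (coef_row a b c d e) = qform a b c d e.
Proof. by rewrite quarticE !mxE. Qed.

Lemma stdE (L K : R) : std_quartic L K = qform 1 0 (-1) L K.
Proof. by apply/funext => p; rewrite /std_quartic /qform; ring. Qed.

Lemma is_quarticP (h : 'cV[R]_2 -> R) :
  is_quartic h <-> exists a b c d e, h = qform a b c d e.
Proof.
split=> [[c ->]|[a [b [c [d [e ->]]]]]]; first by rewrite quarticE; do 5 eexists.
by exists (coef_row a b c d e); rewrite quartic_coef_row.
Qed.

Lemma col2P p : p = pt (p 0 0) (p 1 0).
Proof.
by apply/colP => i; rewrite !mxE; case: i => [[|[|//]] Hi] /=; congr (p _ _); apply: val_inj.
Qed.

Lemma pt0 x y : pt x y 0 0 = x. Proof. by rewrite mxE. Qed.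
Lemma pt1 x y : pt x y 1 0 = y. Proof. by rewrite mxE. Qed.

Lemma mulmx_col2 A p (i : 'I_2) : (A *m p) i 0 = A i 0 * p 0 0 + A i 1 * p 1 0.
Proof.
rewrite mxE big_ord_recl big_ord_recl big_ord0 addr0.
by rewrite (_ : lift ord0 ord0 = 1) //; apply: val_inj.
Qed.

Definition mx2 (a b c d : R) : 'M[R]_2 :=
  \matrix_(i, j) (if i == 0 then if j == 0 then a else b else if j == 0 then c else d).

Lemma mx2_mul a b c d x y : mx2 a b c d *m pt x y = pt (a * x + b * y) (c * x + d * y).
Proof. by rewrite [LHS]col2P !mulmx_col2 !mxE. Qed.

Lemma det2 A : \det A = A 0 0 * A 1 1 - A 0 1 * A 1 0.
Proof.
rewrite (expand_det_row _ 0) big_ord_recl big_ord_recl big_ord0 addr0 /cofactor !det_mx11 !mxE.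
rewrite (_ : lift (lift ord0 ord0) 0 = 0); last exact/val_inj.
rewrite (_ : lift 0 0 = lift ord0 ord0) // (_ : lift ord0 ord0 = 1); last exact/val_inj.
by rewrite /= expr0 expr1; ring.
Qed.

Lemma mx2_det a b c d : \det (mx2 a b c d) = a * d - b * c.
Proof. by rewrite det2 !mxE. Qed.

Lemma mx2E A : A = mx2 (A 0 0) (A 0 1) (A 1 0) (A 1 1).
Proof.
apply/matrixP => i j; rewrite !mxE.
by case: i => [[|[|//]] Hi]; case: j => [[|[|//]] Hj] /=; congr (A _ _); apply: val_inj.
Qed.

Lemma pullback_qform A a b c d e :
  let s := A 0 0 in let t := A 0 1 in let u := A 1 0 in let v := A 1 1 in
  pullback A (qform a b c d e) = qform
   (a*s^+4 + b*s^+3*u + c*s^+2*u^+2 + d*s*u^+3 + e*u^+4)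
   (4*a*s^+3*t + b*(3*s^+2*t*u + s^+3*v) + c*(2*s*t*u^+2 + 2*s^+2*u*v)
     + d*(t*u^+3 + 3*s*u^+2*v) + 4*e*u^+3*v)
   (6*a*s^+2*t^+2 + b*(3*s*t^+2*u + 3*s^+2*t*v) + c*(t^+2*u^+2 + 4*s*t*u*v + s^+2*v^+2)
     + d*(3*t*u^+2*v + 3*s*u*v^+2) + 6*e*u^+2*v^+2)
   (4*a*s*t^+3 + b*(t^+3*u + 3*s*t^+2*v) + c*(2*t^+2*u*v + 2*s*t*v^+2)
     + d*(3*t*u*v^+2 + s*v^+3) + 4*e*u*v^+3)
   (a*t^+4 + b*t^+3*v + c*t^+2*v^+2 + d*t*v^+3 + e*v^+4).
Proof.
cbv zeta; apply/funext => p; rewrite /pullback /qform !mulmx_col2; ring.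
Qed.

(** Reduces partial derivatives on column vectors to derivatives in one real variable, which
    [derive_val] computes automatically. *)
Lemma derive_line (V : normedModType R) (g : V -> R) (v p : V) :
  'D_v g p = 'D_1 (fun t : R => g (t *: v + p)) 0.
Proof.
rewrite /derive.
rewrite (_ : (fun h => h^-1 *: ((g \o shift p) (h *: v) - g p)) =
  (fun h => h^-1 *: (((fun t : R =>
    g (t *: v + p)) \o shift (0 : R)) (h *: (1 : R)) - g (0 *: v + p)))) //.
apply/funext => t /=; congr (_ *: (g _ - g _)); rewrite ?scale0r ?add0r ?addr0 //.
by rewrite /GRing.scale /= mulr1.
Qed.

Lemma line_delta p (i j : 'I_2) (t : R) :
  (t *: delta_mx i 0 + p) j 0 = t * (j == i)%:R + p j 0.
Proof. by rewrite !mxE eqxx andbT. Qed.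

Lemma derive_qform0 a b c d e :
  'D_(delta_mx 0 0) (qform a b c d e) = (fun p =>
  4 * a * p 0 0 ^+ 3 + 3 * b * p 0 0 ^+ 2 * p 1 0 + 2 * c * p 0 0 * p 1 0 ^+ 2
  + d * p 1 0 ^+ 3)%R.
Proof.
apply/funext => p; rewrite derive_line /qform; under eq_fun do rewrite !line_delta /=.
by rewrite derive_val /GRing.scale /=; ring.
Qed.

Lemma derive_qform1 a b c d e :
  'D_(delta_mx 1 0) (qform a b c d e) = (fun p =>
  b * p 0 0 ^+ 3 + 2 * c * p 0 0 ^+ 2 * p 1 0 + 3 * d * p 0 0 * p 1 0 ^+ 2
  + 4 * e * p 1 0 ^+ 3)%R.
Proof.
apply/funext => p; rewrite derive_line /qform; under eq_fun do rewrite !line_delta /=.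
by rewrite derive_val /GRing.scale /=; ring.
Qed.

Lemma derive_cform a b c d (i : 'I_2) p :
  'D_(delta_mx i 0) (fun p : 'cV[R]_2 => a * p 0 0 ^+ 3 + b * p 0 0 ^+ 2 * p 1 0
    + c * p 0 0 * p 1 0 ^+ 2 + d * p 1 0 ^+ 3) p =
  if i == 0 then 3 * a * p 0 0 ^+ 2 + 2 * b * p 0 0 * p 1 0 + c * p 1 0 ^+ 2
  else b * p 0 0 ^+ 2 + 2 * c * p 0 0 * p 1 0 + 3 * d * p 1 0 ^+ 2.
Proof.
rewrite derive_line; under eq_fun do rewrite !line_delta /=.
rewrite derive_val /GRing.scale /=.
by case: i => [[|[|//]] Hi] /=; ring.
Qed.

Lemma hessian_qform a b c d e p :
  hessian (qform a b c d e) p =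
  let x := p 0 0 in let y := p 1 0 in
  let hxy := 3*b*x^+2 + 4*c*x*y + 3*d*y^+2 in
  mx2 (12*a*x^+2 + 6*b*x*y + 2*c*y^+2) hxy hxy (2*c*x^+2 + 6*d*x*y + 12*e*y^+2).
Proof.
rewrite [LHS]mx2E /= !mxE derive_qform0 derive_qform1 !derive_cform /=.
by congr mx2; ring.
Qed.

(** * Signature of symmetric matrices of order two *)

Lemma quadratic_pos_vector (r s t : R) : r * t - s * s < 0 ->
  exists x y, 0 < r * x ^+ 2 + 2 * s * x * y + t * y ^+ 2.
Proof.
move=> D; have [r0|r0|r0] := ltgtP r 0.
- exists (- s / r), 1.
  have -> : r * (- s / r) ^+ 2 + 2 * s * (- s / r) * 1 + t * 1 ^+ 2 = (r * t - s * s) / r.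
    by field; rewrite lt_eqF.
  by rewrite nmulr_rgt0 // invr_lt0.
- by exists 1, 0; lra.
- have s0 : s != 0 by apply/eqP => s0; move: D; rewrite r0 s0 !mul0r subrr ltxx.
  exists ((1 - t) / (2 * s)), 1.
  by rewrite r0 (_ : _ + _ = 1) //; field; rewrite s0.
Qed.

(** Congruence multiplies the determinant by a square, which gives one direction. For the other, a
    vector of positive value and a vector orthogonal to it are rescaled to a Sylvester basis. *)
Lemma lorentzian_mx2 (r s t : R) : lorentzian (mx2 r s s t) <-> r * t - s * s < 0.
Proof.
split=> [[P Pu PM]|D].
  have := congr1 (fun M => \det M) PM.
  rewrite !det_mulmx det_tr mx2_det det2 !mxE /= mulr1n mulr0n expr0 expr1.
  move: Pu; rewrite unitmxE unitfE => Pu E.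
  have : 0 < (\det P) ^+ 2 by rewrite exprn_even_gt0.
  nra.
have [x [y q0]] := quadratic_pos_vector D.
set q := (X in 0 < X) in q0.
set D' := r * t - s * s in D.
have n0 : 0 < - (D' * q) by rewrite oppr_gt0 nmulr_rlt0.
have sq0 : Num.sqrt q != 0 by rewrite sqrtr_eq0 -ltNge.
have sn0 : Num.sqrt (- (D' * q)) != 0 by rewrite sqrtr_eq0 -ltNge.
have qE := sqr_sqrtr (ltW q0); have nE := sqr_sqrtr (ltW n0).
set u := Num.sqrt q in sq0 qE *.
set w := Num.sqrt _ in sn0 nE *.
have qn0 : q != 0 by rewrite gt_eqF.
(* The second column is orthogonal to [(x, y)] for the form; before scaling, its value is
   [D' * q < 0]. *)
exists (mx2 (x / u) (- (s * x + t * y) / w) (y / u) ((r * x + s * y) / w)).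
  rewrite unitmxE unitfE mx2_det.
  rewrite (_ : _ - _ = q / (u * w)); last by rewrite /q; field; rewrite sq0 sn0.
  by rewrite mulf_neq0 // invr_neq0 // mulf_neq0.
rewrite [LHS]mx2E [RHS]mx2E !mxE !big_ord_recl !big_ord0 /= !mxE !big_ord_recl !big_ord0 /= !mxE /=.
rewrite !mulr1n !mulr0n expr0 expr1.
have qe : u^-1 ^+ 2 * q = 1 by rewrite -qE; field.
have ne : w^-1 ^+ 2 * (D' * q) = - 1 by rewrite -[D' * q]opprK -nE; field.
congr mx2; [|ring|ring|].
- by transitivity (u^-1 ^+ 2 * q) => //; rewrite /q; ring.
- by transitivity (w^-1 ^+ 2 * (D' * q)) => //; rewrite /q /D'; ring.
Qed.

Definition neg_hess_det a b c d e p : R :=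
  let x := p 0 0 in let y := p 1 0 in
  (3*b*x^+2 + 4*c*x*y + 3*d*y^+2) ^+ 2 -
  (12*a*x^+2 + 6*b*x*y + 2*c*y^+2) * (2*c*x^+2 + 6*d*x*y + 12*e*y^+2).

Lemma hyperbolic_qform a b c d e p :
  hyperbolic_point (qform a b c d e) p <-> 0 < neg_hess_det a b c d e p.
Proof.
rewrite /hyperbolic_point hessian_qform /=.
set r := 12 * a * _ + _ + _; set s := 3 * b * _ + _ + _; set t := 2 * c * _ + _ + _.
rewrite (_ : - mx2 r s s t = mx2 (- r) (- s) (- s) (- t)); last first.
  by rewrite [LHS]mx2E !mxE.
rewrite lorentzian_mx2 /neg_hess_det -/r -/s -/t.
by rewrite (_ : - r * - t - - s * - s = - (s ^+ 2 - r * t)) ?oppr_lt0 //; ring.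
Qed.
End Quartics.

(** * Pullbacks and equivalence *)

Section Pullbacks.
Context {R : realType}.
Implicit Types (a b c d e x y : R) (p q : 'cV[R]_2) (A : 'M[R]_2).

Lemma qform_inj a b c d e a' b' c' d' e' :
  qform a b c d e = qform a' b' c' d' e' ->
  [/\ a = a', b = b', c = c', d = d' & e = e'].
Proof.
move=> E.
have Ep x y := congr1 (fun h => h (pt x y)) E.
have := (Ep 1 0, Ep 0 1, Ep 1 1, Ep 1 (-1), Ep 1 2).
rewrite /qform !pt0 !pt1 => -[[[[H1 H2] H3] H4] H5].
by split; lra.
Qed.

Lemma neg_hess_det_pullback A a b c d e a' b' c' d' e' p :
  pullback A (qform a b c d e) = qform a' b' c' d' e' ->
  neg_hess_det a' b' c' d' e' p = \det A ^+ 2 * neg_hess_det a b c d e (A *m p).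
Proof.
rewrite pullback_qform det2 => /qform_inj[<- <- <- <- <-].
rewrite /neg_hess_det /= !mulmx_col2.
set s := A 0 0; set t := A 0 1; set u := A 1 0; set v := A 1 1.
set x := p 0 0; set y := p 1 0.
set X := s * x + t * y; set Y := u * x + v * y.
set r0 := 12 * a * X ^+ 2 + _ + _.
set s0 := 3 * b * X ^+ 2 + _ + _.
set t0 := 2 * c * X ^+ 2 + _ + _.
set r1 := 12 * _ * x ^+ 2 + _ + _.
set s1 := 3 * _ * x ^+ 2 + _ + _.
set t1 := 2 * _ * x ^+ 2 + _ + _.
(* The next three equations are the entries of the congruence of Hessians: the new one at [p] is
   [A^T M A], with [M] the old one at [A p]. *)
have -> : r1 = r0 * s ^+ 2 + 2 * s0 * s * u + t0 * u ^+ 2.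
  by rewrite /r1 /r0 /s0 /t0 /X /Y; ring.
have -> : s1 = r0 * s * t + s0 * (s * v + t * u) + t0 * u * v.
  by rewrite /s1 /r0 /s0 /t0 /X /Y; ring.
have -> : t1 = r0 * t ^+ 2 + 2 * s0 * t * v + t0 * v ^+ 2.
  by rewrite /t1 /r0 /s0 /t0 /X /Y; ring.
by ring.
Qed.

Lemma pullback_mul A B (h : 'cV[R]_2 -> R) : pullback A (pullback B h) = pullback (B *m A) h.
Proof. by apply/funext => p; rewrite /pullback mulmxA. Qed.

Lemma pullback1 (h : 'cV[R]_2 -> R) : pullback 1%:M h = h.
Proof. by apply/funext => p; rewrite /pullback mul1mx. Qed.

Lemma is_quartic_pullback A (h : 'cV[R]_2 -> R) : is_quartic h -> is_quartic (pullback A h).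
Proof.
by move=> /is_quarticP[a [b [c [d [e ->]]]]]; apply/is_quarticP; rewrite pullback_qform;
  do 5 eexists.
Qed.

Lemma hyperbolic_level_pullback A (h : 'cV[R]_2 -> R) p : A \in unitmx -> is_quartic h ->
  hyperbolic_level (pullback A h) p <-> hyperbolic_level h (A *m p).
Proof.
move=> Au /is_quarticP[a [b [c [d [e ->]]]]].
rewrite /hyperbolic_level /= /pullback -/(pullback A _).
have E := pullback_qform A a b c d e.
rewrite [in hyperbolic_point _ _]E !hyperbolic_qform (neg_hess_det_pullback _ E).
rewrite pmulr_rgt0 // exprn_even_gt0 //=.
by move: Au; rewrite unitmxE unitfE.
Qed.

Lemma cvg_mx (T : Type) (F : set_system T) {FF : Filter F} m n (M : T -> 'M[R]_(m,
  n)) (N : 'M[R]_(m, n)) :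
  (forall i j, M t i j @[t --> F] --> N i j) -> M t @[t --> F] --> N.
Proof.
move=> H; apply/cvg_ballP => e e0.
have : \forall t \near F, forall i j, ball (N i j) e (M t i j).
  apply: filter_forall => i; apply: filter_forall => j.
  by have /cvg_ballP := H i j; apply.
by apply: filterS => t Ht; split.
Qed.


(** * Linear images of connected components, and equivalence *)

Lemma mulmx_continuous A : continuous (mulmx A : 'cV[R]_2 -> 'cV[R]_2).
Proof.
move=> p; apply: (@cvg_mx _ (nbhs p)) => i j; rewrite ord1 mulmx_col2.
under eq_fun do rewrite mulmx_col2.
by apply: cvgD; apply: cvgMr; apply: coord_continuous.
Qed.

Lemma image_mulmxK A (S : set 'cV[R]_2) : A \in unitmx -> mulmx (invmx A) @` (mulmx A @` S) = S.
Proof. by move=> Au; rewrite image_comp; rewrite (_ : _ \o _ = id) ?image_id //; apply/funext =>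
  p /=; rewrite mulKmx. Qed.

Lemma image_mulmx_preimage A (S : set 'cV[R]_2) : A \in unitmx ->
  mulmx A @` S = mulmx (invmx A) @^-1` S.
Proof.
move=> Au; apply/seteqP; split=> [_ [p Sp <-] /=|p /= Sp]; first by rewrite mulKmx.
by exists (invmx A *m p); rewrite ?mulKVmx.
Qed.

Lemma image_component_sub A (S : set 'cV[R]_2) p : S p ->
  mulmx A @` connected_component S p `<=` connected_component (mulmx A @` S) (A *m p).
Proof.
move=> Sp; apply: connected_component_max.
- by exists p => //; apply: connected_component_refl.
- by apply: image_subset; apply: connected_component_sub.
- apply: connected_continuous_connected; first exact: component_connected.
  by apply: continuous_subspaceT; apply: mulmx_continuous.
Qed.

Lemma image_component A (S : set 'cV[R]_2) p : A \in unitmx -> S p ->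
  mulmx A @` connected_component S p = connected_component (mulmx A @` S) (A *m p).
Proof.
move=> Au Sp; apply/seteqP; split; first exact: image_component_sub.
rewrite [X in _ `<=` X]image_mulmx_preimage // => q Hq.
have HS : (mulmx A @` S) (A *m p) by exists p.
have := @image_component_sub (invmx A) _ _ HS.
rewrite image_mulmxK // mulKmx // => sub.
by rewrite /preimage /=; apply: sub; exists q.
Qed.

Lemma equivalent_refl (H : set 'cV[R]_2) : equivalent H H.
Proof.
exists 1%:M; first exact: unitmx1.
by rewrite (_ : mulmx _ = id) ?image_id //; apply/funext => p; rewrite mul1mx.
Qed.

Lemma equivalent_sym (H G : set 'cV[R]_2) : equivalent H G -> equivalent G H.
Proof. by move=> [A Au <-]; exists (invmx A); rewrite ?unitmx_inv ?image_mulmxK. Qed.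

Lemma equivalent_trans (G H I : set 'cV[R]_2) : equivalent H G -> equivalent G I -> equivalent H I.
Proof.
move=> [A Au <-] [B Bu <-]; exists (B *m A); first by rewrite unitmx_mul Bu.
by rewrite image_comp; congr image; apply/funext => p /=; rewrite mulmxA.
Qed.

Lemma hyperbolic_level_image A (h : 'cV[R]_2 -> R) : A \in unitmx -> is_quartic h ->
  mulmx A @` hyperbolic_level (pullback A h) = hyperbolic_level h.
Proof.
move=> Au hq; apply/seteqP; split=> [_ [p /(hyperbolic_level_pullback _ Au hq) Hp <-] //|p Hp].
exists (invmx A *m p); last by rewrite mulKVmx.
by apply/(hyperbolic_level_pullback _ Au hq); rewrite mulKVmx.
Qed.

(** The matrix is a homeomorphism between the two hyperbolic level sets, so it carries components to
    components, and a component may be named by any of its points. *)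
Lemma frame_image A (h : 'cV[R]_2 -> R) (H : set 'cV[R]_2) :
  A \in unitmx -> maximal_gpsr_of h H -> H (A *m pt 1 0) ->
  mulmx A @` curve_through_e1 (pullback A h) = H.
Proof.
move=> Au [hq [p Hp ->]] HA.
have HA' := connected_component_sub HA.
have HS := (hyperbolic_level_pullback _ Au hq).2 HA'.
rewrite /curve_through_e1 (image_component Au HS) (hyperbolic_level_image Au hq).
exact/esym/same_connected_component.
Qed.

Lemma maximal_gpsr_equivalent (H G : set 'cV[R]_2) :
  maximal_gpsr H -> equivalent H G -> maximal_gpsr G.
Proof.
move=> [h [hq [p Hp ->]]] [A Au <-].
have Au' : invmx A \in unitmx by rewrite unitmx_inv.
exists (pullback (invmx A) h); split; first exact: is_quartic_pullback.
have E : pullback A (pullback (invmx A) h) = h by rewrite pullback_mul mulVmx // pullback1.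
have hq' : is_quartic (pullback (invmx A) h) by exact: is_quartic_pullback.
have lE : mulmx A @` hyperbolic_level h = hyperbolic_level (pullback (invmx A) h).
  by rewrite -(hyperbolic_level_image Au hq') E.
exists (A *m p); first by rewrite -lE; exists p.
by rewrite (image_component Au Hp) lE.
Qed.

End Pullbacks.

(** * Signs of real polynomials *)

Section PolynomialSigns.
Context {R : realType}.
Implicit Types (p : {poly R}) (a b c x y : R).

Lemma poly_ivt_root p a b : a <= b -> p.[a] * p.[b] < 0 ->
  exists2 c, a < c < b & p.[c] = 0.
Proof.
by move=> ab /(polyrcf.poly_ivtoo ab)[c]; rewrite in_itv => /= cab /rootP; exists c.
Qed.

Lemma poly_const_sign p a b : (forall y, a < y < b -> p.[y] != 0) ->
  forall y z, a < y < b -> a < z < b -> 0 < p.[y] -> 0 < p.[z].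
Proof.
move=> H y z /andP[ay yb] /andP[az zb] py; rewrite ltNge; apply/negP => pz.
have {}pz : p.[z] < 0 by rewrite lt_neqAle pz H ?az.
have [yz|zy|yz] := ltgtP y z; last by move: py pz; rewrite yz => /ltW; rewrite leNgt => /negP.
- have [|c /andP[yc cz] /eqP] := poly_ivt_root (ltW yz) (p := p); first by rewrite pmulr_rlt0.
  by apply/negP/H; rewrite (lt_trans ay) ?(lt_trans cz).
- have [|c /andP[yc cz] /eqP] := poly_ivt_root (ltW zy) (p := p); first by rewrite nmulr_rlt0.
  by apply/negP/H; rewrite (lt_trans az) ?(lt_trans cz).
Qed.

Lemma poly_pos_near p x : 0 < p.[x] -> exists2 d, 0 < d & forall y, `|y - x| < d -> 0 < p.[y].
Proof.
move=> px; have [d d0 H] := polyrcf.poly_cont x p px; exists d => // y /H.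
by rewrite ltr_distl subrr => /andP[].
Qed.

Lemma poly_mvt_lt p a b : a < b -> exists2 c, a < c < b & p.[b] - p.[a] = p^`().[c] * (b - a).
Proof. by move=> ab; have [c] := polyrcf.poly_mvt p ab; rewrite in_itv; exists c. Qed.

Lemma poly_down_crossing p x c : p.[x] = 0 -> p^`().[x] < 0 -> x < c ->
  exists2 y, x < y < c & p.[y] < 0.
Proof.
move=> px dpx xc.
have [|d d0 H] := @poly_pos_near (- p^`()) x; first by rewrite hornerN oppr_gt0.
pose y := x + Num.min (d / 2) ((c - x) / 2).
have xy : x < y by rewrite ltrDl lt_min; lra.
have yd : y <= x + d / 2 by rewrite lerD2l ge_min lexx.
have yc : y <= x + (c - x) / 2 by rewrite lerD2l ge_min lexx orbT.
exists y; first by rewrite xy /=; lra.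
have [e /andP[xe ey] E] := poly_mvt_lt p xy.
have := H e; rewrite ger0_norm ?subr_ge0 ?ltW // hornerN oppr_gt0 => He.
have -> : p.[y] = p^`().[e] * (y - x) by rewrite -E px subr0.
by rewrite nmulr_rlt0 ?subr_gt0 // He //; lra.
Qed.

(* Otherwise the last root before [c] would be crossed downwards. *)
Lemma poly_no_up_crossing p x c : p.[x] = 0 -> x < c ->
  (forall y, x <= y < c -> p.[y] = 0 -> p^`().[y] < 0) -> p.[c] <= 0.
Proof.
move=> px xc H; rewrite leNgt; apply/negP => pc.
have p0 : p != 0 by apply: contraTneq pc => ->; rewrite horner0 ltxx.
have [y [/andP[xy yc] py yP]] : exists y, [/\ x <= y < c, p.[y] = 0 & forall z, y < z < c ->
  p.[z] != 0].
  case: (polyrcf.prev_rootP p x c) => [p00|y _ py0 hy hn|y _ yE hn].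
  - by move: p0; rewrite p00 eqxx.
  - exists y; split => //; by move: hy; rewrite in_itv /= => /andP[/ltW -> ->].
  - by exists x; split=> //; rewrite lexx.
have xyc : x <= y < c by rewrite xy.
have [z /andP[yz zc] pz] := poly_down_crossing py (H y xyc py) yc.
have [|w /andP[zw wc] pw] := poly_ivt_root (ltW zc) (p := p); first by rewrite nmulr_rlt0.
by have := yP w; rewrite pw eqxx (lt_trans yz zw) wc => /(_ isT).
Qed.

Lemma poly_first_root p a y : 0 < p.[a] -> a < y -> p.[y] <= 0 ->
  exists b, [/\ a < b, b <= y, p.[b] = 0 & forall z, a <= z < b -> 0 < p.[z]].
Proof.
move=> pa ay py.
have p0 : p != 0 by apply: contraTneq pa => ->; rewrite horner0 ltxx.
have [c /andP[ac cy] pc] : exists2 c, a < c <= y & p.[c] = 0.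
  move: py; rewrite le_eqVlt => /predU1P[py|py]; first by exists y; rewrite ?ay ?lexx.
  have [|c /andP[ac cy] pc] := poly_ivt_root (ltW ay) (p := p); first by rewrite pmulr_rlt0.
  by exists c; rewrite // ac ltW.
have [b [ab bc pb bP]] : exists b, [/\ a < b, b <= c, p.[b] = 0 & forall z, a < z < b ->
  p.[z] != 0].
  case: (polyrcf.next_rootP p a c) => [p00|b _ pb hb hn|b _ bE hn].
  - by move: p0; rewrite p00 eqxx.
  - by exists b; move: hb; rewrite in_itv /= => /andP[ab bc]; split => //; exact: ltW.
  - by exists c.
exists b; split=> //; first exact: le_trans cy.
move=> z /andP[az zb]; move: az; rewrite le_eqVlt => /predU1P[<- //|az].
rewrite ltNge; apply/negP => pz.
have {}pz : p.[z] < 0 by rewrite lt_neqAle pz bP ?az.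
have [|w /andP[aw wz] pw] := poly_ivt_root (ltW az) (p := p); first by rewrite pmulr_rlt0.
by have := bP w; rewrite pw eqxx aw (lt_trans wz zb) => /(_ isT).
Qed.

Lemma poly_eq_on_itv p q a b : a < b -> (forall y, a < y < b -> p.[y] = q.[y]) -> p = q.
Proof.
move=> ab H; apply/eqP; rewrite -subr_eq0; apply/negPn/negP => n0.
(* As many points as the size of the difference, which exceeds its possible number of roots; the
   shift by [2] keeps them strictly inside the interval. *)
pose rs := [seq a + (b - a) / (i%:R + 2) | i <- iota 0 (size (p - q))].
suff : (size rs < size (p - q)%R)%N by rewrite size_map size_iota ltnn.
apply: max_poly_roots n0 _ _; last first.
  rewrite map_inj_uniq ?iota_uniq // => i j /addrI /mulfI.
  rewrite subr_eq0 gt_eqF // => /(_ isT) /invr_inj /addIr /eqP.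
  by rewrite eqr_nat => /eqP.
apply/allP => _ /mapP[i _ ->]; apply/rootP; rewrite hornerD hornerN H ?subrr //.
have i0 : 0 <= i%:R :> R by [].
rewrite ltrDl divr_gt0 ?subr_gt0 /=; [|by []|lra].
rewrite -ltrBrDl ltr_pdivrMr; [|lra].
by rewrite ltr_pMr ?subr_gt0 //; lra.
Qed.
End PolynomialSigns.

(** * The affine quartic and its interval of hyperbolicity *)

Section AffineQuartic.
Context {R : realType}.
Implicit Types (L K x y : R).

Definition fq L K y : R := 1 - y ^+ 2 + L * y ^+ 3 + K * y ^+ 4.
Definition fq1 L K y : R := - 2 * y + 3 * L * y ^+ 2 + 4 * K * y ^+ 3.
Definition fq2 L K y : R := - 2 + 6 * L * y + 12 * K * y ^+ 2.
Definition fq3 L K y : R := 6 * L + 24 * K * y.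

(* [wq = 3 f'^2 - 4 f f''] is, up to a factor, minus the determinant of the
   Hessian of the quartic at [(1, y)], and [tq = (f' w - f w') / 3] is the
   Jacobian covariant. *)
Definition wq L K y : R :=
  8 - 24 * L * y + (4 - 48 * K) * y ^+ 2 - 4 * L * y ^+ 3 + (3 * L ^+ 2 + 8 * K) * y ^+ 4.
Definition wq1 L K y : R :=
  - 24 * L + 2 * (4 - 48 * K) * y - 12 * L * y ^+ 2 + 4 * (3 * L ^+ 2 + 8 * K) * y ^+ 3.
Definition tq L K y : R := (fq1 L K y * wq L K y - fq L K y * wq1 L K y) / 3.

Definition invI L K : R := K + 1 / 12.
Definition invJ L K : R := 1 / 216 - K / 6 - L ^+ 2 / 16.

Lemma wqE L K y : wq L K y = 3 * fq1 L K y ^+ 2 - 4 * fq L K y * fq2 L K y.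
Proof. by rewrite /wq /fq /fq1 /fq2; ring. Qed.

(** This is [b^3 - 4 a b c + 8 a^2 d] in the Taylor coefficients of [f] at [y], the form in which
    [pullback_normalize] produces the new [L]. *)
Lemma tqE L K y : let f := fq L K y in let f1 := fq1 L K y in
  tq L K y = f1 ^+ 3 - 2 * f * f1 * fq2 L K y + 4 / 3 * f ^+ 2 * fq3 L K y.
Proof. by rewrite /tq /wq /wq1 /fq /fq1 /fq2 /fq3 /=; field. Qed.

(** The classical relation between a quartic, its Hessian covariant and its Jacobian covariant.
    Divided by [w^3], it becomes a polynomial identity in [m = 8 f / w]. *)
Lemma syzygy L K y : 8 * tq L K y ^+ 2 = 8 / 27 * wq L K y ^+ 3
  - 512 / 3 * invI L K * fq L K y ^+ 2 * wq L K y - 8192 * invJ L K * fq L K y ^+ 3.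
Proof. by rewrite /tq /wq /wq1 /fq /fq1 /invI /invJ; field. Qed.

(** * The same functions as polynomials *)

Definition fpol L K : {poly R} := 1 - 'X^2 + L *: 'X^3 + K *: 'X^4.
Definition wpol L K : {poly R} :=
  8%:P - (24 * L) *: 'X + (4 - 48 * K) *: 'X^2 - (4 * L) *: 'X^3 + (3 * L ^+ 2 + 8 * K) *: 'X^4.
Definition tpol L K : {poly R} :=
  3^-1 *: ((fpol L K)^`() * wpol L K - fpol L K * (wpol L K)^`()).

Lemma horner_fpol L K y : (fpol L K).[y] = fq L K y.
Proof. by rewrite /fpol /fq !hornerE; ring. Qed.
Lemma horner_wpol L K y : (wpol L K).[y] = wq L K y.
Proof. by rewrite /wpol /wq !hornerE; ring. Qed.
Lemma horner_fpol1 L K y : (fpol L K)^`().[y] = fq1 L K y.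
Proof. rewrite /fpol /fq1 !poly.derivE. rewrite !hornerE /=. ring. Qed.
Lemma horner_fpol2 L K y : (fpol L K)^`()^`().[y] = fq2 L K y.
Proof. by rewrite /fpol /fq2 !(poly.derivE, hornerE) /=; ring. Qed.
Lemma horner_wpol1 L K y : (wpol L K)^`().[y] = wq1 L K y.
Proof. by rewrite /wpol /wq1 !(poly.derivE, hornerE) /=; ring. Qed.
Lemma horner_tpol L K y : (tpol L K).[y] = tq L K y.
Proof.
rewrite /tpol hornerZ hornerD hornerN !hornerM horner_wpol horner_fpol.
by rewrite horner_fpol1 horner_wpol1 mulrC.
Qed.

Definition fqw_horner := (horner_fpol, horner_wpol, horner_fpol1, horner_fpol2, horner_wpol1,
  horner_tpol).

Lemma fqN L K y : fq (- L) K y = fq L K (- y).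
Proof. by rewrite /fq; ring. Qed.
Lemma wqN L K y : wq (- L) K y = wq L K (- y).
Proof. by rewrite /wq; ring. Qed.
Lemma tqN L K y : tq (- L) K y = - tq L K (- y).
Proof. by rewrite /tq /fq /wq /fq1 /wq1; field. Qed.
Lemma fq0 L K : fq L K 0 = 1.
Proof. by rewrite /fq; ring. Qed.
Lemma wq0 L K : wq L K 0 = 8.
Proof. by rewrite /wq; ring. Qed.

(* [f^(1/4)] is strictly concave where [f, w > 0] and has a critical point at
   [0], so it cannot stay positive on a half-line. Concretely,
   [q = (c - y) f' + 4 f] vanishes at [y0] if [c] is the zero of the tangent to
   [f^(1/4)] at [y0], and [4 f q' < 3 f' q] prevents [q] from vanishing upwards. *)
Lemma hyperbolic_bounded L K : exists2 y, 0 < y & fq L K y <= 0 \/ wq L K y <= 0.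
Proof.
apply: contrapT => N.
have H y : ~ (0 < y /\ (fq L K y <= 0 \/ wq L K y <= 0)) by move=> [y0 h]; apply: N; exists y.
have fpos y : 0 <= y -> 0 < fq L K y.
  rewrite le_eqVlt => /predU1P[<-|y0]; first by rewrite fq0.
  by rewrite ltNge; apply/negP => fy; apply: (H y); split=> //; left.
have wpos y : 0 <= y -> 0 < wq L K y.
  rewrite le_eqVlt => /predU1P[<-|y0]; first by rewrite wq0.
  by rewrite ltNge; apply/negP => wy; apply: (H y); split=> //; right.
(* [f'] vanishes at [0] and [f''] is [- 2] there, so [f'] is negative somewhere to the right. *)
have [|||y0 /andP[y00 _] dy0] := @poly_down_crossing R (fpol L K)^`() 0 1.
- by rewrite fqw_horner /fq1; ring.
- by rewrite fqw_horner /fq2; lra.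
- by [].
rewrite fqw_horner in dy0.
pose c := y0 - 4 * fq L K y0 / fq1 L K y0.
have dn0 : fq1 L K y0 != 0 by rewrite lt_eqF.
have y0c : y0 < c.
  by rewrite ltrDl oppr_gt0 nmulr_llt0 ?invr_lt0 // mulr_gt0 ?fpos // ltW.
have c0 : 0 < c by exact: lt_trans y0c.
pose q := (c%:P - 'X) * (fpol L K)^`() + 4%:P * fpol L K.
have qE y : q.[y] = (c - y) * fq1 L K y + 4 * fq L K y.
  by rewrite /q hornerD !hornerM hornerD hornerN !hornerC hornerX !fqw_horner.
have q1E y : q^`().[y] = (c - y) * fq2 L K y + 3 * fq1 L K y.
  have -> : q^`() = (c%:P - 'X) * (fpol L K)^`()^`() + 3%:P * (fpol L K)^`().
    by rewrite /q !poly.derivE (_ : 4%:P = 3%:P + 1) ?polyCD //; ring.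
  by rewrite hornerD !hornerM hornerD hornerN !hornerC hornerX !fqw_horner.
have := @poly_no_up_crossing R q y0 c.
rewrite qE; have -> : (c - y0) * fq1 L K y0 + 4 * fq L K y0 = 0 by rewrite /c; field.
move=> /(_ erefl y0c); rewrite qE subrr mul0r add0r => Hq.
have : 4 * fq L K c <= 0; last by have := fpos c (ltW c0); lra.
apply: Hq => y /andP[y0y yc]; rewrite qE q1E => qy.
have f0 := fpos y (ltW (lt_le_trans y00 y0y)).
have := wpos y (ltW (lt_le_trans y00 y0y)); rewrite wqE => w0.
have cy : 0 < c - y by rewrite subr_gt0.
have E : 4 * fq L K y * ((c - y) * fq2 L K y + 3 * fq1 L K y) =
  - (c - y) * (3 * fq1 L K y ^+ 2 - 4 * fq L K y * fq2 L K y).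
  have -> : 4 * fq L K y = - ((c - y) * fq1 L K y) by lra.
  ring.
rewrite -(pmulr_rlt0 _ (_ : 0 < 4 * fq L K y)); last by lra.
by rewrite E mulNr oppr_lt0 mulr_gt0.
Qed.

(** The end is the least positive zero of the product [f w]. Before it neither factor vanishes, so
    each keeps its positive sign from [0]. *)
Lemma right_end L K : exists b, [/\ 0 < b,
  forall y, 0 <= y < b -> 0 < fq L K y /\ 0 < wq L K y,
  0 <= fq L K b, 0 <= wq L K b & fq L K b * wq L K b = 0].
Proof.
have [y y0 fwy] := hyperbolic_bounded L K.
(* The product is positive only if both factors are negative at [y]; a zero of one of them before
   [y] then replaces [y]. *)
wlog fwy' : y y0 fwy / fq L K y * wq L K y <= 0.
  move=> W; have [fw|/ltW fw] := lerP (fq L K y * wq L K y) 0; first exact: W fw.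
  have pk p z : 0 < p.[0] -> 0 < z -> p.[z] <= 0 -> exists2 t : R, 0 < t & p.[t] = 0.
    by move=> h1 h2 h3; have [b [b0 _ pb _]] := poly_first_root h1 h2 h3; exists b.
  case: fwy => fwy.
    have [||t t0] := pk (fpol L K) y _ y0; rewrite ?fqw_horner ?fq0 // => ft.
    by apply: (W t) => //; rewrite ft; [left|rewrite mul0r].
  have [||t t0] := pk (wpol L K) y _ y0; rewrite ?fqw_horner ?wq0 // => wt.
  by apply: (W t) => //; rewrite wt; [right|rewrite mulr0].
have [|||b [b0 _ pb bP]] := @poly_first_root R (fpol L K * wpol L K) 0 y.
- by rewrite hornerM !fqw_horner fq0 wq0; lra.
- by [].
- by rewrite hornerM !fqw_horner.
have pos p : 0 < p.[0] -> (forall z, 0 <= z < b -> p.[z] != 0) -> (forall z, 0 <= z < b ->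
  0 < p.[z]) /\ 0 <= p.[b].
  move=> p0 pn; split=> [z /andP[z0 zb]|].
    rewrite ltNge; apply/negP => pz.
    have z0' : 0 < z by rewrite lt_neqAle z0 andbT; apply/eqP => z0'; move: p0 pz;
      rewrite -z0' ltNge => /negP.
    have [t [t0 tz pt _]] := poly_first_root p0 z0' pz.
    by have := pn t; rewrite pt eqxx ltW //= (le_lt_trans tz) // => /(_ isT).
  rewrite leNgt; apply/negP => pz.
  have [t [t0 tz pt _]] := poly_first_root p0 b0 (ltW pz).
  have tb : t < b by rewrite lt_neqAle tz andbT; apply/eqP => tb; move: pz; rewrite -tb pt ltxx.
  by have := pn t; rewrite pt eqxx ltW //= tb => /(_ isT).
have [|z zb|fpos fb] := pos (fpol L K); first by rewrite fqw_horner fq0.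
  by have := bP z zb; rewrite hornerM; apply: contraTneq => ->; rewrite mul0r ltxx.
have [|z zb|wpos wb] := pos (wpol L K); first by rewrite fqw_horner wq0.
  by have := bP z zb; rewrite hornerM; apply: contraTneq => ->; rewrite mulr0 ltxx.
exists b; split => //.
- by move=> z zb; move: (fpos z zb) (wpos z zb); rewrite !fqw_horner.
- by rewrite -horner_fpol.
- by rewrite -horner_wpol.
- by move: pb; rewrite hornerM !fqw_horner.
Qed.

(* [a < 0 < b] are the ends of the interval [dom] of the curve of [(L, K)]. *)
Definition ends L K a b : Prop := [/\ a < 0 < b,
  forall y, a < y < b -> 0 < fq L K y /\ 0 < wq L K y,
  [/\ 0 <= fq L K a, 0 <= wq L K a & fq L K a * wq L K a = 0] &
  [/\ 0 <= fq L K b, 0 <= wq L K b & fq L K b * wq L K b = 0]].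

(** The left end is the reflection of the right end for [(- L, K)]. *)
Lemma ends_exist L K : exists a b, ends L K a b.
Proof.
have [b [b0 bP fb wb fwb]] := right_end L K.
have [a [a0 aP fa wa fwa]] := right_end (- L) K.
exists (- a), b; split=> //; first by rewrite oppr_lt0 a0.
  move=> y /andP[ay yb]; have [y0|y0] := lerP 0 y; first by apply: bP; rewrite y0.
  have := aP (- y); rewrite fqN wqN opprK; apply.
  by rewrite oppr_ge0 ltW //= ltrNl.
by rewrite -fqN -wqN.
Qed.

Lemma endsN L K a b : ends L K a b -> ends (- L) K (- b) (- a).
Proof.
move=> [/andP[a0 b0] H Ha Hb]; split; rewrite ?fqN ?wqN ?opprK //.
  by rewrite oppr_lt0 oppr_gt0 a0 b0.
by move=> y /andP[by' ya]; rewrite fqN wqN; apply: H; rewrite ltrNr ltrNl ya by'.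
Qed.
End AffineQuartic.

(** * Curves in standard form *)

Section StandardCurve.
Context {R : realType}.
Implicit Types (L K x y a b : R) (p : 'cV[R]_2).

Definition std_curve L K : set 'cV[R]_2 := curve_through_e1 (std_quartic L K).

Lemma std_quartic_ray L K x y : std_quartic L K (pt x (x * y)) = x ^+ 4 * fq L K y.
Proof. by rewrite /std_quartic /fq !pt0 !pt1; ring. Qed.

Lemma std_quartic1 L K y : std_quartic L K (pt 1 y) = fq L K y.
Proof. by rewrite /std_quartic /fq !pt0 !pt1; ring. Qed.

Lemma neg_hess_det_std L K x y : neg_hess_det 1 0 (-1) L K (pt x (x * y)) = x ^+ 4 * (3 * wq L K y).
Proof. by rewrite /neg_hess_det /wq !pt0 !pt1; ring. Qed.

Lemma ray_pt p : p 0 0 != 0 -> p = pt (p 0 0) (p 0 0 * (p 1 0 / p 0 0)).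
Proof. by move=> p0; rewrite [LHS]col2P mulrC divfK. Qed.

Lemma hyperbolic_level_ray L K x y : 0 < x -> 0 < fq L K y -> 0 < wq L K y ->
  x ^+ 4 * fq L K y = 1 -> hyperbolic_level (std_quartic L K) (pt x (x * y)).
Proof.
move=> x0 f0 w0 E; split; first by rewrite std_quartic_ray.
by rewrite stdE hyperbolic_qform neg_hess_det_std; apply: mulr_gt0; [exact: exprn_gt0|lra].
Qed.

Lemma hyperbolic_level_e1 L K : hyperbolic_level (std_quartic L K) (pt 1 0).
Proof.
rewrite -[X in pt 1 X](mulr0 1); apply: hyperbolic_level_ray; rewrite ?fq0 ?wq0 //.
by rewrite expr1n mulr1.
Qed.

Lemma std_curve_e1 L K : std_curve L K (pt 1 0).
Proof. exact/connected_component_refl/hyperbolic_level_e1. Qed.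

Lemma std_maximal L K : maximal_gpsr_of (std_quartic L K) (std_curve L K).
Proof.
split; first by apply/is_quarticP; rewrite stdE; do 5 eexists.
by exists (pt 1 0) => //; apply: hyperbolic_level_e1.
Qed.

(** The factor [f^(-1/4)] that moves [(1, y)] along its ray onto [{h = 1}]. Iterated square roots
    make its fourth power and its continuity elementary. *)
Definition phi L K y : R := (Num.sqrt (Num.sqrt (fq L K y)))^-1.

Lemma phi_gt0 L K y : 0 < fq L K y -> 0 < phi L K y.
Proof. by move=> f0; rewrite invr_gt0 !sqrtr_gt0. Qed.

Lemma phi4 L K y : 0 < fq L K y -> phi L K y ^+ 4 * fq L K y = 1.
Proof.
move=> f0; rewrite /phi exprVn (_ : 4 = 2 * 2)%N // exprM !sqr_sqrtr ?sqrtr_ge0 ?ltW //.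
by rewrite mulVf // gt_eqF.
Qed.

Lemma phi_powR L K y : 0 < fq L K y -> fq L K y `^ (- 4^-1) = phi L K y.
Proof.
move=> f0; rewrite powRN /phi (_ : 4^-1 = 2^-1 * 2^-1); last by field.
by rewrite powRrM !powR12_sqrt ?sqrtr_ge0 ?ltW.
Qed.

Lemma phi_unique L K x y : 0 < x -> 0 < fq L K y -> x ^+ 4 * fq L K y = 1 -> x = phi L K y.
Proof.
move=> x0 f0 E; apply/eqP; rewrite -(@eqrXn2 _ 4) // ?ltW ?phi_gt0 //.
by rewrite -(inj_eq (mulIf (lt0r_neq0 f0))) E phi4.
Qed.

Lemma fq_continuous L K : continuous (fq L K).
Proof.
rewrite (_ : fq L K = horner (fpol L K)); last by apply/funext => y; rewrite horner_fpol.
exact: continuous_horner.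
Qed.

Lemma wq_continuous L K : continuous (wq L K).
Proof.
rewrite (_ : wq L K = horner (wpol L K)); last by apply/funext => y; rewrite horner_wpol.
exact: continuous_horner.
Qed.

Lemma phi_continuous L K y : 0 < fq L K y -> phi L K z @[z --> y] --> phi L K y.
Proof.
move=> f0; apply: cvgV; first by rewrite gt_eqF // !sqrtr_gt0.
apply: continuous_cvg; first exact: sqrt_continuous.
apply: continuous_cvg; first exact: sqrt_continuous.
exact: fq_continuous.
Qed.

Lemma lin_continuous u v : continuous (fun p : 'cV[R]_2 => u * p 0 0 + v * p 1 0).
Proof.
move=> p; apply: (@continuousD _ _ _ (fun q : 'cV[R]_2 => u * q 0 0) (fun q : 'cV[R]_2 =>
  v * q 1 0)).
  by apply: (@continuousM _ _ (fun=> u)); [exact: cst_continuous|exact: coord_continuous].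
by apply: (@continuousM _ _ (fun=> v)); [exact: cst_continuous|exact: coord_continuous].
Qed.

Lemma open_lin u v : open [set p : 'cV[R]_2 | 0 < u * p 0 0 + v * p 1 0].
Proof. exact: ((continuousP _).1 (@lin_continuous u v) _ (@open_gt _ 0)). Qed.

Lemma closed_lin u v : closed [set p : 'cV[R]_2 | 0 <= u * p 0 0 + v * p 1 0].
Proof. exact: ((continuous_closedP _).1 (@lin_continuous u v) _ (@closed_ge _ 0)). Qed.

(** The radial image of the interval is connected and contains [(1, 0)], so it lies in the
    component. Conversely, the open cone over the interval and its closure cut out the same part of
    the component, which is thus open and closed in it. *)
Lemma std_curveP L K a b p : ends L K a b ->
  std_curve L K p <-> [/\ 0 < p 0 0, a * p 0 0 < p 1 0 < b * p 0 0 & std_quartic L K p = 1].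
Proof.
move=> [/andP[a0 b0] fw [fa wa fwa] [fb wb fwb]]; split; last first.
  move=> [x0 /andP[ay yb] hp].
  have xn0 := lt0r_neq0 x0.
  pose y := p 1 0 / p 0 0.
  have ayb : a < y < b by rewrite ltr_pdivlMr // ltr_pdivrMr // ay yb.
  have yE := ray_pt xn0.
  have [f0 w0] := fw y ayb.
  have xE : p 0 0 = phi L K y.
    by apply: phi_unique => //; rewrite -std_quartic_ray -yE.
  pose g z := pt (phi L K z) (phi L K z * z).
  have -> : p = g y by rewrite yE {1 2}xE.
  have : g @` [set` `]a, b[] `<=` std_curve L K.
    apply: connected_component_max.
    - exists 0; first by rewrite /= in_itv /= a0 b0.
      by rewrite /g /phi fq0 !sqrtr1 invr1 mul1r.
    - move=> q [z /=]; rewrite in_itv /= => /fw[fz wz] <-.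
      by apply: hyperbolic_level_ray; rewrite ?phi_gt0 ?phi4.
    - apply: connected_continuous_connected; first exact/connected_intervalP/interval_is_interval.
      apply: continuous_in_subspaceT => z; rewrite inE /= in_itv /= => /fw[fz wz].
      apply: (@cvg_mx _ _ (nbhs z)) => i j; rewrite ord1 mxE.
      under eq_fun do rewrite mxE.
      case: (i == 0); first exact: phi_continuous.
      by apply: cvgM; [exact: phi_continuous|exact: cvg_id].
  by apply; exists y; rewrite //= in_itv.
pose U := [set p : 'cV[R]_2 | [/\ 0 < p 0 0, a * p 0 0 < p 1 0 & p 1 0 < b * p 0 0]].
pose V := [set p : 'cV[R]_2 | [/\ 0 <= p 0 0, a * p 0 0 <= p 1 0 & p 1 0 <= b * p 0 0]].
have lvl q : std_curve L K q -> hyperbolic_level (std_quartic L K) q.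
  exact: connected_component_sub.
(* On the boundary rays [f w = 0] and at the vertex [h = 0], so the level set meets neither. *)
have UV : std_curve L K `&` U = std_curve L K `&` V.
  apply/seteqP; split=> q [Cq [q0 qa qb]]; split => //; first by split; exact: ltW.
  have [hq hypq] := lvl q Cq.
  move: hypq; rewrite stdE hyperbolic_qform => hypq.
  have q00 : 0 < q 0 0.
    rewrite lt_neqAle q0 andbT; apply/eqP => q00.
    have q10 : q 1 0 = 0 by move: qa qb; rewrite -q00 !mulr0 => h1 h2; apply/le_anti; rewrite h1 h2.
    by move: hq; rewrite /std_quartic -q00 q10; lra.
  have E := ray_pt (lt0r_neq0 q00).
  have {}hq : q 0 0 ^+ 4 * fq L K (q 1 0 / q 0 0) = 1 by rewrite -std_quartic_ray -E.
  have {}hypq : 0 < 3 * wq L K (q 1 0 / q 0 0).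
    rewrite -(pmulr_rgt0 _ (exprn_gt0 4 q00)) -neg_hess_det_std -E //.
  have q4 : 0 < q 0 0 ^+ 4 by rewrite exprn_gt0.
  have hf : 0 < fq L K (q 1 0 / q 0 0) by rewrite -(pmulr_rgt0 _ q4) hq.
  have hw' : 0 < wq L K (q 1 0 / q 0 0) by lra.
  split => //; rewrite lt_neqAle ?qa ?qb andbT; apply/eqP => qE.
    by have := mulr_gt0 hf hw'; rewrite -qE mulfK ?lt0r_neq0 // fwa ltxx.
  by have := mulr_gt0 hf hw'; rewrite qE mulfK ?lt0r_neq0 // fwb ltxx.
have : std_curve L K `&` U = std_curve L K.
  apply: (component_connected (A := hyperbolic_level (std_quartic L K)) (x := pt 1 0)).
  - by exists (pt 1 0); split; [exact: std_curve_e1|rewrite /U /= pt0 pt1 !mulr1].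
  - exists U => //.
    rewrite (_ : U = [set p | 0 < 1 * p 0 0 + 0 * p 1 0] `&`
      ([set p | 0 < - a * p 0 0 + 1 * p 1 0] `&` [set p | 0 < b * p 0 0 + (-1) * p 1 0])).
      by apply: openI; [|apply: openI]; exact: open_lin.
    by apply/seteqP; split => q /= [h1]; [move=> h2 h3; split; last split|move=> [h2 h3]; split];
      lra.
  - exists V => //.
    rewrite (_ : V = [set p | 0 <= 1 * p 0 0 + 0 * p 1 0] `&`
      ([set p | 0 <= - a * p 0 0 + 1 * p 1 0] `&` [set p | 0 <= b * p 0 0 + (-1) * p 1 0])).
      by apply: closedI; [|apply: closedI]; exact: closed_lin.
    by apply/seteqP; split => q /= [h1]; [move=> h2 h3; split; last split|move=> [h2 h3]; split];
      lra.
move=> <- [Cp [h1 h2 h3]]; split=> //; first by rewrite h2.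
by have [] := lvl p Cp.
Qed.

Lemma std_curve_ray L K a b y : ends L K a b -> a < y < b ->
  std_curve L K (pt (phi L K y) (phi L K y * y)).
Proof.
move=> E yab; have [_ fw _ _] := E; have [f0 w0] := fw y yab.
apply/(std_curveP _ E); rewrite pt0 pt1 std_quartic_ray phi4 ?phi_gt0 //.
by split=> //; rewrite ![_ * phi _ _ _]mulrC !ltr_pM2l ?phi_gt0.
Qed.

Lemma dom_std_curve L K a b : ends L K a b -> dom (std_curve L K) = [set y | a < y < b].
Proof.
move=> E; apply/seteqP; split=> y.
  move=> [r [p [r0 /(std_curveP _ E)[p0 pab _] yE]]].
  have h0 := congr1 (fun q : 'cV[R]_2 => q 0 0) yE; have h1 := congr1 (fun q : 'cV[R]_2 =>
    q 1 0) yE.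
  move: h0 h1; rewrite !mxE /= => h0 -> /=.
  rewrite -(ltr_pM2l r0) -[X in _ && X](ltr_pM2l r0) in pab.
  by move: pab; rewrite !mulrA ![r * _]mulrC -!mulrA -h0 !mulr1.
move=> /= yab; have [_ fw _ _] := E; have [f0 w0] := fw y yab.
exists (phi L K y)^-1, (pt (phi L K y) (phi L K y * y)); split.
- by rewrite invr_gt0 phi_gt0.
- exact: std_curve_ray E yab.
- apply/colP => i; rewrite !mxE; case: (i == 0); first by rewrite mulVf // lt0r_neq0 ?phi_gt0.
  by rewrite mulKf // lt0r_neq0 ?phi_gt0.
Qed.

Lemma std_quartic_continuous L K : continuous (std_quartic L K).
Proof.
have c i : continuous (fun p : 'cV[R]_2 => p i 0) by exact: coord_continuous.
have cC (x : R) : continuous (fun p : 'cV[R]_2 => x) by exact: cst_continuous.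
have cM (f g : 'cV[R]_2 -> R) : continuous f -> continuous g -> continuous (fun p => f p * g p).
  by move=> fc gc p; apply: (@continuousM _ _ f g); [exact: fc|exact: gc].
have cD (f g : 'cV[R]_2 -> R) : continuous f -> continuous g -> continuous (fun p => f p + g p).
  by move=> fc gc p; apply: (@continuousD _ _ _ f g); [exact: fc|exact: gc].
have cB (f g : 'cV[R]_2 -> R) : continuous f -> continuous g -> continuous (fun p => f p - g p).
  by move=> fc gc p; apply: (@continuousB _ _ _ f g); [exact: fc|exact: gc].
have cX i n : continuous (fun p : 'cV[R]_2 => p i 0 ^+ n).
  elim: n => [|n IH]; first exact: cC.
  rewrite (_ : (fun p : 'cV[R]_2 => _) = (fun p => p i 0 * p i 0 ^+ n)); first exact: cM.
  by apply/funext => p; rewrite exprS.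
apply: (cD _ _ _ (cM _ _ (cC K) (cX 1 4%N))).
apply: (cD _ _ _ (cM _ _ (cM _ _ (cC L) (c 0)) (cX 1 3%N))).
exact: (cB _ _ (cX 0 4%N) (cM _ _ (cX 0 2%N) (cX 1 2%N))).
Qed.

(** If [f] vanishes at an end, the boundary ray misses [{h = 1}], and the strict cone conditions may
    be relaxed to closed ones. If [f > 0] there, the point over the end is a limit of points of the
    curve without lying on it. *)
Lemma closed_std_curve L K a b : ends L K a b ->
  closed (std_curve L K) <-> fq L K a = 0 /\ fq L K b = 0.
Proof.
move=> E; have [/andP[a0 b0] fw [fa wa fwa] [fb wb fwb]] := E; split; last first.
  move=> [fa0 fb0].
  rewrite (_ : std_curve L K = [set p : 'cV[R]_2 | 0 <= 1 * p 0 0 + 0 * p 1 0] `&`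
      ([set p : 'cV[R]_2 | 0 <= - a * p 0 0 + 1 * p 1 0] `&` [set p : 'cV[R]_2 | 0 <= b * p 0 0 + (-1) * p 1 0]) `&`
      (std_quartic L K @^-1` [set 1])).
    apply: closedI; first by apply: closedI; [|apply: closedI]; exact: closed_lin.
    exact: ((continuous_closedP _).1 (@std_quartic_continuous L K) _ (@closed_eq _ 1)).
  apply/seteqP; split=> [p /(std_curveP _ E)[p0 /andP[pa pb] hp]|p [/= [p0 [pa pb]] hp]].
    by split => //=; split; [|split]; lra.
  apply/(std_curveP _ E).
  have p00 : 0 < p 0 0.
    rewrite lt_neqAle; apply/andP; split; last by lra.
    apply/eqP => p00; have p10 : p 1 0 = 0 by apply/le_anti; rewrite -p00 in pa pb; lra.
    by move: hp; rewrite /std_quartic -p00 p10; lra.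
  have pE := ray_pt (lt0r_neq0 p00).
  have rE z : p 1 0 = z * p 0 0 -> std_quartic L K p = p 0 0 ^+ 4 * fq L K z.
    by move=> zE; rewrite {1}pE std_quartic_ray zE mulfK ?lt0r_neq0.
  split=> //; apply/andP; split; rewrite lt_neqAle; apply/andP; split; try lra; apply/eqP => /esym.
    by move=> /rE; rewrite hp fa0 mulr0 => /eqP; rewrite oner_eq0.
  by move=> /esym /rE; rewrite hp fb0 mulr0 => /eqP; rewrite oner_eq0.
suff H y : y = a \/ y = b -> closed (std_curve L K) -> 0 <= fq L K y -> fq L K y = 0.
  by move=> C; split; apply: H => //; [left|right].
move=> yab C; rewrite le_eqVlt => /predU1P[//|fy].
suff : std_curve L K (pt (phi L K y) (phi L K y * y)).
  move=> /(std_curveP _ E); rewrite pt0 pt1 => -[p0 + _].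
  rewrite ![_ * phi _ _ _]mulrC !ltr_pM2l //.
  by case: yab => ->; rewrite ltxx ?andbF.
(* The factor lies in [[1/2, 1)] and tends to [1], so the end is approached from inside. *)
pose z n : R := y * (1 - harmonic n / 2).
have zab n : a < z n < b.
  have n1 : 0 < harmonic n :> R by rewrite /harmonic invr_gt0.
  have n2 : harmonic n <= 1 :> R by rewrite /harmonic invf_le1 // ler1n.
  rewrite /z; set k := harmonic n in n1 n2 *.
  by case: yab => ->; apply/andP; split; nra.
pose g n := pt (phi L K (z n)) (phi L K (z n) * z n).
suff : g @ \oo --> pt (phi L K y) (phi L K y * y).
  apply: (closed_cvg (fun p => std_curve L K p) C).
  by apply: nearW => n; exact: std_curve_ray E (zab n).
have zy : z n @[n --> \oo] --> y.
  have H : (1 - harmonic n / 2) @[n --> \oo] --> (1 - 0 / 2 : R).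
    by apply: cvgB; [exact: cvg_cst|apply: cvgMl; exact: cvg_harmonic].
  have := cvgM (cvg_cst y) H.
  by rewrite mul0r subr0 mulr1 => H'; exact: H'.
have phiy : phi L K (z n) @[n --> \oo] --> phi L K y.
  by apply: (cvg_comp _ _ zy); exact: phi_continuous.
apply: cvg_mx => i j; rewrite ord1 mxE; under eq_fun do rewrite mxE.
by case: (i == 0) => //; exact: cvgM.
Qed.

End StandardCurve.

(** * Standard frames and invariants *)

Section Frames.
Context {R : realType}.
Implicit Types (L K x y a b c d e : R) (p : 'cV[R]_2) (A : 'M[R]_2).

(** A homogeneous quartic is determined by its values on the points [(1, y)], and these are known
    over a whole interval. This lets a statement about curves as sets be turned into one about
    quartics. *)
Lemma std_curve_quartic_unique L K h : is_quartic h ->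
  (forall p, std_curve L K p -> h p = 1) -> h = std_quartic L K.
Proof.
move=> /is_quarticP[c0 [c1 [c2 [c3 [c4 ->]]]]] H.
have [a [b E]] := ends_exist L K.
have [/andP[a0 b0] fw _ _] := E.
pose g : {poly R} := c0%:P + c1 *: 'X + c2 *: 'X^2 + c3 *: 'X^3 + c4 *: 'X^4.
have gE y : g.[y] = c0 + c1 * y + c2 * y ^+ 2 + c3 * y ^+ 3 + c4 * y ^+ 4.
  by rewrite /g !hornerE; ring.
have gf : g = fpol L K.
  apply: (poly_eq_on_itv (lt_trans a0 b0)) => y yab; rewrite gE horner_fpol.
  have [f0 w0] := fw y yab.
  have := H _ (std_curve_ray E yab); rewrite -(phi4 f0) /qform !pt0 !pt1 => h1.
  apply: (mulfI (lt0r_neq0 (exprn_gt0 4 (phi_gt0 f0)))).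
  by rewrite -h1; ring.
have gv y : c0 + c1 * y + c2 * y ^+ 2 + c3 * y ^+ 3 + c4 * y ^+ 4 = fq L K y.
  by rewrite -gE gf horner_fpol.
have := (gv 0, gv 1, gv (-1), gv 2, gv (-2)); rewrite /fq => -[[[[h0 h1] h2] h3] h4].
by rewrite stdE; congr qform; lra.
Qed.

Lemma std_curve_rayP L K a b p : ends L K a b -> std_curve L K p ->
  exists y, [/\ a < y < b, 0 < p 0 0, p = pt (p 0 0) (p 0 0 * y) & p 0 0 ^+ 4 * fq L K y = 1].
Proof.
move=> E /(std_curveP _ E)[p0 /andP[ap pb] hp]; exists (p 1 0 / p 0 0); split => //.
- by rewrite ltr_pdivlMr // ltr_pdivrMr // ap pb.
- exact/ray_pt/lt0r_neq0.
- by rewrite -std_quartic_ray -ray_pt // lt0r_neq0.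
Qed.

(** Scales the second column of the frame so that the coefficient of [x^2 y^2] becomes [- 1], which
    amounts to [2 w sigma^2 = 1]. *)
Definition sigma L K y : R := (Num.sqrt (2 * wq L K y))^-1.

Lemma sigma_gt0 L K y : 0 < wq L K y -> 0 < sigma L K y.
Proof. by move=> w0; rewrite invr_gt0 sqrtr_gt0 mulr_gt0. Qed.

Lemma sigma2 L K y : 0 < wq L K y -> 2 * wq L K y * sigma L K y ^+ 2 = 1.
Proof. by move=> w0; rewrite /sigma exprVn sqr_sqrtr ?mulfV ?mulr_ge0 ?mulf_neq0 ?gt_eqF // ltW.
  Qed.

(** The shear sends [(1, z)] to [(1, y + z)], so the new coefficients are the Taylor coefficients of
    [f] at [y]. *)
Lemma pullback_shear L K y : pullback (mx2 1 0 y 1) (std_quartic L K) =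
  qform (fq L K y) (fq1 L K y) (fq2 L K y / 2) (fq3 L K y / 6) K.
Proof.
rewrite stdE pullback_qform !mxE /= /fq /fq1 /fq2 /fq3.
by congr qform; field.
Qed.

(* The second column spans the kernel of the differential at the first one. *)
Lemma pullback_normalize a b c d e (s t : R) :
  s ^+ 4 * a = 1 -> 2 * (3 * b ^+ 2 - 8 * a * c) * t ^+ 2 = 1 ->
  pullback (mx2 s (- (s * t * b)) 0 (4 * s * t * a)) (qform a b c d e) =
  std_quartic (8 * (b ^+ 3 - 4 * a * b * c + 8 * a ^+ 2 * d) * t ^+ 3)
   ((- 3 * b ^+ 4 + 16 * a * b ^+ 2 * c - 64 * a ^+ 2 * b * d + 256 * a ^+ 3 * e) * t ^+ 4).
Proof.
move=> sa wt; have saE z : z = s ^+ 4 * a * z by rewrite sa mul1r.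
rewrite stdE pullback_qform !mxE /=.
congr qform.
- by rewrite -sa; ring.
- by ring.
- transitivity (- (s ^+ 4 * a) * (2 * (3 * b ^+ 2 - 8 * a * c) * t ^+ 2)); first by ring.
  by rewrite sa wt mulr1.
- by rewrite [RHS]saE; ring.
- by rewrite [RHS]saE; ring.
Qed.

(** The shear to [y] followed by the normalisation ([frame_mxE]), multiplied out so that its
    continuity in [y] and its value at [0] can be read off entrywise. *)
Definition frame_mx L K y : 'M[R]_2 :=
  let s := phi L K y in let t := sigma L K y in
  mx2 s (- (s * t * fq1 L K y)) (s * y) (s * t * (4 * fq L K y - y * fq1 L K y)).

(** The new first parameter with its sign, which the invariants do not see. *)
Definition frame_L L K y : R := 8 * tq L K y * sigma L K y ^+ 3.

Lemma mx2_mulmx (a b c d a' b' c' d' : R) : mx2 a b c d *m mx2 a' b' c' d' =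
  mx2 (a * a' + b * c') (a * b' + b * d') (c * a' + d * c') (c * b' + d * d').
Proof.
rewrite [LHS]mx2E !mxE !big_ord_recl !big_ord0 /= !mxE /=.
by rewrite !addr0.
Qed.

Lemma frame_mxE L K y : frame_mx L K y = mx2 1 0 y 1 *m
  mx2 (phi L K y) (- (phi L K y * sigma L K y * fq1 L K y)) 0
      (4 * phi L K y * sigma L K y * fq L K y).
Proof. by rewrite mx2_mulmx; congr mx2; ring. Qed.

(** The second parameter is left unspecified; it is recovered from the invariant [I]. *)
Lemma pullback_frame_mx L K y : 0 < fq L K y -> 0 < wq L K y ->
  exists K', pullback (frame_mx L K y) (std_quartic L K) = std_quartic (frame_L L K y) K'.
Proof.
move=> f0 w0; rewrite frame_mxE -pullback_mul pullback_shear.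
rewrite (_ : frame_L L K y = 8 * (fq1 L K y ^+ 3 - 4 * fq L K y * fq1 L K y * (fq2 L K y / 2)
  + 8 * fq L K y ^+ 2 * (fq3 L K y / 6)) * sigma L K y ^+ 3); last first.
  by rewrite /frame_L tqE; field.
eexists.
rewrite pullback_normalize ?phi4 //; last first.
  by rewrite -[RHS](sigma2 w0) wqE; congr (2 * _ * _); field.
Qed.

Lemma frame_mx_e1 L K y : frame_mx L K y *m pt 1 0 = pt (phi L K y) (phi L K y * y).
Proof. by rewrite mx2_mul !mulr1 !mulr0 !addr0. Qed.

Lemma frame_mx_unit L K y : 0 < fq L K y -> 0 < wq L K y -> frame_mx L K y \in unitmx.
Proof.
move=> f0 w0; rewrite unitmxE unitfE mx2_det.
rewrite (_ : _ - _ = phi L K y ^+ 2 * sigma L K y * (4 * fq L K y)); last by ring.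
by rewrite !mulf_neq0 ?expf_neq0 ?gt_eqF // ?phi_gt0 ?sigma_gt0.
Qed.

(** The classical [a e - 4 b d + 3 c^2] and the catalecticant determinant, rewritten for
    coefficients without binomial factors. *)
Definition qinvI a b c d e : R := a * e - b * d / 4 + c ^+ 2 / 12.
Definition qinvJ a b c d e : R :=
  a * c * e / 6 + b * c * d / 48 - a * d ^+ 2 / 16 - b ^+ 2 * e / 16 - c ^+ 3 / 216.

(** Weights four and six in the determinant. Upper triangular matrices suffice, because a frame is a
    shear times such a matrix and shears are handled by Taylor coefficients. *)
Lemma qinv_tri (s t w : R) a b c d e a' b' c' d' e' :
  pullback (mx2 s t 0 w) (qform a b c d e) = qform a' b' c' d' e' ->
  qinvI a' b' c' d' e' = (s * w) ^+ 4 * qinvI a b c d e /\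
  qinvJ a' b' c' d' e' = (s * w) ^+ 6 * qinvJ a b c d e.
Proof.
rewrite pullback_qform !mxE /= => /qform_inj[<- <- <- <- <-].
by split; rewrite /qinvI /qinvJ; field.
Qed.

Definition mq L K y : R := 8 * fq L K y / wq L K y.

(** The squared determinant of any frame over [y] is [m]: the Hessian determinants give
    [det^2 s^4 w = 8] and the level gives [s^4 f = 1], with [s] the first entry of the frame. The
    weights of [I] and [J] do the rest. *)
Lemma frame_invariants L K a b A L' K' : ends L K a b -> std_curve L K (A *m pt 1 0) ->
  pullback A (std_quartic L K) = std_quartic L' K' ->
  exists y, [/\ a < y < b, A *m pt 1 0 = pt (A 0 0) (A 0 0 * y), 0 < A 0 0,
    invI L' K' = mq L K y ^+ 2 * invI L K & invJ L' K' = mq L K y ^+ 3 * invJ L K].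
Proof.
move=> E CA PA.
have A0 : (A *m pt 1 0) 0 0 = A 0 0 by rewrite mulmx_col2 pt0 pt1 mulr1 mulr0 addr0.
have [y [yab s0 pE hf]] := std_curve_rayP E CA.
rewrite A0 in s0 pE hf.
have [_ fw _ _] := E; have [f0 w0] := fw y yab.
have A1 : A 1 0 = A 0 0 * y.
  by have := congr1 (fun q : 'cV[R]_2 => q 1 0) pE; rewrite mulmx_col2 pt0 !pt1 mulr1 mulr0 addr0.
pose w := A 1 1 - y * A 0 1.
have AE : A = mx2 1 0 y 1 *m mx2 (A 0 0) (A 0 1) 0 w.
  by rewrite {1}[A]mx2E mx2_mulmx A1; congr mx2; rewrite /w; ring.
have dE : \det A = A 0 0 * w by rewrite det2 A1 /w; ring.
have mE : mq L K y = (A 0 0 * w) ^+ 2.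
  rewrite -dE; have PA' := PA; rewrite !stdE in PA'.
  have := neg_hess_det_pullback (pt 1 0) PA'.
  rewrite pE neg_hess_det_std -[X in pt 1 X](mulr0 1) neg_hess_det_std wq0 expr1n => h.
  have h8 : \det A ^+ 2 * (A 0 0 ^+ 4 * wq L K y) = 8 by lra.
  apply: (mulIf (lt0r_neq0 w0)); rewrite /mq divfK ?lt0r_neq0 //.
  rewrite -[RHS]mulr1; transitivity (\det A ^+ 2 * wq L K y * (A 0 0 ^+ 4 * fq L K y));
    last by rewrite hf.
  by rewrite -h8; ring.
have := PA; rewrite {1}AE -pullback_mul pullback_shear stdE => /qinv_tri[].
move=> hI hJ; exists y; split; rewrite // mE -exprM.
- transitivity (qinvI 1 0 (-1) L' K'); first by rewrite /qinvI /invI; field.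
  by rewrite hI; congr (_ * _); rewrite /qinvI /invI /fq /fq1 /fq2 /fq3; field.
- transitivity (qinvJ 1 0 (-1) L' K'); first by rewrite /qinvJ /invJ; field.
  by rewrite hJ; congr (_ * _); rewrite /qinvJ /invJ /fq /fq1 /fq2 /fq3; field.
Qed.
End Frames.

(** * Equivalence of curves in standard form *)

Section Equivalence.
Context {R : realType}.
Implicit Types (L K x y a b c d e : R) (p : 'cV[R]_2) (A : 'M[R]_2) (h : 'cV[R]_2 ->
  R) (H : set 'cV[R]_2).

(** A similarity [M] moves [(1, 0)] to [p]. The pulled back quartic has leading coefficient [1],
    hyperbolicity at [p] reads [3 b^2 - 8 a c > 0], and so [pullback_normalize] applies with
    [s = 1]. *)
Lemma gpsr_frame h H p : maximal_gpsr_of h H -> H p ->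
  exists2 A, standard_frame h H A & A *m pt 1 0 = p.
Proof.
move=> [/is_quarticP[a [b [c [d [e ->]]]]] [q Hq HE]] Hp.
have [hp hyp] : hyperbolic_level (qform a b c d e) p.
  by rewrite HE in Hp; apply: connected_component_sub Hp.
move: hyp; rewrite hyperbolic_qform => hyp.
pose M := mx2 (p 0 0) (- p 1 0) (p 1 0) (p 0 0).
have Me : M *m pt 1 0 = p by rewrite mx2_mul !mulr1 !mulr0 !addr0 -col2P.
have p0 : 0 < p 0 0 ^+ 2 + p 1 0 ^+ 2.
  rewrite lt_neqAle addr_ge0 ?sqr_ge0 // andbT eq_sym paddr_eq0 ?sqr_ge0 //.
  apply/negP; rewrite !sqrf_eq0 => /andP[/eqP p0 /eqP p1].
  by move: hp; rewrite /qform p0 p1; lra.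
have detM : \det M = p 0 0 ^+ 2 + p 1 0 ^+ 2 by rewrite mx2_det; ring.
have [a' [b' [c' [d' [e' PM]]]]] : exists a' b' c' d' e',
    pullback M (qform a b c d e) = qform a' b' c' d' e'.
  by rewrite pullback_qform; do 5 eexists.
have a1 : a' = 1.
  have := congr1 (fun g => g (pt 1 0)) PM; rewrite /pullback Me hp /qform pt0 pt1 => ->.
  by ring.
have w0 : 0 < 3 * b' ^+ 2 - 8 * a' * c'.
  have := neg_hess_det_pullback (pt 1 0) PM; rewrite Me detM {1}/neg_hess_det pt0 pt1 => h1.
  have := mulr_gt0 (exprn_gt0 2 p0) hyp; rewrite -h1; lra.
pose t := (Num.sqrt (2 * (3 * b' ^+ 2 - 8 * a' * c')))^-1.
have t2 : 2 * (3 * b' ^+ 2 - 8 * a' * c') * t ^+ 2 = 1.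
  by rewrite /t exprVn sqr_sqrtr ?mulfV ?mulr_ge0 ?mulf_neq0 ?(gt_eqF w0) ?ltW // gt_eqF.
have t0 : t != 0 by apply/eqP => t0; move: t2; rewrite t0 expr0n mulr0 => /esym/eqP;
  rewrite oner_eq0.
have s1 : 1 ^+ 4 * a' = 1 by rewrite a1 expr1n mulr1.
have PN := pullback_normalize d' e' s1 t2.
set N := mx2 _ _ _ _ in PN.
have Ne : N *m pt 1 0 = pt 1 0 by rewrite mx2_mul !mulr1 !mulr0 !addr0.
exists (M *m N); last by rewrite -mulmxA Ne Me.
split.
- rewrite unitmx_mul !unitmxE !unitfE detM gt_eqF //= mx2_det a1 mulr0 subr0 mul1r !mulr1.
  by rewrite mulf_neq0.
- by rewrite -mulmxA Ne Me.
- by rewrite -pullback_mul PM PN; do 2 eexists.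
Qed.

Lemma standard_frameP h H A : maximal_gpsr_of h H -> standard_frame h H A ->
  exists L K, [/\ pullback A h = std_quartic L K, mulmx A @` std_curve L K = H
    & mulmx A @^-1` H = std_curve L K].
Proof.
move=> hH [Au HA [L [K E]]]; exists L, K.
have F := frame_image Au hH HA; rewrite E in F.
split => //; rewrite -F image_mulmx_preimage //.
by apply/seteqP; split => p /=; rewrite /preimage /= mulKmx.
Qed.

Lemma gpsr_of_nonempty h H : maximal_gpsr_of h H -> exists p, H p.
Proof. by move=> [_ [p Hp ->]]; exists p; apply: connected_component_refl. Qed.

Lemma gpsr_of_level h H p : maximal_gpsr_of h H -> H p -> h p = 1.
Proof. by move=> [_ [q _ ->]] /connected_component_sub[]. Qed.

Lemma gpsr_standard h H : maximal_gpsr_of h H -> exists L K, equivalent H (std_curve L K).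
Proof.
move=> hH; have [p Hp] := gpsr_of_nonempty hH.
have [A FA _] := gpsr_frame hH Hp.
have [L [K [E F _]]] := standard_frameP hH FA.
by have [Au _ _] := FA; exists L, K; apply: equivalent_sym; exists A.
Qed.

Lemma std_curveN L K : equivalent (std_curve L K) (std_curve (- L) K).
Proof.
apply: equivalent_sym; exists (mx2 1 0 0 (-1)).
  by rewrite unitmxE unitfE mx2_det mul1r mulr0 subr0 oppr_eq0 oner_eq0.
have PE : pullback (mx2 1 0 0 (-1)) (std_quartic L K) = std_quartic (- L) K.
  by rewrite !stdE pullback_qform !mxE /=; congr qform; ring.
rewrite {1}/std_curve -PE.
apply: frame_image; last 1 first.
- rewrite mx2_mul (_ : pt _ _ = pt 1 0); first exact: std_curve_e1.
  by congr pt; ring.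
- by rewrite unitmxE unitfE mx2_det mul1r mulr0 subr0 oppr_eq0 oner_eq0.
- exact: std_maximal.
Qed.

(** The explicit frame over [y] has the prescribed invariants, hence the right [K'] and the right
    [L'] up to sign; reversing the second column corrects the sign. *)
Lemma frame_at L K a b y L' K' : ends L K a b -> a < y < b ->
  invI L' K' = mq L K y ^+ 2 * invI L K -> invJ L' K' = mq L K y ^+ 3 * invJ L K ->
  exists A, [/\ A \in unitmx, A *m pt 1 0 = pt (phi L K y) (phi L K y * y) &
    pullback A (std_quartic L K) = std_quartic L' K'].
Proof.
move=> E yab hI hJ; have [_ fw _ _] := E; have [f0 w0] := fw y yab.
have [K1 PF] := pullback_frame_mx f0 w0.
set L1 := frame_L L K y in PF.
have Fe := frame_mx_e1 L K y.
have CF : std_curve L K (frame_mx L K y *m pt 1 0) by rewrite Fe; apply: std_curve_ray yab.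
have [z [zab zE s0 hI1 hJ1]] := frame_invariants E CF PF.
have yz : z = y.
  rewrite Fe in zE; have h0 := congr1 (fun q : 'cV[R]_2 => q 0 0) zE.
  have h1 := congr1 (fun q : 'cV[R]_2 => q 1 0) zE.
  by move: h0 h1; rewrite !pt0 !pt1 => <- /(mulfI (lt0r_neq0 (phi_gt0 f0))).
rewrite yz in hI1 hJ1.
have K1E : K1 = K' by rewrite -hI1 in hI; move: hI; rewrite /invI => /addIr.
have L1E : (L1 == L') || (L1 == - L').
  by rewrite -eqf_sqr; apply/eqP; rewrite -hJ1 /invJ K1E in hJ; lra.
case/orP: L1E => /eqP L1E.
  by exists (frame_mx L K y); rewrite frame_mx_unit // Fe PF L1E K1E.
exists (frame_mx L K y *m mx2 1 0 0 (-1)); split.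
- rewrite unitmx_mul frame_mx_unit //=.
  by rewrite unitmxE unitfE mx2_det mul1r mulr0 subr0 oppr_eq0 oner_eq0.
- rewrite -mulmxA mx2_mul (_ : pt (1 * 1 + _) _ = pt 1 0) ?Fe //.
  by congr pt; ring.
- rewrite -pullback_mul PF L1E K1E !stdE pullback_qform !mxE /=; congr qform; ring.
Qed.

(** Equivalence speaks only of the curves as sets; since a curve determines its quartic, the matrix
    also relates the two quartics. *)
Lemma equivalent_pullback L K L' K' : equivalent (std_curve L K) (std_curve L' K') ->
  exists A, [/\ A \in unitmx, std_curve L K (A *m pt 1 0) &
    pullback A (std_quartic L K) = std_quartic L' K'].
Proof.
move=> [M Mu ME]; exists (invmx M); split.
- by rewrite unitmx_inv.
- by have := std_curve_e1 L' K'; rewrite -ME => -[p Cp <-]; rewrite mulKmx.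
have <- : pullback M (std_quartic L' K') = std_quartic L K.
  apply: std_curve_quartic_unique.
    by apply: is_quartic_pullback; have [] := std_maximal L' K'.
  move=> p Cp; rewrite /pullback; apply: (gpsr_of_level (std_maximal L' K')).
  by rewrite -ME; exists p.
by rewrite pullback_mul mulmxV // pullback1.
Qed.

Lemma equivalent_std L K L' K' a b : ends L K a b ->
  equivalent (std_curve L K) (std_curve L' K') <->
  exists y, [/\ a < y < b, invI L' K' = mq L K y ^+ 2 * invI L K
    & invJ L' K' = mq L K y ^+ 3 * invJ L K].
Proof.
move=> E; split; last first.
  move=> [y [yab hI hJ]]; have [A [Au Ae PA]] := frame_at E yab hI hJ.
  apply: equivalent_sym; exists A => //; rewrite /std_curve -PA.
  apply: frame_image => //; first exact: std_maximal.
  by rewrite Ae; apply: std_curve_ray E yab.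
move=> /equivalent_pullback[A [Au CA PA]].
by have [y [yab _ _ hI hJ]] := frame_invariants E CA PA; exists y.
Qed.

(** If no value of [m] changes the invariants, every point has a frame that pulls the quartic back
    to itself. Two such symmetries compose to one from [p] to [q]. *)
Lemma homogeneous_std L K a b : ends L K a b ->
  (forall y, a < y < b -> invI L K = mq L K y ^+ 2 * invI L K /\ invJ L K = mq L K y ^+ 3 * invJ L K) ->
  homogeneous (std_curve L K).
Proof.
move=> E Hm p q Cp Cq.
have frame r : std_curve L K r -> exists A, [/\ A \in unitmx, A *m pt 1 0 = r,
    pullback A (std_quartic L K) = std_quartic L K & mulmx A @` std_curve L K = std_curve L K].
  move=> Cr; have [y [yab r0 rE hr]] := std_curve_rayP E Cr.
  have [_ fw _ _] := E; have [f0 w0] := fw y yab.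
  have [hI hJ] := Hm y yab.
  have [A [Au Ae PA]] := frame_at E yab hI hJ.
  have {}Ae : A *m pt 1 0 = r by rewrite Ae [RHS]rE (phi_unique r0 f0 hr).
  exists A; split => //; rewrite {1}/std_curve -{1}PA.
  by apply: frame_image => //; [exact: std_maximal|rewrite Ae].
have [A [Au Ae PA IA]] := frame p Cp; have [B [Bu Be PB IB]] := frame q Cq.
exists (B *m invmx A); split.
- by rewrite unitmx_mul Bu unitmx_inv.
- have -> : mulmx (B *m invmx A) @` std_curve L K = mulmx B @` (mulmx (invmx A) @` std_curve L K).
    by rewrite image_comp; congr image; apply/funext => r /=; rewrite mulmxA.
  by rewrite -{1}IA image_mulmxK.
- by rewrite -mulmxA -Ae mulKmx.
Qed.

(** The hypothesis makes [8 f] and [w] agree on an interval, hence as polynomials. *)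
Lemma wq_fq L K a b : ends L K a b ->
  (forall y, a < y < b -> mq L K y = 1) -> L = 0 /\ K = 1 / 4.
Proof.
move=> E Hm; have [/andP[a0 b0] fw _ _] := E.
have P : 8 *: fpol L K = wpol L K.
  apply: (poly_eq_on_itv (lt_trans a0 b0)) => y yab.
  have [f0 w0] := fw y yab; rewrite hornerZ horner_fpol horner_wpol.
  by have := Hm y yab; rewrite /mq => h; rewrite -[LHS](divfK (lt0r_neq0 w0)) h mul1r.
have Hv y : 8 * fq L K y = wq L K y by rewrite -horner_fpol -horner_wpol -P hornerZ.
have := Hv 1; have := Hv (-1); rewrite /fq /wq => h1 h2.
have L0 : L = 0 by lra.
by split=> //; move: h1; rewrite L0; lra.
Qed.

(** A symmetry taking [(1, 0)] to the point over [y] gives [I = m^2 I] and [J = m^3 J]. A nonzero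
    invariant therefore forces [m = 1] on the whole interval. *)
Lemma homogeneous_stdP L K : homogeneous (std_curve L K) ->
  (invI L K = 0 /\ invJ L K = 0) \/ (L = 0 /\ K = 1 / 4).
Proof.
move=> Hh; have [a [b E]] := ends_exist L K.
have Hm y : a < y < b -> invI L K = mq L K y ^+ 2 * invI L K /\ invJ L K = mq L K y ^+ 3 * invJ L K.
  move=> yab; have [_ fw _ _] := E; have [f0 w0] := fw y yab.
  have [A [Au IA Ae]] := Hh _ _ (std_curve_e1 L K) (std_curve_ray E yab).
  have PA : pullback A (std_quartic L K) = std_quartic L K.
    apply: std_curve_quartic_unique.
      by apply: is_quartic_pullback; have [] := std_maximal L K.
    move=> r Cr; rewrite /pullback; apply: (gpsr_of_level (std_maximal L K)).
    by rewrite -IA; exists r.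
  have CA : std_curve L K (A *m pt 1 0) by rewrite Ae; apply: std_curve_ray E yab.
  have [z [zab zE s0 hI1 hJ1]] := frame_invariants E CA PA.
  suff yz : z = y by rewrite -yz.
  rewrite Ae in zE; have h0 := congr1 (fun q : 'cV[R]_2 => q 0 0) zE.
  have h1 := congr1 (fun q : 'cV[R]_2 => q 1 0) zE.
  by move: h0 h1; rewrite !pt0 !pt1 => <- /(mulfI (lt0r_neq0 (phi_gt0 f0))).
have [hI|nI] := eqVneq (invI L K) 0; have [hJ|nJ] := eqVneq (invJ L K) 0; first by left.
all: right; apply: (wq_fq E) => y yab; have [_ fw _ _] := E; have [f0 w0] := fw y yab.
all: have m0 : 0 < mq L K y by rewrite /mq divr_gt0 ?mulr_gt0.
all: have [h1 h2] := Hm y yab.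
- have h3 : mq L K y ^+ 3 = 1 by apply: (mulIf nJ); rewrite mul1r -h2.
  by apply/eqP; rewrite -(@eqrXn2 _ 3) ?ltW // expr1n h3.
all: have h3 : mq L K y ^+ 2 = 1 by apply: (mulIf nI); rewrite mul1r -h1.
all: by apply/eqP; rewrite -(@eqrXn2 _ 2) ?ltW // expr1n h3.
Qed.

Lemma equivalent_closed (H G : set 'cV[R]_2) : equivalent H G -> closed H -> closed G.
Proof.
move=> [A Au <-] C; rewrite image_mulmx_preimage //.
exact: ((continuous_closedP _).1 (@mulmx_continuous _ (invmx A)) _ C).
Qed.

End Equivalence.

(** * Limits at the ends *)

Section Limits.
Context {R : realType}.
Implicit Types (L K x y v a b : R) (p : 'cV[R]_2) (A : 'M[R]_2) (h : 'cV[R]_2 ->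
  R) (H : set 'cV[R]_2).

(** Invariance of [I] and [J] under shears. *)
Lemma inv_taylor L K y :
  invI L K = qinvI (fq L K y) (fq1 L K y) (fq2 L K y / 2) (fq3 L K y / 6) K /\
  invJ L K = qinvJ (fq L K y) (fq1 L K y) (fq2 L K y / 2) (fq3 L K y / 6) K.
Proof. by split; rewrite /qinvI /qinvJ /invI /invJ /fq /fq1 /fq2 /fq3; field. Qed.

(** Only the Taylor coefficient [f'' / 2] survives in both invariants; in particular
    [I^3 = 27 J^2]. *)
Lemma inv_double_root L K v : fq L K v = 0 -> fq1 L K v = 0 ->
  invI L K = fq2 L K v ^+ 2 / 48 /\ invJ L K = - fq2 L K v ^+ 3 / 1728.
Proof.
move=> f0 f10; have [-> ->] := inv_taylor L K v; rewrite f0 f10 /qinvI /qinvJ.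
by split; field.
Qed.

Lemma cvg_at_left_horner (p : {poly R}) v : p.[t * v] @[t --> (1 : R)^'-] --> p.[v].
Proof.
apply: continuous_cvg; first exact: continuous_horner.
rewrite -[X in _ --> X]mul1r; apply: cvg_at_left_filter.
apply: cvgM; [exact: cvg_id|exact: cvg_cst].
Qed.

Lemma near_at_left_unit (P : R -> Prop) : (forall t, 0 <= t < 1 -> P t) ->
  \forall t \near (1 : R)^'-, P t.
Proof.
move=> H; near=> t; apply: H; apply/andP; split.
  by near: t; apply: nbhs_left_ge.
by near: t; apply: nbhs_left_lt.
Unshelve. all: end_near. Qed.

Lemma cvg_at_left_ratio (p q : {poly R}) v (g : R -> R) : q.[v] != 0 ->
  (forall t, 0 <= t < 1 -> g t = p.[t * v] / q.[t * v]) ->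
  g t @[t --> (1 : R)^'-] --> p.[v] / q.[v].
Proof.
move=> q0 gE; apply: (@cvg_trans _ ((fun t => p.[t * v] / q.[t * v]) @ (1 : R)^'-)); last first.
  apply: cvgM; first exact: cvg_at_left_horner.
  by apply: cvgV => //; exact: cvg_at_left_horner.
apply: near_eq_cvg; apply: near_at_left_unit => t t01; exact/esym/gE.
Qed.

(** At a simple root [w = 3 f'^2] is nonzero, so the quotient is continuous there. *)
Lemma mq_cvg_simple L K v : fq L K v = 0 -> fq1 L K v != 0 ->
  mq L K (t * v) @[t --> (1 : R)^'-] --> (0 : R).
Proof.
move=> f0 f1n.
have w0 : wq L K v != 0 by rewrite wqE f0 mulr0 mul0r subr0 mulf_neq0 ?expf_neq0.
have := @cvg_at_left_ratio (8 *: fpol L K) (wpol L K) v (fun t => mq L K (t * v)).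
rewrite horner_wpol hornerZ horner_fpol f0 mulr0 mul0r; apply => // t _.
by rewrite horner_wpol hornerZ horner_fpol.
Qed.

(** Both [f] and [w] vanish to second order. After cancelling [(y - v)^2] the quotient is [8 g / d],
    where [g] is [f'' / 2] and [d] is [f''^2] at [v]. *)
Lemma mq_cvg_double L K v : v != 0 -> fq L K v = 0 -> fq1 L K v = 0 -> fq2 L K v != 0 ->
  mq L K (t * v) @[t --> (1 : R)^'-] --> 4 / fq2 L K v.
Proof.
move=> v0 f0 f10 f2n.
have [z zE] : exists z : {poly R}, forall y, z.[y] = y - v.
  by exists ('X - v%:P) => y; rewrite !hornerE.
have [g gE] : exists g : {poly R}, forall y,
    g.[y] = fq2 L K v / 2 + fq3 L K v / 6 * (y - v) + K * (y - v) ^+ 2.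
  exists ((fq2 L K v / 2)%:P + (fq3 L K v / 6) *: z + K *: z ^+ 2) => y.
  by rewrite !hornerE /= !zE; ring.
have [g1 g1E] : exists g1 : {poly R}, forall y, g1.[y] = fq3 L K v / 6 + 2 * K * (y - v).
  by exists ((fq3 L K v / 6)%:P + (2 * K) *: z) => y; rewrite !hornerE zE.
have [d dE] : exists d : {poly R}, forall y,
    d.[y] = 3 * (2 * g.[y] + (y - v) * g1.[y]) ^+ 2 - 4 * (g.[y] * fq2 L K y).
  exists (3 *: (2 *: g + z * g1) ^+ 2 - 4 *: (g * (fpol L K)^`()^`())) => y.
  by rewrite -horner_fpol2 -zE !(hornerD, hornerN, hornerZ, hornerM, horner_exp).
have gv : g.[v] = fq2 L K v / 2 by rewrite gE subrr expr0n !mulr0 !addr0.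
have dv : d.[v] = fq2 L K v ^+ 2 by rewrite dE gv subrr; field.
have tf y : fq L K y = (y - v) ^+ 2 * g.[y].
  have -> : fq L K y = fq L K v + fq1 L K v * (y - v) + (y - v) ^+ 2 * g.[y].
    by rewrite gE /fq /fq1 /fq2 /fq3; field.
  by rewrite f0 f10 mul0r !add0r.
have tf1 y : fq1 L K y = (y - v) * (2 * g.[y] + (y - v) * g1.[y]).
  have -> : fq1 L K y = fq1 L K v + (y - v) * (2 * g.[y] + (y - v) * g1.[y]).
    by rewrite gE g1E /fq1 /fq2 /fq3; field.
  by rewrite f10 add0r.
have -> : 4 / fq2 L K v = (8 *: g).[v] / d.[v].
  by rewrite hornerZ gv dv; field.
apply: cvg_at_left_ratio; first by rewrite dv expf_neq0.
move=> t /andP[t0 t1]; rewrite /mq hornerZ.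
have tv0 : t * v - v != 0.
  by rewrite -[X in _ - X]mul1r -mulrBl mulf_neq0 // subr_eq0 lt_eqF.
have -> : wq L K (t * v) = (t * v - v) ^+ 2 * d.[t * v].
  by rewrite wqE tf1 tf dE; ring.
rewrite tf [8 * (_ * _)]mulrCA invfM mulrACA mulfV ?mul1r // expf_neq0 //.
Qed.

(** That [f] vanishes at [v] is always given separately. The second clause rules out triple roots,
    which lead to B like simple ones. *)
Definition double_root L K v := fq1 L K v = 0 /\ fq2 L K v <> 0.

(* [(0, 0)] and [(1/3, - 1/27)] are the invariants of B and A. *)
Lemma inv_cvg L K v : v != 0 -> fq L K v = 0 ->
  exists i j : R, [/\ mq L K (t * v) ^+ 2 * invI L K @[t --> (1 : R)^'-] --> i,
    mq L K (t * v) ^+ 3 * invJ L K @[t --> (1 : R)^'-] --> j,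
    ~ double_root L K v -> i = 0 /\ j = 0 &
    double_root L K v -> i = 1 / 3 /\ j = - (1 / 27)].
Proof.
move=> v0 f0.
have C (m : R) : mq L K (t * v) @[t --> (1 : R)^'-] --> m ->
    mq L K (t * v) ^+ 2 * invI L K @[t --> (1 : R)^'-] --> m ^+ 2 * invI L K /\
    mq L K (t * v) ^+ 3 * invJ L K @[t --> (1 : R)^'-] --> m ^+ 3 * invJ L K.
  move=> Cm; split; apply: cvgM; try exact: cvg_cst.
    by under eq_fun do rewrite expr2; rewrite expr2; exact: cvgM.
  by under eq_fun do rewrite 2!exprS expr1; rewrite 2!exprS expr1; apply: cvgM => //; exact: cvgM.
have [f1|f1] := eqVneq (fq1 L K v) 0; last first.
  have [c1 c2] := C _ (mq_cvg_simple f0 f1).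
  exists (0 ^+ 2 * invI L K), (0 ^+ 3 * invJ L K); split => //.
    by rewrite !expr0n !mul0r.
  by case=> h; rewrite h eqxx in f1.
have [hI hJ] := inv_double_root f0 f1.
have [f2|f2] := eqVneq (fq2 L K v) 0.
  (* A root of order at least three kills both invariants, so the two expressions are constantly
     [0]. *)
  have I0 : invI L K = 0 by rewrite hI f2; ring.
  have J0 : invJ L K = 0 by rewrite hJ f2; ring.
  exists 0, 0; rewrite I0 J0; split => //; try by case=> _; rewrite f2.
  - by under eq_fun do rewrite mulr0; exact: cvg_cst.
  - by under eq_fun do rewrite mulr0; exact: cvg_cst.
have [c1 c2] := C _ (mq_cvg_double v0 f0 f1 f2).
do 2 eexists; split; [exact: c1|exact: c2| |].
- by case; split => //; exact/eqP.
- by rewrite hI hJ => _; split; field.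
Qed.

(** * Limits of the quartic along a segment *)

Lemma segment_end L K a b v : ends L K a b -> v != 0 -> fq L K v = 0 ->
  (forall t, 0 <= t < 1 -> a < t * v < b) -> (0 < v /\ v = b) \/ (v < 0 /\ v = a).
Proof.
move=> E v0 f0 H; have [/andP[a0 b0] fw _ _] := E.
have nv : ~ (a < v < b) by move=> /fw[]; rewrite f0 ltxx.
have [vp|vn|vv] := ltgtP v 0; last by rewrite vv eqxx in v0.
- right; split=> //; apply/eqP; rewrite eq_le; apply/andP; split.
    by rewrite leNgt; apply/negP => av; apply: nv; rewrite av (lt_trans vp).
  rewrite leNgt; apply/negP => va.
  (* If [v] lay beyond the end [a], the segment would hit that end at the time [a / v < 1]. *)
  have := H (a / v); rewrite divfK // ltxx => h; suff : false by []; apply: h.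
  by rewrite ltr_ndivrMr // mul1r va andbT ltW // nmulr_lgt0 // invr_lt0.
- left; split=> //; apply/eqP; rewrite eq_le; apply/andP; split; last first.
    by rewrite leNgt; apply/negP => vb; apply: nv; rewrite vb (lt_trans a0).
  rewrite leNgt; apply/negP => bv.
  have := H (b / v); rewrite divfK // ltxx andbF => h; suff : false by []; apply: h.
  by rewrite ltr_pdivrMr // mul1r bv andbT divr_ge0 // ltW.
Qed.

Lemma dom_segment L K a b v : ends L K a b ->
  (forall t : R, 0 <= t < 1 -> dom (std_curve L K) (t * v)) -> forall t, 0 <= t < 1 ->
    a < t * v < b.
Proof. by move=> E H t /H; rewrite (dom_std_curve E). Qed.

(** Whatever path of frames is chosen, the invariants at time [t] depend only on the point over
    [t v]. By continuity, the limit quartic has the limits found in [inv_cvg] as its invariants. *)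
Lemma limit_quartic_inv L K a b v hhat : ends L K a b ->
  limit_quartic (std_quartic L K) (std_curve L K) v hhat ->
  [/\ fq L K v = 0, (0 < v /\ v = b) \/ (v < 0 /\ v = a) &
    exists L' K', [/\ hhat = std_quartic L' K',
     ~ double_root L K v -> invI L' K' = 0 /\ invJ L' K' = 0 &
     double_root L K v -> invI L' K' = 1 / 3 /\ invJ L' K' = - (1 / 27)]].
Proof.
move=> E [v0 dv]; rewrite std_quartic1 => f0 [B [_ _ HB [c [chat [Hc cchat ->]]]]].
have {}dv := dom_segment E dv.
split=> //; first exact: segment_end E v0 f0 dv.
have [i [j [ci cj hs hd]]] := inv_cvg v0 f0.
have Hct t : 0 <= t < 1 -> [/\ c t 0 0 = 1, c t 0 1 = 0, c t 0 2 = -1,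
    invI (c t 0 3) (c t 0 4) = mq L K (t * v) ^+ 2 * invI L K &
    invJ (c t 0 3) (c t 0 4) = mq L K (t * v) ^+ 3 * invJ L K].
  move=> t01; have [Bu Be [Lt [Kt PB]]] := HB t t01.
  have := Hc t t01; rewrite PB quarticE stdE => /qform_inj[<- <- <- <- <-].
  have tv := dv t t01; have [_ fw _ _] := E; have [ft wt] := fw _ tv.
  have Be' : B t *m pt 1 0 = pt (phi L K (t * v)) (phi L K (t * v) * (t * v)).
    rewrite Be std_quartic1 phi_powR //.
    by apply/colP => k; rewrite !mxE; case: (k == 0); rewrite ?mulr1.
  have CB : std_curve L K (B t *m pt 1 0) by rewrite Be'; exact: std_curve_ray E tv.
  have [z [zab zE s0 hI1 hJ1]] := frame_invariants E CB PB.
  suff yz : z = t * v by rewrite -yz.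
  rewrite Be' in zE; have h0 := congr1 (fun q : 'cV[R]_2 => q 0 0) zE.
  have h1 := congr1 (fun q : 'cV[R]_2 => q 1 0) zE.
  by move: h0 h1; rewrite !pt0 !pt1 => <- /(mulfI (lt0r_neq0 (phi_gt0 ft))).
have cc k : c t 0 k @[t --> (1 : R)^'-] --> chat 0 k.
  by apply: (cvg_comp _ (fun M : 'rV[R]_5 => M 0 k) cchat); exact: coord_continuous.
have lim_eq (g k : R -> R) (l m : R) : (forall t, 0 <= t < 1 -> g t = k t) ->
    g t @[t --> (1 : R)^'-] --> l -> k t @[t --> (1 : R)^'-] --> m -> l = m.
  move=> gk cg ck; refine (@cvg_unique _ (@Rhausdorff R) (k @ (1 : R)^'-) _ l m _ ck).
  apply: (@cvg_trans _ (g @ (1 : R)^'-)) => //.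
  by apply: near_eq_cvg; apply: near_at_left_unit => t t01; exact: gk.
have h0 : chat 0 0 = 1.
  by apply: (lim_eq (fun t => c t 0 0) (fun=> 1)) (cc 0) (cvg_cst _) => t /Hct[].
have h1 : chat 0 1 = 0.
  by apply: (lim_eq (fun t => c t 0 1) (fun=> 0)) (cc 1) (cvg_cst _) => t /Hct[].
have h2 : chat 0 2 = -1.
  by apply: (lim_eq (fun t => c t 0 2) (fun=> -1)) (cc 2) (cvg_cst _) => t /Hct[].
have cI : invI (c t 0 3) (c t 0 4) @[t --> (1 : R)^'-] --> invI (chat 0 3) (chat 0 4).
  by apply: cvgD; [exact: cc|exact: cvg_cst].
have cJ : invJ (c t 0 3) (c t 0 4) @[t --> (1 : R)^'-] --> invJ (chat 0 3) (chat 0 4).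
  apply: cvgB; last first.
    apply: cvgM; last exact: cvg_cst.
    by under eq_fun do rewrite expr2; rewrite expr2; apply: cvgM; exact: cc.
  apply: cvgB; first exact: cvg_cst.
  by apply: cvgM; [exact: cc|exact: cvg_cst].
have h3 : invI (chat 0 3) (chat 0 4) = i.
  by apply: lim_eq cI ci => t /Hct[].
have h4 : invJ (chat 0 3) (chat 0 4) = j.
  by apply: lim_eq cJ cj => t /Hct[].
exists (chat 0 3), (chat 0 4); rewrite h3 h4; split => //.
by rewrite quarticE stdE h0 h1 h2.
Qed.

Lemma sigma_continuous L K y : 0 < wq L K y -> sigma L K z @[z --> y] --> sigma L K y.
Proof.
move=> w0; apply: cvgV; first by rewrite gt_eqF // sqrtr_gt0 mulr_gt0.
apply: continuous_cvg; first exact: sqrt_continuous.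
by apply: cvgM; [exact: cvg_cst|exact: wq_continuous].
Qed.

(** A polynomial has constant sign just to the left of [1], so it is a fixed sign times the root of
    its square. This upgrades convergence of [L^2] to that of [L]. *)
Lemma poly_left_sign (p : {poly R}) : exists2 s : R, (s = 1 \/ s = - 1) &
  \forall t \near (1 : R)^'-, p.[t] = s * Num.sqrt (p.[t] ^+ 2).
Proof.
have [->|p0] := eqVneq p 0.
  exists 1; first by left.
  by apply: nearW => t; rewrite horner0 expr0n sqrtr0 mulr0.
have [y [y1 yP]] : exists y, y < 1 /\ forall z, y < z < 1 -> p.[z] != 0.
  case: (polyrcf.prev_rootP p 0 1) => [p00|y _ py0 hy hn|y _ yE hn].
  - by move: p0; rewrite p00 eqxx.
  - by exists y; move: hy; rewrite in_itv /= => /andP[_ y1]; split => //.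
  - by exists 0; split.
have near_y : \forall t \near (1 : R)^'-, y < t < 1.
  near=> t; apply/andP; split; first by near: t; exact: nbhs_left_gt.
  by near: t; exact: nbhs_left_lt.
have y2 : y < (y + 1) / 2 < 1 by apply/andP; split; lra.
have [s0|s0] := ltrP 0 p.[(y + 1) / 2].
  exists 1; first by left.
  apply: filterS near_y => t ty; rewrite mul1r sqrtr_sqr gtr0_norm //.
  exact: poly_const_sign yP _ _ y2 ty s0.
exists (-1); first by right.
apply: filterS near_y => t ty; rewrite mulN1r sqrtr_sqr.
have : 0 < (- p).[t].
  apply: (poly_const_sign _ y2 ty).
    by move=> z /yP; rewrite hornerN oppr_eq0.
  by rewrite hornerN oppr_gt0 lt_neqAle s0 yP.
by rewrite hornerN oppr_gt0 => /ltr0_norm ->; rewrite opprK.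
Unshelve. all: end_near. Qed.

(** The explicit frames along the segment serve as the path. [K] converges because [m^2 I] does,
    [L^2] because [m^3 J] does too, and [L] because its sign is eventually constant. *)
Lemma limit_quartic_exists L K a b v : ends L K a b -> v != 0 -> fq L K v = 0 ->
  (forall t, 0 <= t < 1 -> a < t * v < b) ->
  exists hhat, limit_quartic (std_quartic L K) (std_curve L K) v hhat.
Proof.
move=> E v0 f0 dv; have [/andP[a0 b0] fw _ _] := E.
have fwt t : 0 <= t < 1 -> 0 < fq L K (t * v) /\ 0 < wq L K (t * v) by move=> /dv/fw.
have [i [j [ci cj _ _]]] := inv_cvg v0 f0.
pose Kt t := mq L K (t * v) ^+ 2 * invI L K - 1 / 12.
pose Lt t := frame_L L K (t * v).
have PB t : 0 <= t < 1 -> pullback (frame_mx L K (t * v)) (std_quartic L K) = std_quartic (Lt t) (Kt t)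
    /\ invJ (Lt t) (Kt t) = mq L K (t * v) ^+ 3 * invJ L K.
  move=> t01; have [ft wt] := fwt t t01; have [K1 P1] := pullback_frame_mx ft wt.
  have Be := frame_mx_e1 L K (t * v).
  have CB : std_curve L K (frame_mx L K (t * v) *m pt 1 0).
    by rewrite Be; exact: std_curve_ray E (dv t t01).
  have [z [zab zE s0 hI1 hJ1]] := frame_invariants E CB P1.
  have yz : z = t * v.
    rewrite Be in zE; have h0 := congr1 (fun q : 'cV[R]_2 => q 0 0) zE.
    have h1 := congr1 (fun q : 'cV[R]_2 => q 1 0) zE.
    by move: h0 h1; rewrite !pt0 !pt1 => <- /(mulfI (lt0r_neq0 (phi_gt0 ft))).
  rewrite yz in hI1 hJ1.
  have K1E : K1 = Kt t by rewrite /Kt -hI1 /invI; ring.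
  by rewrite P1 -hJ1 -K1E.
have cK : Kt t @[t --> (1 : R)^'-] --> i - 1 / 12 by apply: cvgB; [exact: ci|exact: cvg_cst].
(* [J = 1/216 - K/6 - L^2/16] solved for [L^2]. *)
have cL2 : Lt t ^+ 2 @[t --> (1 : R)^'-] --> 16 * (1 / 216 - (i - 1 / 12) / 6 - j).
  apply: (@cvg_trans _ ((fun t =>
    16 * (1 / 216 - Kt t / 6 - mq L K (t * v) ^+ 3 * invJ L K)) @ (1 : R)^'-)).
    apply: near_eq_cvg; apply: near_at_left_unit => t /PB[_ <-].
    by rewrite /invJ; field.
  apply: cvgM; first exact: cvg_cst.
  apply: cvgB => //; apply: cvgB; first exact: cvg_cst.
  by apply: cvgM => //; exact: cvg_cst.
(* The sign of [L] is that of [tq], here as a polynomial in the time. *)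
have [s ss Hs] := poly_left_sign (tpol L K \Po (v *: 'X)).
have cL : Lt t @[t --> (1 : R)^'-] --> s * Num.sqrt (16 * (1 / 216 - (i - 1 / 12) / 6 - j)).
  apply: (@cvg_trans _ ((fun t => s * Num.sqrt (Lt t ^+ 2)) @ (1 : R)^'-)); last first.
    apply: cvgM; first exact: cvg_cst.
    by apply: continuous_cvg => //; exact: sqrt_continuous.
  apply: near_eq_cvg.
  have near01 : \forall t \near (1 : R)^'-, 0 <= t < 1 by apply: near_at_left_unit.
  apply: filterS2 near01 Hs => t t01.
  have -> : (tpol L K \Po (v *: 'X)).[t] = tq L K (t * v).
    have vX : (v *: 'X).[t] = t * v by rewrite hornerZ hornerX mulrC.
    by rewrite horner_comp vX horner_tpol.
  have [ft wt] := fwt t t01; rewrite !sqrtr_sqr /Lt /frame_L => h.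
  have s3 : 0 <= 8 * sigma L K (t * v) ^+ 3 by rewrite mulr_ge0 // exprn_ge0 // ltW // sigma_gt0.
  rewrite mulrAC normrM (ger0_norm s3) mulrCA -h; ring.
exists (quartic (coef_row 1 0 (-1) (s * Num.sqrt (16 * (1 / 216 - (i - 1 / 12) / 6 - j))) (i - 1 / 12))).
split=> //; first by move=> t t01; rewrite (dom_std_curve E); exact: dv.
  by rewrite std_quartic1.
exists (fun t => frame_mx L K (t * v)); split.
- apply: continuous_in_subspaceT => t; rewrite inE /= in_itv /= => t01.
  have [ft wt] := fwt t t01.
  have cv : (x * v) @[x --> t] --> t * v by apply: cvgM; [exact: cvg_id|exact: cvg_cst].
  have cs : phi L K (x * v) @[x --> t] --> phi L K (t * v).
    by apply: (cvg_comp _ _ cv); exact: phi_continuous.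
  have ct : sigma L K (x * v) @[x --> t] --> sigma L K (t * v).
    by apply: (cvg_comp _ _ cv); exact: sigma_continuous.
  have cf : fq L K (x * v) @[x --> t] --> fq L K (t * v).
    by apply: (cvg_comp _ _ cv); exact: fq_continuous.
  have cf1 : fq1 L K (x * v) @[x --> t] --> fq1 L K (t * v).
    under eq_fun do rewrite -horner_fpol1; rewrite -horner_fpol1.
    by apply: (cvg_comp _ _ cv); exact: continuous_horner.
  have cst4 : phi L K (x * v) * sigma L K (x * v) @[x --> t] --> phi L K (t * v) * sigma L K (t * v).
    exact: cvgM.
  apply: (@cvg_mx _ _ (nbhs t)) => k l; rewrite mxE; under eq_fun do rewrite mxE.
  case: (k == 0); case: (l == 0) => //.
  + by apply: cvgN; exact: cvgM.
  + exact: cvgM.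
  + apply: cvgM => //; apply: cvgB; last exact: cvgM.
    by apply: cvgM => //; exact: cvg_cst.
- have s0 : sigma L K 0 = 1 / 4.
    rewrite /sigma wq0 (_ : 2 * 8 = 4 ^+ 2); last by ring.
    by rewrite sqrtr_sqr ger0_norm // mul1r.
  have p0 : phi L K 0 = 1 by rewrite /phi fq0 !sqrtr1 invr1.
  have f10 : fq1 L K 0 = 0 by rewrite /fq1; ring.
  rewrite mul0r /frame_mx s0 p0 f10 fq0 [RHS]mx2E !mxE /= mulr1n mulr0n.
  by congr mx2; field.
- move=> t t01; have [ft wt] := fwt t t01; split.
  + exact: frame_mx_unit.
  + rewrite frame_mx_e1 std_quartic1 phi_powR //.
    by apply/colP => k; rewrite !mxE; case: (k == 0); rewrite ?mulr1.
  + by have [-> _] := PB t t01; do 2 eexists.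
exists (fun t => coef_row 1 0 (-1) (Lt t) (Kt t)).
eexists; split; last reflexivity.
- by move=> t t01; have [-> _] := PB t t01; rewrite quartic_coef_row stdE.
apply: cvg_mx => k l; rewrite !mxE; under eq_fun do rewrite mxE.
by case: l => [[|[|[|[|[|//]]]]] Hl] //=; exact: cvg_cst.
Qed.

End Limits.

(** * Limit geometries *)

Section LimitGeometries.
Context {R : realType}.
Implicit Types (L K x y v a b : R) (p : 'cV[R]_2) (A : 'M[R]_2) (h : 'cV[R]_2 ->
  R) (H G : set 'cV[R]_2).

(** At [K = - 1/12], where [I = 0], the equation [J = 0] becomes [L^2 = 8/27]. *)
Definition Lb : R := 2 * Num.sqrt 2 / (3 * Num.sqrt 3).

Lemma Lb2 : Lb ^+ 2 = 8 / 27.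
Proof.
rewrite /Lb expr_div_n !exprMn !sqr_sqrtr //.
by field.
Qed.

Lemma curveBE : curveB = std_curve Lb (- (1 / 12)). Proof. by []. Qed.

Lemma equivalent_sqr L L' K : L ^+ 2 = L' ^+ 2 -> equivalent (std_curve L K) (std_curve L' K).
Proof.
move=> /eqP; rewrite eqf_sqr => /orP[/eqP ->|/eqP ->]; first exact: equivalent_refl.
exact/equivalent_sym/std_curveN.
Qed.

Lemma inv_curveB L K : invI L K = 0 -> invJ L K = 0 -> equivalent curveB (std_curve L K).
Proof.
rewrite /invI /invJ => hI hJ; have -> : K = - (1 / 12) by lra.
by rewrite curveBE; apply: equivalent_sqr; rewrite Lb2; lra.
Qed.

Lemma inv_curveA L K : invI L K = 1 / 3 -> invJ L K = - (1 / 27) -> std_curve L K = curveA.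
Proof.
rewrite /invI /invJ => hI hJ; have K4 : K = 1 / 4 by lra.
have /eqP : L ^+ 2 = 0 by lra.
by rewrite sqrf_eq0 K4 => /eqP ->.
Qed.

Lemma standard_frame_ends h H A : maximal_gpsr_of h H -> standard_frame h H A ->
  exists L K a b, [/\ pullback A h = std_quartic L K, mulmx A @^-1` H = std_curve L K,
    equivalent H (std_curve L K) & ends L K a b].
Proof.
move=> hH FA; have [L [K [PA IA iA]]] := standard_frameP hH FA.
have [a [b E]] := ends_exist L K; exists L, K, a, b; split => //.
by have [Au _ _] := FA; apply: equivalent_sym; exists A.
Qed.

Lemma limit_along_root L K a b h H A v hhat : ends L K a b ->
  pullback A h = std_quartic L K -> mulmx A @^-1` H = std_curve L K ->
  limit_along h H A v hhat ->
  [/\ fq L K v = 0, (0 < v /\ v = b) \/ (v < 0 /\ v = a),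
     ~ double_root L K v -> equivalent curveB (curve_through_e1 hhat) &
     double_root L K v -> equivalent curveA (curve_through_e1 hhat)].
Proof.
move=> E PA IA [lq _]; rewrite PA IA in lq.
have [f0 vE [L' [K' [hE hs hd]]]] := limit_quartic_inv E lq.
rewrite hE -/(std_curve L' K'); split=> //.
  by move=> /hs[hI hJ]; exact: inv_curveB.
by move=> /hd[hI hJ]; rewrite inv_curveA //; exact: equivalent_refl.
Qed.

Lemma limit_along_exists L K a b h H A v : ends L K a b ->
  pullback A h = std_quartic L K -> mulmx A @^-1` H = std_curve L K ->
  fq L K v = 0 -> v = a \/ v = b -> exists hhat, limit_along h H A v hhat.
Proof.
move=> E PA IA f0 vE; have [/andP[a0 b0] fw _ _] := E.
have v0 : v != 0 by case: vE => ->; [rewrite lt_eqF|rewrite gt_eqF].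
have dv t : 0 <= t < 1 -> a < t * v < b.
  by move=> /andP[t0 t1]; case: vE => ->; apply/andP; split; nra.
have [hhat lq] := limit_quartic_exists E v0 f0 dv.
exists hhat; split; first by rewrite PA IA.
have [_ _ [L' [K' [-> _ _]]]] := limit_quartic_inv E lq.
exact: (hyperbolic_level_e1 L' K').2.
Qed.

(** A limit in a direction forces [v] to be the end on that side and a root of [f]; conversely every
    root end has a limit. *)
Lemma nb_limit_directions_ends L K a b h H A : ends L K a b ->
  pullback A h = std_quartic L K -> mulmx A @^-1` H = std_curve L K ->
  nb_limit_directions h H A = ((fq L K a == 0)%R + (fq L K b == 0)%R)%N.
Proof.
move=> E PA IA; have [/andP[a0 b0] fw _ _] := E.
rewrite /nb_limit_directions -sum1_card big_mkcond big_bool /= addnC.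
congr (_ + _)%N.
- rewrite (_ : _ \in _ = (fq L K a == 0)); first by case: ifP.
  rewrite unfold_in /=; apply/asboolP/eqP => [[v [hhat [vs la]]]|fa].
    have [f0 [[v0 _]|[_ <-]] _ _] := limit_along_root E PA IA la; last by [].
    by rewrite v0 in vs.
  have [hhat la] := limit_along_exists E PA IA fa (or_introl erefl).
  by exists a, hhat; split => //; rewrite ltNge ltW.
- rewrite (_ : _ \in _ = (fq L K b == 0)); first by case: ifP.
  rewrite unfold_in /=; apply/asboolP/eqP => [[v [hhat [vs la]]]|fb].
    have [f0 [[_ <-]|[v0 _]] _ _] := limit_along_root E PA IA la; first by [].
    by rewrite ltNge ltW // in vs.
  have [hhat la] := limit_along_exists E PA IA fb (or_intror erefl).
  by exists b, hhat.
Qed.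

(** The frame in the definition is arbitrary, so the standard form obtained here is only known to be
    equivalent to [H]. An upper bound on limit geometries must therefore be proved for all
    equivalent standard forms. *)
Lemma limit_geometries_root H G : limit_geometries H G ->
  exists L K a b v, [/\ equivalent H (std_curve L K), ends L K a b, fq L K v = 0,
    v = a \/ v = b &
    (~ double_root L K v /\ equivalent curveB G) \/ (double_root L K v /\ equivalent curveA G)].
Proof.
move=> [_ [h [A [v [hhat [hH FA la eG]]]]]].
have [L [K [a [b [PA IA eH E]]]]] := standard_frame_ends hH FA.
have [f0 vE hs hd] := limit_along_root E PA IA la.
exists L, K, a, b, v; split => //; first by case: vE => -[_]; [right|left].
have [d|d] := pselect (double_root L K v).
  by right; split; [exact: d|exact: equivalent_trans (hd d) eG].
by left; split; [exact: d|exact: equivalent_trans (hs d) eG].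
Qed.

Lemma standard_frame1 L K : standard_frame (std_quartic L K) (std_curve L K) 1%:M.
Proof.
split; first exact: unitmx1.
  by rewrite mul1mx; exact: std_curve_e1.
by rewrite pullback1; do 2 eexists.
Qed.

Lemma limit_geometries_of_root L K a b v G : ends L K a b -> fq L K v = 0 -> v = a \/ v = b ->
  (~ double_root L K v /\ equivalent curveB G) \/ (double_root L K v /\ equivalent curveA G) ->
  limit_geometries (std_curve L K) G.
Proof.
move=> E f0 vE eG.
have PA : pullback 1%:M (std_quartic L K) = std_quartic L K by rewrite pullback1.
have IA : mulmx 1%:M @^-1` std_curve L K = std_curve L K.
  by apply/seteqP; split => p; rewrite /preimage /= mul1mx.
have [hhat la] := limit_along_exists E PA IA f0 vE.
have [_ _ hs hd] := limit_along_root E PA IA la.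
split; last first.
  exists (std_quartic L K), 1%:M, v, hhat; split => //; first exact: std_maximal.
    exact: standard_frame1.
  case: eG => -[d]; first by apply: equivalent_trans; apply: equivalent_sym; exact: hs.
  by apply: equivalent_trans; apply: equivalent_sym; exact: hd.
have mB : maximal_gpsr (curveB : set 'cV[R]_2) by exists (std_quartic Lb (- (1 / 12)));
  exact: std_maximal.
have mA : maximal_gpsr (curveA : set 'cV[R]_2) by exists (std_quartic 0 (1 / 4));
  exact: std_maximal.
case: eG => -[_ eG].
  exact: maximal_gpsr_equivalent mB eG.
exact: maximal_gpsr_equivalent mA eG.
Qed.

Lemma limit_directions_ends H n : (forall L K a b, ends L K a b -> equivalent H (std_curve L K) ->
  ((fq L K a == 0)%R + (fq L K b == 0)%R)%N = n) -> limit_directions H n.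
Proof.
move=> Hn h A hH FA; have [L [K [a [b [PA IA eH E]]]]] := standard_frame_ends hH FA.
by rewrite (nb_limit_directions_ends E PA IA); exact: Hn.
Qed.

End LimitGeometries.

(** * The range of [m] *)

Section Dynamics.
Context {R : realType}.
Implicit Types (L K x y z v a b m : R).

(* [L_y^2] as a function of [m = mq L K y], where [L_y] is the first parameter
   of the standard form at the point of the curve over [y]. *)
Definition Gq L K m : R := 8 / 27 - 8 / 3 * invI L K * m ^+ 2 - 16 * invJ L K * m ^+ 3.

Lemma mq_gt0 L K y : 0 < fq L K y -> 0 < wq L K y -> 0 < mq L K y.
Proof. by move=> f0 w0; rewrite /mq divr_gt0 ?mulr_gt0. Qed.

Lemma mq0 L K : mq L K 0 = 1.
Proof. by rewrite /mq fq0 wq0 mulr1 divff. Qed.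

Lemma Gq_mq L K y : 0 < wq L K y -> 8 * tq L K y ^+ 2 = Gq L K (mq L K y) * wq L K y ^+ 3.
Proof.
by move=> w0; rewrite syzygy /Gq /mq; field; rewrite gt_eqF.
Qed.

Lemma Gq_ge0 L K y : 0 < wq L K y -> 0 <= Gq L K (mq L K y).
Proof.
by move=> w0; rewrite -(pmulr_lge0 _ (exprn_gt0 3 w0)) -Gq_mq // mulr_ge0 // sqr_ge0.
Qed.

Lemma Gq_eq0 L K y : 0 < wq L K y -> Gq L K (mq L K y) = 0 -> tq L K y = 0.
Proof.
move=> w0 G0; have /eqP := Gq_mq w0; rewrite G0 mul0r mulf_eq0 sqrf_eq0 pnatr_eq0 /=.
by move/eqP.
Qed.

Lemma equivalent_target L K a b y L' : ends L K a b -> a < y < b ->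
  L' ^+ 2 = Gq L K (mq L K y) ->
  equivalent (std_curve L K) (std_curve L' (mq L K y ^+ 2 * invI L K - 1 / 12)).
Proof.
move=> E yab LE; apply/(equivalent_std _ _ E); exists y; split => //.
  by rewrite /invI; ring.
by rewrite {1}/invJ LE /Gq; field.
Qed.

Lemma equivalent_Gq L K a b L' K' : ends L K a b ->
  equivalent (std_curve L K) (std_curve L' K') ->
  exists m, [/\ 0 < m, exists2 y, a < y < b & m = mq L K y,
    invI L' K' = m ^+ 2 * invI L K, invJ L' K' = m ^+ 3 * invJ L K & L' ^+ 2 = Gq L K m].
Proof.
move=> E /(equivalent_std _ _ E)[y [yab hI hJ]].
have [_ fw _ _] := E; have [f0 w0] := fw y yab.
exists (mq L K y); split => //; [exact: mq_gt0|by exists y|].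
by move: hI hJ; rewrite /Gq {1}/invI {1}/invJ; lra.
Qed.

Lemma tq_sign L K a b : (exists2 y, a < y < b & tq L K y = 0) \/
  (forall y, a < y < b -> 0 < tq L K y) \/ (forall y, a < y < b -> tq L K y < 0).
Proof.
have [ex|nex] := pselect (exists2 y, a < y < b & tq L K y = 0); first by left.
right; have n0 y : a < y < b -> (tpol L K).[y] != 0.
  by move=> yab; apply/eqP; rewrite horner_tpol => t0; apply: nex; exists y.
have [[y yab ty]|np] := pselect (exists2 y, a < y < b & 0 < tq L K y).
  left=> z zab; rewrite -horner_tpol; apply: (poly_const_sign n0 yab zab).
  by rewrite horner_tpol.
right=> y yab; rewrite lt_neqAle -horner_tpol n0 //= horner_tpol leNgt; apply/negP => ty.
by apply: np; exists y.
Qed.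

(** Where [w > 0], its sign compares [mq] with the constant [m] and its zeros are the solutions of
    [mq = m], so tools for polynomials apply. *)
Definition mpol L K m : {poly R} := 8 *: fpol L K - m *: wpol L K.

Lemma horner_mpol L K m y : (mpol L K m).[y] = 8 * fq L K y - m * wq L K y.
Proof. by rewrite /mpol hornerD hornerN !hornerZ !fqw_horner. Qed.

Lemma horner_mpol1 L K m y : (mpol L K m)^`().[y] = 8 * fq1 L K y - m * wq1 L K y.
Proof. by rewrite /mpol derivB !derivZ hornerD hornerN !hornerZ !fqw_horner. Qed.

Lemma mq_gt L K m y : 0 < wq L K y -> (m < mq L K y) = (0 < (mpol L K m).[y]).
Proof. by move=> w0; rewrite horner_mpol subr_gt0 /mq ltr_pdivlMr. Qed.

Lemma mq_lt L K m y : 0 < wq L K y -> (mq L K y < m) = ((mpol L K m).[y] < 0).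
Proof. by move=> w0; rewrite horner_mpol subr_lt0 /mq ltr_pdivrMr. Qed.

Lemma mq_eq L K m y : 0 < wq L K y -> (mpol L K m).[y] = 0 -> mq L K y = m.
Proof. by move=> w0; rewrite horner_mpol /mq => h; apply: (canLR (mulfK (lt0r_neq0 w0))); lra. Qed.

(* At a zero of [8 f - m w] the derivative is [24 t / w], so all the zeros are
   crossed upwards. *)
Lemma mq_increasing L K a b : ends L K a b -> (forall y, a < y < b -> 0 < tq L K y) ->
  forall y z, a < y -> y < z -> z < b -> mq L K y < mq L K z.
Proof.
move=> E tp y z ay yz zb; have [_ fw _ _] := E.
pose p := - mpol L K (mq L K y).
have pE t : p.[t] = mq L K y * wq L K t - 8 * fq L K t by rewrite hornerN horner_mpol; ring.
have p1E t : p^`().[t] = mq L K y * wq1 L K t - 8 * fq1 L K t.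
  by rewrite /p derivN hornerN horner_mpol1; ring.
have crossing t : a < t < b -> p.[t] = 0 -> p^`().[t] < 0.
  move=> tab; have [ft wt] := fw t tab; have tt := tp t tab.
  rewrite pE p1E => h; rewrite -(pmulr_rlt0 _ wt).
  have -> : wq L K t * (mq L K y * wq1 L K t - 8 * fq1 L K t) = - (24 * tq L K t).
    transitivity (mq L K y * wq L K t * wq1 L K t - 8 * fq1 L K t * wq L K t); first by ring.
    have -> : mq L K y * wq L K t = 8 * fq L K t by lra.
    by rewrite /tq; field.
  by rewrite oppr_lt0 mulr_gt0.
have yab : a < y < b by rewrite ay (lt_trans yz).
have zab : a < z < b by rewrite (lt_trans ay).
have [fy wy] := fw y yab; have [fz wz] := fw z zab.
have py : p.[y] = 0 by rewrite pE /mq divfK ?lt0r_neq0 // subrr.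
have nonpos t : y < t < b -> p.[t] <= 0.
  move=> /andP[yt tb]; apply: (poly_no_up_crossing py yt) => s /andP[ys st]; apply: crossing.
  by rewrite (lt_le_trans ay) // (lt_trans st).
rewrite mq_gt // -oppr_lt0 -hornerN -/p lt_neqAle nonpos ?yz // andbT.
apply/eqP => pz.
(* Strictness: a zero at [z] is crossed downwards, so [p] would be positive shortly before [z]. *)
have [|d d0 H] := @poly_pos_near R (- p^`()) z; first by rewrite hornerN oppr_gt0 crossing.
pose e := Num.min (d / 2) ((z - y) / 2).
have e0 : 0 < e by rewrite lt_min; lra.
have ed : e <= d / 2 by rewrite ge_min lexx.
have ez : e <= (z - y) / 2 by rewrite ge_min lexx orbT.
have [|c /andP[c1 c2] cE] := @poly_mvt_lt R p (z - e) z; first by lra.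
have := H c; rewrite hornerN oppr_gt0 ltr0_norm ?subr_lt0 // => Hc.
have p1c : p^`().[c] < 0 by apply: Hc; lra.
have := nonpos (z - e); rewrite pz in cE => Hn.
have : p.[z - e] <= 0 by apply: Hn; lra.
have ze : z - (z - e) = e by lra.
by rewrite ze in cE; nra.
Qed.

Lemma poly_ivt_on (p : {poly R}) a b y z : a < y < b -> a < z < b -> p.[y] < 0 -> 0 < p.[z] ->
  exists2 t, a < t < b & p.[t] = 0.
Proof.
move=> /andP[ay yb] /andP[az zb] py pz.
have [yz|zy|yz] := ltgtP y z; last by move: pz; rewrite -yz ltNge ltW.
- have [|t /andP[t1 t2] pt] := poly_ivt_root (ltW yz) (p := p); first by rewrite nmulr_rlt0.
  by exists t; rewrite // (lt_trans ay) // (lt_trans t2).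
- have [|t /andP[t1 t2] pt] := poly_ivt_root (ltW zy) (p := p); first by rewrite pmulr_rlt0.
  by exists t; rewrite // (lt_trans az) // (lt_trans t2).
Qed.

Lemma mq_ivt L K a b y z m : ends L K a b -> a < y < b -> a < z < b ->
  mq L K y < m -> m < mq L K z -> exists2 t, a < t < b & mq L K t = m.
Proof.
move=> E yab zab; have [_ fw _ _] := E; have [fy wy] := fw y yab; have [fz wz] := fw z zab.
rewrite mq_lt // mq_gt // => h1 h2; have [t tab pt] := poly_ivt_on yab zab h1 h2.
by exists t => //; have [ft wt] := fw t tab; exact: mq_eq.
Qed.

(** * Behaviour of [m] near the ends *)

Lemma ends_segment L K a b v t : ends L K a b -> v = a \/ v = b -> 0 <= t < 1 -> a < t * v < b.
Proof.
by move=> [/andP[a0 b0] _ _ _] vE /andP[t0 t1]; case: vE => ->; apply/andP; split; nra.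
Qed.

(** The clause [0 < y / v] records that [y] is on the same side of [0] as the end, so that a
    monotone [m] can be compared with its value [1] at [0]. *)
Lemma near_segment L K a b v (P : R -> Prop) : ends L K a b -> v = a \/ v = b ->
  (\forall t \near (1 : R)^'-, P (t * v)) -> exists2 y, a < y < b & P y /\ 0 < y / v.
Proof.
move=> E vE NP; have [/andP[a0 b0] _ _ _] := E.
have N0 : \forall t \near (1 : R)^'-, 0 < t < 1.
  near=> t; apply/andP; split; first by near: t; exact: nbhs_left_gt.
  by near: t; exact: nbhs_left_lt.
have [t [Pt /andP[t0 t1]]] := filter_ex (filterI NP N0).
exists (t * v); first by apply: (ends_segment E vE); rewrite t1 ltW.
split=> //; rewrite mulfK //; case: vE => ->; [by rewrite lt_eqF|by rewrite gt_eqF].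
Unshelve. all: end_near. Qed.

(** At a double root [m] tends to [4 / f'']; being positive on the interval, it excludes [f'' < 0].
    A root of order at least three is recorded through its vanishing invariants. *)
Lemma end_cases L K a b v : ends L K a b -> v = a \/ v = b ->
  [\/ fq L K v = 0 /\ fq1 L K v != 0, [/\ fq L K v = 0, fq1 L K v = 0 & 0 < fq2 L K v],
      invI L K = 0 /\ invJ L K = 0 | 0 < fq L K v /\ wq L K v = 0].
Proof.
move=> E vE; have [/andP[a0 b0] fw [fa wa fwa] [fb wb fwb]] := E.
have [fv fwv] : 0 <= fq L K v /\ fq L K v * wq L K v = 0 by case: vE => ->.
have v0 : v != 0 by case: vE => ->; [rewrite lt_eqF|rewrite gt_eqF].
move: fv; rewrite le_eqVlt => /predU1P[/esym fv|fv]; last first.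
  by apply: Or44; split => //; apply: (mulfI (lt0r_neq0 fv)); rewrite fwv mulr0.
have [f1|f1] := eqVneq (fq1 L K v) 0; last exact: Or41.
have [hI hJ] := inv_double_root fv f1.
have [f2|f2] := eqVneq (fq2 L K v) 0.
  by apply: Or43; rewrite hI hJ f2 !expr0n !oppr0 !mul0r.
apply: Or42; split => //; rewrite lt_neqAle eq_sym f2 /= leNgt; apply/negP => f20.
have : \forall t \near (1 : R)^'-, mq L K (t * v) < 0.
  by apply: (cvgr_lt (4 / fq2 L K v)); [exact: mq_cvg_double|rewrite nmulr_llt0 ?invr_lt0].
move=> /(near_segment (P := fun y => mq L K y < 0) E vE)[y yab []]; have [f0 w0] := fw y yab.
by rewrite ltNge ltW // mq_gt0.
Qed.

(** [m] is unbounded near such an end: [8 f - m w] tends to [8 f > 0] for every constant [m]. *)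
Lemma mq_near_nonroot L K a b v m : ends L K a b -> v = a \/ v = b -> 0 < fq L K v ->
  wq L K v = 0 ->
  exists2 y, a < y < b & m < mq L K y /\ 0 < y / v.
Proof.
move=> E vE fv wv; have [_ fw _ _] := E.
have : \forall t \near (1 : R)^'-, 0 < (mpol L K m).[t * v].
  apply: (cvgr_gt (mpol L K m).[v]); first exact: cvg_at_left_horner.
  by rewrite horner_mpol wv mulr0 subr0 mulr_gt0.
move=> /(near_segment (P := fun y => 0 < (mpol L K m).[y]) E vE)[y yab [h yv]]; exists y => //;
  split => //.
by have [f0 w0] := fw y yab; rewrite mq_gt.
Qed.

Lemma mq_near_simple L K a b v m : ends L K a b -> v = a \/ v = b -> fq L K v = 0 ->
  fq1 L K v != 0 ->
  0 < m -> exists2 y, a < y < b & mq L K y < m /\ 0 < y / v.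
Proof.
move=> E vE fv f1v m0; apply: (near_segment (P := fun y => mq L K y < m) E vE).
by apply: (cvgr_lt 0) => //; exact: mq_cvg_simple.
Qed.

Lemma mq_near_double L K a b v (P : set R) : ends L K a b -> v = a \/ v = b ->
  fq L K v = 0 -> fq1 L K v = 0 -> 0 < fq2 L K v -> nbhs (4 / fq2 L K v) P ->
  exists2 y, a < y < b & P (mq L K y) /\ 0 < y / v.
Proof.
move=> E vE fv f1v f2v HP; apply: (near_segment (P := fun y => P (mq L K y)) E vE).
have [/andP[a0 b0] _ _ _] := E.
have v0 : v != 0 by case: vE => ->; [rewrite lt_eqF|rewrite gt_eqF].
exact: (mq_cvg_double v0 fv f1v (lt0r_neq0 f2v)).
Qed.

End Dynamics.

(** * Reduction to the normal forms *)

Section Classification.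
Context {R : realType}.
Implicit Types (L K x y z v a b m : R).

(* Cardano: [z = 24 U - 4] is the real root of [z^3 = 336 z + 2522]. *)
Lemma constU_cubic : let z := 24 * constU - 4 in
  [/\ 0 < z, z ^+ 3 = 336 * z + 2522 & 448 < z ^+ 2 :> R].
Proof.
set r : R := Num.sqrt 57; set w := 46 + 6 * r; set i := (w `^ (1 / 3))^-1.
have r2 : r ^+ 2 = 57 by rewrite sqr_sqrtr.
have r0 : 0 < r by rewrite sqrtr_gt0.
have w0 : 0 < w by rewrite /w; lra.
have s0 : 0 < w `^ (1 / 3) by exact: powR_gt0.
have i0 : 0 < i by rewrite invr_gt0.
have s3 : (w `^ (1 / 3)) ^+ 3 = w.
  by rewrite -powR_mulrn ?ltW // -powRrM divfK ?powRr1 ?ltW.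
have i3 : i ^+ 3 * w = 1 by rewrite /i exprVn s3 mulVf // gt_eqF.
have s2 : w `^ (- (2 / 3)) = i ^+ 2.
  rewrite powRN /i exprVn -powR_mulrn ?ltW // -powRrM; congr (_^-1); congr (_ `^ _).
  by field.
pose P := 31 + 3 * r; pose Q := 100 + 12 * r.
have UE : 24 * constU - 4 = P * i + Q * i ^+ 2.
  by rewrite /constU -/r -/w s2 powRN -/i /P /Q; field.
rewrite UE; set z := P * i + Q * i ^+ 2; cbv zeta.
have r3 : r ^+ 3 = 57 * r by rewrite exprS r2 mulrC.
have z0 : 0 < z by rewrite addr_gt0 // mulr_gt0 ?exprn_gt0 // /P /Q; lra.
(* With [u = P i] and [v = Q i^2] one has [u v = 112] and [u^3 + v^3 = 2522], so that [z = u + v]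
   satisfies [z^3 = u^3 + v^3 + 3 u v z]. *)
have PQ : P * Q = 112 * w by rewrite /P /Q /w; lra.
have P3 : P ^+ 3 = (1261 + 57 * r) * w by rewrite /P /w; lra.
have Q3 : Q ^+ 3 = (1261 - 57 * r) * w ^+ 2.
  by rewrite /Q /w; lra.
have zE : z ^+ 3 = 336 * z + 2522.
  have -> : z ^+ 3 = P ^+ 3 * i ^+ 3 + Q ^+ 3 * i ^+ 6 + 3 * (P * Q) * i ^+ 3 * z.
    by rewrite /z; ring.
  rewrite PQ P3 Q3.
  transitivity ((1261 + 57 * r) * (i ^+ 3 * w) + (1261 - 57 * r) * (i ^+ 3 * w) ^+ 2
    + 336 * (i ^+ 3 * w) * z); first by ring.
  by rewrite i3; ring.
split => //; rewrite ltNge; apply/negP => z2.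
clearbody z; clear - z0 zE z2.
(* If [z^2 <= 448], then [2522 <= 112 z], hence [z > 22] and [z^2 > 484]. The bound [448] makes the
   quadratic cofactor of the cubic positive definite. *)
have h : z * (z ^+ 2 - 336) = 2522 by lra.
have z112 : 2522 <= z * 112 by rewrite -h (ler_pM2l z0); lra.
have : 22 ^+ 2 < z ^+ 2 by rewrite ltr_pXn2r ?nnegrE ?ltW //; lra.
lra.
Qed.

(** In [k = 24 K - 4] the discriminant is a positive multiple of [k^3 - 336 k - 2522], whose
    quotient by [k - z] has no real root since [z^2 > 448]. *)
Lemma discr_constU K : exists2 q : R, 0 < q & invI 1 K ^+ 3 - 27 * invJ 1 K ^+ 2 = (K - constU) * q.
Proof.
have [] := constU_cubic; set z := 24 * constU - 4; cbv zeta => z0 z3 z2.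
pose k := 24 * K - 4.
have UE : constU = (z + 4) / 24 by rewrite /z; field.
have KE : K = (k + 4) / 24 by rewrite /k; field.
clearbody z k; rewrite UE KE /invI /invJ; clear - z0 z3 z2.
exists ((k ^+ 2 + z * k + z ^+ 2 - 336) / 576).
  rewrite (_ : _ / 576 = ((k + z / 2) ^+ 2 + 3 / 4 * (z ^+ 2 - 448)) / 576); last by field.
  apply: divr_gt0; last by rewrite ltr0n.
  apply: ltr_wpDl; first exact: sqr_ge0.
  apply: mulr_gt0; last by rewrite subr_gt0; exact: z2.
  by apply: divr_gt0; rewrite ltr0n.
transitivity ((k ^+ 3 - 336 * k - 2522 - (z ^+ 3 - 336 * z - 2522)) / 13824); last by field.
by rewrite z3; field.
Qed.

Lemma discr_eq0 K : invI 1 K ^+ 3 - 27 * invJ 1 K ^+ 2 = 0 -> K = constU.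
Proof.
have [q q0 ->] := discr_constU K => /eqP; rewrite mulf_eq0 (gt_eqF q0) orbF subr_eq0.
by move/eqP.
Qed.

Lemma discr_U : invI 1 constU ^+ 3 - 27 * invJ 1 constU ^+ 2 = 0 :> R.
Proof. by have [q q0 ->] := discr_constU constU; rewrite subrr mul0r. Qed.

Lemma discr_lt0 K : K < constU -> invI 1 K ^+ 3 - 27 * invJ 1 K ^+ 2 < 0.
Proof. by move=> KU; have [q q0 ->] := discr_constU K; rewrite nmulr_rlt0 // subr_lt0. Qed.

Lemma discr_ge0 K : constU <= K -> 0 <= invI 1 K ^+ 3 - 27 * invJ 1 K ^+ 2.
Proof. by move=> KU; have [q q0 ->] := discr_constU K; rewrite mulr_ge0 ?subr_ge0 // ltW. Qed.

Lemma constU_gt : - (25 / 72) < constU :> R.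
Proof. by have [] := constU_cubic; lra. Qed.

(** [m] increases and is [1] at [0], so it stays below [1] on the left, whereas it is unbounded near
    an end with [f > 0 = w]. *)
Lemma pos_left_root L K a b : ends L K a b -> (forall y, a < y < b -> 0 < tq L K y) ->
  ~ (invI L K = 0 /\ invJ L K = 0) ->
  (fq L K a = 0 /\ fq1 L K a != 0) \/ [/\ fq L K a = 0, fq1 L K a = 0 & 0 < fq2 L K a].
Proof.
move=> E tp nIJ; have aE : a = a \/ a = b by left.
have [/andP[a0 b0] fw _ _] := E.
case: (end_cases E aE) => //; [by left|by right|].
move=> [fa wa]; have [y /andP[ay yb] [my ya]] := mq_near_nonroot 1 E aE fa wa.
have y0 : y < 0 by move: ya; rewrite nmulr_lgt0 ?invr_lt0.
by have := mq_increasing E tp ay y0 b0; rewrite mq0; lra.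
Qed.

(** To the right of [0] one has [m > 1], whereas [m] tends to [0] at a simple root. *)
Lemma pos_right_end L K a b : ends L K a b -> (forall y, a < y < b -> 0 < tq L K y) ->
  ~ (invI L K = 0 /\ invJ L K = 0) ->
  (0 < fq L K b /\ wq L K b = 0) \/ [/\ fq L K b = 0, fq1 L K b = 0 & 0 < fq2 L K b].
Proof.
move=> E tp nIJ; have bE : b = a \/ b = b by right.
have [/andP[a0 b0] fw _ _] := E.
case: (end_cases E bE) => //; [|by right|by left].
move=> [fb f1b]; have [y /andP[ay yb] [my yb']] := mq_near_simple E bE fb f1b ltr01.
have y0 : 0 < y by move: yb'; rewrite pmulr_lgt0 ?invr_gt0.
by have := mq_increasing E tp a0 y0 yb; rewrite mq0; lra.
Qed.

Lemma Gq_continuous L K : continuous (Gq L K).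
Proof.
rewrite (_ : Gq L K = horner ((8 / 27)%:P - (8 / 3 * invI L K) *: 'X^2 - (16 * invJ L K) *: 'X^3)).
  exact: continuous_horner.
by apply/funext => m; rewrite /Gq !hornerE.
Qed.

(** [m] is unbounded while [Gq] stays nonnegative along the curve, so the leading coefficient of
    [Gq] is positive. It is [- 16 J], or [- 8/3 I] if [J = 0]. *)
Lemma Gq_nonroot_end L K a b v : ends L K a b -> v = a \/ v = b -> 0 < fq L K v -> wq L K v = 0 ->
  ~ (invI L K = 0 /\ invJ L K = 0) ->
  [/\ invJ L K <= 0, (invJ L K = 0 -> invI L K < 0) & exists M, forall m, M < m -> 1 < Gq L K m].
Proof.
move=> E vE fv wv nIJ; have [_ fw _ _] := E.
have big M : exists2 m, M < m & 0 <= Gq L K m.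
  have [y yab [My _]] := mq_near_nonroot M E vE fv wv; have [f0 w0] := fw y yab.
  by exists (mq L K y) => //; exact: Gq_ge0.
set I := invI L K in nIJ *; set J := invJ L K in nIJ *.
have GE m : Gq L K m = 8 / 27 - 8 / 3 * I * m ^+ 2 - 16 * J * m ^+ 3 by [].
clearbody I J.
have In : 0 <= `|I| /\ - `|I| <= I <= `|I| by rewrite normr_ge0 -ler_norml lexx.
case: In => In /andP[I1 I2].
have J0 : J <= 0.
  rewrite leNgt; apply/negP => J0.
  (* Beyond this bound [m > 1] and [m J > |I| + 1], so the cubic term dominates. *)
  have [m Mm] := big (1 + (`|I| + 1) / J); rewrite GE.
  have q0 : 0 < (`|I| + 1) / J by rewrite divr_gt0 // ltr_wpDl.
  have mJ : `|I| + 1 < m * J by rewrite -ltr_pdivrMr //; lra.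
  have m2 : 1 < m ^+ 2 by rewrite exprn_egt1 //; lra.
  have h3 : (`|I| + 1) * m ^+ 2 < m * J * m ^+ 2 by rewrite (ltr_pM2r (lt_trans ltr01 m2)).
  have h : (I + `|I|) * m ^+ 2 >= 0 by rewrite mulr_ge0 //; lra.
  have h' : 0 <= `|I| * m ^+ 2 by rewrite mulr_ge0 //; lra.
  by rewrite (_ : m * J * m ^+ 2 = J * m ^+ 3) in h3; [lra|ring].
have JI : J = 0 -> I < 0.
  move=> JE; rewrite ltNge; apply/negP; rewrite le_eqVlt => /predU1P[IE|I0]; first by apply: nIJ.
  have [m Mm] := big (1 + 1 / I); rewrite GE JE.
  have q0 : 0 < 1 / I by rewrite divr_gt0.
  have mI : 1 < m * I by rewrite -ltr_pdivrMr //; lra.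
  by nra.
split => //; move: J0; rewrite le_eqVlt => /predU1P[JE|J0].
  have I0 := JI JE; exists (1 + 1 / (- I)) => m Mm.
  have q0 : 0 < 1 / (- I) by rewrite divr_gt0 // oppr_gt0.
  have mI : 1 < m * (- I) by rewrite -ltr_pdivrMr ?oppr_gt0 //; lra.
  by rewrite GE JE; nra.
exists (1 + (`|I| + 1) / (- J)) => m Mm.
have q0 : 0 < (`|I| + 1) / (- J) by rewrite divr_gt0 ?oppr_gt0 // ltr_wpDl.
have mJ : `|I| + 1 < m * (- J) by rewrite -ltr_pdivrMr ?oppr_gt0 //; lra.
have m2 : 1 < m ^+ 2 by rewrite exprn_egt1 //; lra.
have h3 : (`|I| + 1) * m ^+ 2 < m * - J * m ^+ 2 by rewrite (ltr_pM2r (lt_trans ltr01 m2)).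
have h : (`|I| - I) * m ^+ 2 >= 0 by rewrite mulr_ge0 //; lra.
have h' : 0 <= `|I| * m ^+ 2 by rewrite mulr_ge0 //; lra.
by rewrite GE; rewrite (_ : m * - J * m ^+ 2 = - (J * m ^+ 3)) in h3; [lra|ring].
Qed.

Lemma Gq_small L K : exists2 e, 0 < e & forall m, 0 < m -> m < e -> Gq L K m < 1.
Proof.
pose N := `|invI L K| + `|invJ L K|.
have N0 : 0 <= N by rewrite addr_ge0.
(* The terms in [I] and [J] contribute at most [16 N m < 2/5], and [8/27 + 2/5 < 1]. *)
exists (1 / (1 + 40 * N)); first by rewrite divr_gt0 //; lra.
move=> m m0; rewrite ltr_pdivlMr; last by lra.
have : - `|invI L K| <= invI L K <= `|invI L K| by rewrite -ler_norml.
have : - `|invJ L K| <= invJ L K <= `|invJ L K| by rewrite -ler_norml.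
rewrite /Gq /N in N0 *; move: (invI L K) (invJ L K) N0 => I J.
have := normr_ge0 I; have := normr_ge0 J; move: `|I| `|J| =>
  i j j0 i0 N0 /andP[J1 J2] /andP[I1 I2] h.
have mi : 0 <= m * i by rewrite mulr_ge0 // ltW.
have mj : 0 <= m * j by rewrite mulr_ge0 // ltW.
have m1 : m <= 1 by lra.
have h1 : - I * m ^+ 2 <= i * m.
  apply: (@le_trans _ _ (i * m ^+ 2)); first by rewrite (ler_wpM2r (sqr_ge0 m)) //; lra.
  by rewrite ler_wpM2l // expr2 ler_piMr // ltW.
have h2 : - J * m ^+ 3 <= j * m.
  apply: (@le_trans _ _ (j * m ^+ 3)); first by rewrite (ler_wpM2r (exprn_ge0 3 (ltW m0))) //; lra.
  by rewrite ler_wpM2l // exprS ler_piMr ?exprn_ile1 // ltW.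
by lra.
Qed.

(** [L_y^2] is below [1] near the root end, where it tends to [8/27] or [0], and above [1] near the
    other end, so [L = 1] is reached. [J <= 0] bounds [K'] from below; the discriminant decides
    between [K' < U] and [K' = U]. *)
Lemma classify_pos_nonroot L K a b : ends L K a b -> (forall y, a < y < b -> 0 < tq L K y) ->
  ~ (invI L K = 0 /\ invJ L K = 0) -> 0 < fq L K b -> wq L K b = 0 ->
  exists e, admissible e /\ equivalent (std_curve L K) (entry_curve e).
Proof.
move=> E tp nIJ fb wb; have bE : b = a \/ b = b by right.
have aE : a = a \/ a = b by left.
have [/andP[a0 b0] fw _ _] := E.
have [J0 JI [M HM]] := Gq_nonroot_end E bE fb wb nIJ.
have Gpos y : a < y < b -> 0 < Gq L K (mq L K y).
  move=> yab; have [f0 w0] := fw y yab; rewrite lt_neqAle Gq_ge0 // andbT eq_sym.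
  by apply/eqP => /(Gq_eq0 w0) t0; have := tp y yab; rewrite t0 ltxx.
have [y1 y1ab Gy1] : exists2 y, a < y < b & Gq L K (mq L K y) < 1.
  case: (pos_left_root E tp nIJ) => [[fa f1a]|[fa f1a f2a]].
    have [e e0 He] := Gq_small L K.
    have [y yab [ym _]] := mq_near_simple E aE fa f1a e0.
    by exists y => //; have [f0 w0] := fw y yab; apply: He => //; exact: mq_gt0.
  have [|y yab [Gy _]] := mq_near_double (P := [set m | Gq L K m < 1]) E aE fa f1a f2a;
    last by exists y.
  have [hI hJ] := inv_double_root fa f1a.
  have G0 : Gq L K (4 / fq2 L K a) < 1.
    rewrite /Gq hI hJ (_ : _ - _ = 0) //.
    by field; rewrite gt_eqF.
  exact: (cvgr_lt _ (@Gq_continuous L K (4 / fq2 L K a)) _ G0).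
have [y2 y2ab [My2 _]] := mq_near_nonroot M E bE fb wb.
(* By the syzygy this is [(Gq - 1) w^3] along the curve. *)
pose p := 8 *: tpol L K ^+ 2 - wpol L K ^+ 3.
have pE y : p.[y] = 8 * tq L K y ^+ 2 - wq L K y ^+ 3.
  by rewrite /p hornerD hornerN hornerZ !horner_exp !fqw_horner.
have [||y yab py] := @poly_ivt_on _ p a b y1 y2 y1ab y2ab.
- have [f0 w0] := fw y1 y1ab; rewrite pE Gq_mq // subr_lt0 gtr_pMl ?exprn_gt0 //.
- have [f0 w0] := fw y2 y2ab; rewrite pE Gq_mq // subr_gt0 ltr_pMl ?exprn_gt0 //; exact: HM.
have [f0 w0] := fw y yab.
have w3 : 0 < wq L K y ^+ 3 by rewrite exprn_gt0.
have G1 : Gq L K (mq L K y) = 1.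
  by apply: (mulIf (lt0r_neq0 w3)); rewrite -Gq_mq // mul1r; move: py; rewrite pE; lra.
have m0 := mq_gt0 f0 w0; set m := mq L K y in G1 m0 *.
pose K' := m ^+ 2 * invI L K - 1 / 12.
have eq1 : equivalent (std_curve L K) (std_curve 1 K').
  by apply: (equivalent_target E yab); rewrite -/m G1 expr1n.
have hI : invI 1 K' = m ^+ 2 * invI L K by rewrite {1}/invI /K'; ring.
have hJ : invJ 1 K' = m ^+ 3 * invJ L K.
  by move: G1; rewrite {1}/invJ expr1n /K' /Gq; lra.
have K'ge : - (25 / 72) <= K'.
  have : invJ 1 K' <= 0 by rewrite hJ pmulr_rle0 // exprn_gt0.
  by rewrite /invJ; lra.
have dE : invI 1 K' ^+ 3 - 27 * invJ 1 K' ^+ 2 = m ^+ 6 * (invI L K ^+ 3 - 27 * invJ L K ^+ 2).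
  by rewrite hI hJ; ring.
case: (pos_left_root E tp nIJ) => [[fa f1a]|[fa f1a f2a]]; last first.
  have [h1 h2] := inv_double_root fa f1a.
  have KU : K' = constU.
    by apply: discr_eq0; rewrite dE h1 h2; field.
  rewrite KU in eq1.
  by exists Case8; split; [by []|exact: eq1].
have KU : K' < constU.
  rewrite ltNge; apply/negP => /discr_ge0; rewrite dE pmulr_rge0 ?exprn_gt0 // => D0.
  have Jn : invJ L K < 0.
    rewrite lt_neqAle J0 andbT; apply/eqP => JE; have I0 := JI JE.
    by move: D0; rewrite JE expr0n mulr0 subr0 exprn_odd_ge0 // leNgt I0.
  have I0 : 0 < invI L K.
    rewrite ltNge; apply/negP => I0; have : invI L K ^+ 3 <= 0 by rewrite exprn_odd_le0.
    have : 0 < invJ L K ^+ 2 by rewrite exprn_even_gt0 //= lt_eqF.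
    by lra.
  (* The critical point of [Gq]. For a nonnegative discriminant [Gq] is at most [0] there; but [m]
     takes this value, and [Gq] is positive along the curve since [t] has no zero. *)
  pose m1 := invI L K / (- 9 * invJ L K).
  have n9 : 0 < - 9 * invJ L K by lra.
  have m10 : 0 < m1 by rewrite divr_gt0.
  have [z1 z1ab [z1m _]] := mq_near_simple E aE fa f1a m10.
  have [z2 z2ab [z2m _]] := mq_near_nonroot m1 E bE fb wb.
  have [z zab zm] := mq_ivt E z1ab z2ab z1m z2m.
  have := Gpos z zab; rewrite zm.
  have -> : Gq L K m1 = - (8 / 729 / invJ L K ^+ 2 * (invI L K ^+ 3 - 27 * invJ L K ^+ 2)).
    by rewrite /Gq /m1; field; rewrite lt_eqF.
  have c0 : 0 < 8 / 729 / invJ L K ^+ 2.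
    by rewrite divr_gt0 ?divr_gt0 ?ltr0n // exprn_even_gt0 //= lt_eqF.
  by rewrite oppr_gt0 ltNge (mulr_ge0 (ltW c0) D0).
move: K'ge; rewrite le_eqVlt => /predU1P[KE|K'gt].
  rewrite -KE in eq1.
  by exists Case7; split; [by []|exact: eq1].
by exists (Case6 K'); split; [rewrite /= K'gt|exact: eq1].
Qed.

(** With a simple root on the left, [m] ranges from [0] to its limit at the double root, and half of
    that limit gives [K = 0] and [L^2 = 4/27]. Two double roots are incompatible with [t > 0]. *)
Lemma classify_pos_double L K a b : ends L K a b -> (forall y, a < y < b -> 0 < tq L K y) ->
  ~ (invI L K = 0 /\ invJ L K = 0) -> fq L K b = 0 -> fq1 L K b = 0 -> 0 < fq2 L K b ->
  equivalent (std_curve L K) (entry_curve Case3).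
Proof.
move=> E tp nIJ fb f1b f2b; have bE : b = a \/ b = b by right.
have aE : a = a \/ a = b by left.
have [/andP[a0 b0] fw _ _] := E.
have [hI hJ] := inv_double_root fb f1b.
pose m := 4 / fq2 L K b; have m0 : 0 < m by rewrite divr_gt0.
case: (pos_left_root E tp nIJ) => [[fa f1a]|[fa f1a f2a]].
  have m20 : 0 < m / 2 by rewrite divr_gt0.
  have [y1 y1ab [y1m _]] := mq_near_simple E aE fa f1a m20.
  have [|y2 y2ab [y2m _]] := mq_near_double (P := [set x | m / 2 < x]) E bE fb f1b f2b.
    by apply: open_nbhs_nbhs; split; [exact: open_gt|rewrite /= -/m; lra].
  have [y yab ym] := mq_ivt E y1ab y2ab y1m y2m.
  have := @equivalent_target _ L K a b y (2 / (3 * Num.sqrt 3)) E yab.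
  rewrite ym (_ : (m / 2) ^+ 2 * invI L K - 1 / 12 = 0); last first.
    by rewrite hI /m; field; rewrite gt_eqF.
  apply; rewrite expr_div_n exprMn sqr_sqrtr // /Gq hI hJ /m; field; rewrite gt_eqF //.
have [hI' hJ'] := inv_double_root fa f1a.
(* Equal [I] gives [m] the same limit at both ends. As [m] increases through [1] at [0], this limit
   is [1]; then [Gq 1 = 0] and [t] vanishes at [0]. *)
have f2E : fq2 L K a = fq2 L K b.
  by apply/eqP; rewrite -(@eqrXn2 _ 2) ?ltW //; apply/eqP; lra.
have m1 : m = 1.
  apply/le_anti/andP; split; rewrite leNgt; apply/negP => m1.
    have [|y /andP[ay yb] [my ya]] := mq_near_double (P := [set x | 1 < x]) E aE fa f1a f2a.
      by apply: open_nbhs_nbhs; split; [exact: open_gt|rewrite /= f2E -/m].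
    have y0 : y < 0 by move: ya; rewrite nmulr_lgt0 ?invr_lt0.
    by have := mq_increasing E tp ay y0 b0; rewrite mq0 => /ltW; rewrite leNgt => /negP; apply.
  have [|y /andP[ay yb] [my ya]] := mq_near_double (P := [set x | x < 1]) E bE fb f1b f2b.
    by apply: open_nbhs_nbhs; split; [exact: open_lt|rewrite /= -/m].
  have y0 : 0 < y by move: ya; rewrite pmulr_lgt0 ?invr_gt0.
  by have := mq_increasing E tp a0 y0 yb; rewrite mq0 => /ltW; rewrite leNgt => /negP; apply.
have f24 : fq2 L K b = 4 by have := divfK (lt0r_neq0 f2b) 4; rewrite -/m m1 mul1r.
have w00 : 0 < wq L K 0 by rewrite wq0.
have := tp 0; rewrite (Gq_eq0 w00) ?ltxx ?a0 ?b0; first by move=> /(_ isT).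
by rewrite mq0 /Gq hI hJ f24; field.
Qed.

Lemma classify_pos L K a b : ends L K a b -> (forall y, a < y < b -> 0 < tq L K y) ->
  ~ (invI L K = 0 /\ invJ L K = 0) ->
  exists e, admissible e /\ equivalent (std_curve L K) (entry_curve e).
Proof.
move=> E tp nIJ; case: (pos_right_end E tp nIJ) => [[fb wb]|[fb f1b f2b]].
  exact: (classify_pos_nonroot E tp nIJ).
by exists Case3; split; [by []|exact: (classify_pos_double E tp nIJ)].
Qed.

Lemma tq0_equivalent L K a b y : ends L K a b -> a < y < b -> tq L K y = 0 ->
  exists K', equivalent (std_curve L K) (std_curve 0 K').
Proof.
move=> E yab t0; have [_ fw _ _] := E; have [f0 w0] := fw y yab.
exists (mq L K y ^+ 2 * invI L K - 1 / 12); apply: (equivalent_target E yab).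
apply: (mulIf (lt0r_neq0 (exprn_gt0 3 w0))).
by rewrite -Gq_mq // t0 !expr0n mulr0 mul0r.
Qed.

Lemma classify L K : exists e, admissible e /\ equivalent (std_curve L K) (entry_curve e).
Proof.
have [[hI hJ]|nIJ] := pselect (invI L K = 0 /\ invJ L K = 0).
  by exists Case2; split; [by []|apply: equivalent_sym; exact: inv_curveB].
have [a [b E]] := ends_exist L K.
case: (tq_sign L K a b) => [[y yab t0]|[tp|tn]].
- have [K' eq0] := tq0_equivalent E yab t0.
  have [K4|K4|K4] := ltgtP K' (1 / 4).
  + by exists (Case4 K'); split; [exact: K4|exact: eq0].
  + by exists (Case5 K'); split; [exact: K4|exact: eq0].
  + by rewrite K4 in eq0; exists Case1; split; [by []|exact: eq0].
- exact: classify_pos E tp nIJ.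
have E' := endsN E.
have [||e [ae eqe]] := @classify_pos (- L) K (- b) (- a) E'.
- move=> y /andP[yb ya]; rewrite tqN oppr_gt0; apply: tn.
  by rewrite ltrNr ltrNl ya yb.
- by move: nIJ; rewrite /invI /invJ sqrrN.
by exists e; split; [exact: ae|exact: equivalent_trans (std_curveN L K) eqe].
Qed.
End Classification.

(** * The individual normal forms *)

Section Entries.
Context {R : realType}.
Implicit Types (L K x y z v a b m : R) (H G : set 'cV[R]_2).

Definition L3 : R := 2 / (3 * Num.sqrt 3).

Lemma L32 : L3 ^+ 2 = 4 / 27.
Proof. by rewrite /L3 expr_div_n exprMn sqr_sqrtr //; field. Qed.

(** * Closed curves of the list *)

Lemma closed_std L K : (forall y, 0 < fq L K y -> wq L K y = 0 -> False) -> closed (std_curve L K).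
Proof.
move=> Hn; have [a [b E]] := ends_exist L K.
have [_ _ [fa _ fwa] [fb _ fwb]] := E.
have root v : 0 <= fq L K v -> fq L K v * wq L K v = 0 -> fq L K v = 0.
  rewrite le_eqVlt => /predU1P[//|fv] fwv.
  by case: (Hn v fv); apply: (mulfI (lt0r_neq0 fv)); rewrite fwv mulr0.
by apply/(closed_std_curve E); split; exact: root.
Qed.

(** The origin of the threshold [1/4]: the sign of [1 - 4 K] decides whether [w >= 8 f], that is
    [m <= 1], or the reverse. *)
Lemma wq_L0 K y : wq 0 K y = 8 * fq 0 K y + 12 * (1 - 4 * K) * y ^+ 2.
Proof. by rewrite /wq /fq; ring. Qed.

Lemma closed_L0 K : K <= 1 / 4 -> closed (std_curve 0 K).
Proof.
move=> K4; apply: closed_std => y fy; rewrite wq_L0 => w0.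
have := mulr_ge0 (_ : 0 <= 1 - 4 * K) (sqr_ge0 y); lra.
Qed.

Lemma fqwq_B L y : L ^+ 2 = 8 / 27 -> let r := 3 / 4 * L in
  fq L (- (1 / 12)) y = (1 - r * y) ^+ 3 * (1 + 3 * r * y) /\
  wq L (- (1 / 12)) y = 8 * (1 - r * y) ^+ 4.
Proof.
move=> e2; cbv zeta; rewrite /fq /wq.
have e3 : L ^+ 3 = 8 / 27 * L by rewrite exprSr e2.
have e4 : L ^+ 4 = 64 / 729 by rewrite (exprD L 2 2) e2; field.
split.
(* Constants are expressed by powers of [L], which makes the factorisation an identity in [L y]. *)
- transitivity (1 - 27 / 8 * L ^+ 2 * y ^+ 2 + 27 / 8 * L ^+ 3 * y ^+ 3 - 243 / 256 * L ^+ 4 * y ^+ 4).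
    by rewrite e2 e3 e4; field.
  by field.
- transitivity (8 - 24 * L * y + 27 * L ^+ 2 * y ^+ 2 - 27 / 2 * L ^+ 3 * y ^+ 3 + 81 / 32 * L ^+ 4 * y ^+ 4).
    by rewrite e2 e3 e4; field.
  by field.
Qed.

Lemma closed_B : closed (std_curve Lb (- (1 / 12)) : set 'cV[R]_2).
Proof.
apply: closed_std => y; have [-> ->] := fqwq_B y Lb2 => fy /eqP.
rewrite mulf_eq0 pnatr_eq0 /= expf_eq0 /= => /eqP e; move: fy.
by rewrite e expr0n mul0r ltxx.
Qed.

(** [1 / r] is a double root and [- 1 / (2 r)] a simple one. *)
Lemma fqwq_3 L y : L ^+ 2 = 4 / 27 -> let r := 3 / 2 * L in
  fq L 0 y = (1 - r * y) ^+ 2 * (1 + 2 * r * y) /\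
  wq L 0 y = 4 * (1 - r * y) ^+ 2 * (2 + (r * y) ^+ 2).
Proof.
move=> e2; cbv zeta; rewrite /fq /wq.
have e3 : L ^+ 3 = 4 / 27 * L by rewrite exprSr e2.
have e4 : L ^+ 4 = 16 / 729 by rewrite (exprD L 2 2) e2; field.
split.
- transitivity (1 - 27 / 4 * L ^+ 2 * y ^+ 2 + 27 / 4 * L ^+ 3 * y ^+ 3).
    by rewrite e2 e3; field.
  by field.
- transitivity (8 - 24 * L * y + 27 * L ^+ 2 * y ^+ 2 - 27 * L ^+ 3 * y ^+ 3 + 81 / 4 * L ^+ 4 * y ^+ 4).
    by rewrite e2 e3 e4; field.
  by field.
Qed.

Lemma closed_3 : closed (std_curve L3 0 : set 'cV[R]_2).
Proof.
apply: closed_std => y; have [-> ->] := fqwq_3 y L32 => fy /eqP.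
have n : 2 + (3 / 2 * L3 * y) ^+ 2 != 0 by rewrite gt_eqF // ltr_wpDr ?sqr_ge0.
rewrite mulf_eq0 (negbTE n) orbF mulf_eq0 pnatr_eq0 orFb expf_eq0 /= => /eqP e.
by move: fy; rewrite e expr0n mul0r ltxx.
Qed.

(** * Inequivalence of the listed curves *)

Lemma A_unique L K : equivalent (std_curve 0 (1 / 4)) (std_curve L K) -> L = 0 /\ K = 1 / 4.
Proof.
have [a [b E]] := ends_exist (0 : R) (1 / 4).
have [_ fw _ _] := E.
move=> /(equivalent_Gq E)[m [m0 [y yab mE] hI _ hL]].
have [f0 w0] := fw y yab.
(* For A, [w = 8 f], so [m] is constant. *)
have m1 : m = 1.
  have wE : wq 0 (1 / 4) y = 8 * fq 0 (1 / 4) y by rewrite wq_L0; field.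
  by rewrite mE /mq wE divff // mulf_neq0 ?gt_eqF.
rewrite m1 in hI hL; rewrite /Gq /invI /invJ in hI hL.
have K4 : K = 1 / 4 by lra.
have /eqP : L ^+ 2 = 0 by rewrite hL; field.
by rewrite sqrf_eq0 => /eqP.
Qed.

Lemma B_inv L K : equivalent (std_curve Lb (- (1 / 12))) (std_curve L K) ->
  invI L K = 0 /\ invJ L K = 0.
Proof.
have [a [b E]] := ends_exist (Lb : R) (- (1 / 12)).
move=> /(equivalent_Gq E)[m [m0 _ -> -> _]].
have -> : invI Lb (- (1 / 12)) = 0 :> R by rewrite /invI; field.
have -> : invJ Lb (- (1 / 12)) = 0 :> R by rewrite /invJ Lb2; field.
by rewrite !mulr0.
Qed.

(** [m] stays in [(0, 2)], and the double zero of [Gq] is at [2], the limit of [m] at the double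
    root. This keeps the curve away from both [L = 0] and [L = 1]. *)
Lemma case3_L L K : equivalent (std_curve L3 0) (std_curve L K) -> 0 < L ^+ 2 <= 8 / 27.
Proof.
have [a [b E]] := ends_exist (L3 : R) 0.
have [_ fw _ _] := E.
move=> /(equivalent_Gq E)[m [m0 [y yab mE] _ _ ->]].
have -> : Gq L3 0 m = 2 / 27 * (m - 2) ^+ 2 * (m + 1).
  by rewrite /Gq /invI /invJ L32; field.
have [f0 w0] := fw y yab.
have m2 : m < 2.
  rewrite mE /mq ltr_pdivrMr //; move: f0 w0; have [-> ->] := fqwq_3 y L32.
  rewrite -[2 * _ * y]mulrA; move: (3 / 2 * L3 * y) => s f0 w0.
  have s1 : s != 1.
    by apply: contraTneq f0 => ->; rewrite subrr expr0n mul0r ltxx.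
  have s2 : 0 < (1 - s) ^+ 2 by rewrite exprn_even_gt0 //= subr_eq0 eq_sym.
  (* Indeed [2 w - 8 f = 8 (1 - s)^4]. *)
  have := mulr_gt0 s2 s2; lra.
apply/andP; split.
  have q : 0 < (m - 2) ^+ 2 by rewrite exprn_even_gt0 //= subr_eq0 lt_eqF.
  by apply: mulr_gt0; [apply: mulr_gt0; [lra|exact: q]|lra].
have := mulr_ge0 (sqr_ge0 m) (_ : 0 <= 3 - m); lra.
Qed.

(** [m - 1] never has the sign opposite to [K - 1/4], and under this restriction the cofactor of
    [1 - m] in [Gq] has no zero. *)
Lemma L0_unique K K' : K < 1 / 4 \/ 1 / 4 < K -> equivalent (std_curve 0 K) (std_curve 0 K') ->
  K = K'.
Proof.
move=> K4; have [a [b E]] := ends_exist 0 K; have [_ fw _ _] := E.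
move=> /(equivalent_Gq E)[m [m0 [y yab mE] hI _ hL]].
have [f0 w0] := fw y yab.
have m1 : m = 1.
  apply/eqP/contraT => m1; exfalso; move: hL.
  have -> : Gq 0 K m = 8 / 27 * (1 - m) * (1 + m + m ^+ 2 - 9 * invI 0 K * m ^+ 2).
    by rewrite /Gq /invI /invJ; field.
  rewrite expr0n => /esym/eqP; rewrite !mulf_eq0 subr_eq0 [1 == m]eq_sym (negbTE m1) orbF.
  rewrite invr_eq0 !pnatr_eq0 /= /invI => /eqP.
  have y2 := sqr_ge0 y.
  case: K4 => K4.
    have m1' : m <= 1.
      rewrite mE /mq ler_pdivrMr // wq_L0 mul1r lerDl.
      by rewrite mulr_ge0 // mulr_ge0 // subr_ge0; lra.
    have mm : m ^+ 2 <= m by rewrite expr2 ler_piMl // ltW.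
    have := mulr_gt0 (exprn_gt0 2 m0) (_ : 0 < 1 / 4 - K); lra.
  have m1' : 1 <= m.
    rewrite mE /mq ler_pdivlMr // wq_L0 mul1r gerDl.
    by rewrite mulr_le0_ge0 // mulr_ge0_le0 // subr_le0; lra.
  have mm : m <= m ^+ 2 by rewrite expr2 ler_peMl // ltW.
  have := mulr_gt0 (exprn_gt0 2 m0) (_ : 0 < K - 1 / 4); lra.
by move: hI; rewrite m1 /invI; lra.
Qed.

(** At [K = - 25/72] the [m^2] terms in the cofactor of [m - 1] cancel, leaving [19/27 (m + 1)]; a
    larger [K] only increases it. *)
Lemma L1_unique K K' : - (25 / 72) <= K -> equivalent (std_curve 1 K) (std_curve 1 K') -> K = K'.
Proof.
move=> K1; have [a [b E]] := ends_exist 1 K.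
move=> /(equivalent_Gq E)[m [m0 _ hI _ hL]].
have m1 : m = 1.
  apply/eqP/contraT => m1; exfalso; move: hL.
  rewrite expr1n => hL.
  have : (m - 1) * (19 / 27 * (m ^+ 2 + m + 1) + 8 / 3 * invI 1 K * m ^+ 2) = 0.
    transitivity (Gq 1 K m - 1); last by rewrite -hL subrr.
    by rewrite /Gq /invI /invJ; field.
  move/eqP; rewrite mulf_eq0 subr_eq0 (negbTE m1) /= => /eqP.
  have := mulr_ge0 (sqr_ge0 m) (_ : 0 <= K + 25 / 72); rewrite /invI; lra.
by move: hI; rewrite m1 /invI; lra.
Qed.

Lemma L1_invJ K : - (25 / 72) <= K -> invJ 1 K <= 0.
Proof. by rewrite /invJ; lra. Qed.

(** On this range [J <= 0] and the discriminant is at most [0]. A zero of [Gq] then forces the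
    discriminant to vanish and the target to be A, whose only standard form has [L = 0]. *)
Lemma no_L0 K K' : - (25 / 72) <= K <= constU -> equivalent (std_curve 1 K) (std_curve 0 K') ->
  False.
Proof.
move=> /andP[K1 K2] eq0; have [a [b E]] := ends_exist 1 K.
have [m [m0 _ hI hJ hL]] := equivalent_Gq E eq0.
have J0 := L1_invJ K1.
have D0 : invI 1 K ^+ 3 - 27 * invJ 1 K ^+ 2 <= 0.
  by have [q q0 ->] := discr_constU K; rewrite mulr_le0_ge0 ?subr_le0 ?(ltW q0).
(* In terms of [k], [Gq m = 0] reads [9 m^2 I = 1 + k], and the discriminant becomes a positive
   multiple of [(k - 2)^2 (k + 1/4)]. *)
pose k := - (54 * m ^+ 3 * invJ 1 K).
have k0 : 0 <= k by rewrite oppr_ge0 mulr_ge0_le0 // mulr_ge0 // exprn_ge0 // ltW.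
have Ik : invI 1 K = (1 + k) / (9 * m ^+ 2).
  have h : 9 * m ^+ 2 * invI 1 K = 1 + k by move: hL; rewrite /Gq expr0n /= /k; lra.
  by rewrite -h mulrC mulKf // mulf_neq0 // expf_neq0 // gt_eqF.
have Jk : invJ 1 K = - k / (54 * m ^+ 3).
  by rewrite /k; field; rewrite gt_eqF.
have k2 : k = 2.
  have DE : 729 * m ^+ 6 * (invI 1 K ^+ 3 - 27 * invJ 1 K ^+ 2) = (k - 2) ^+ 2 * (k + 1 / 4).
    by rewrite Ik Jk; field; rewrite gt_eqF.
  have : (k - 2) ^+ 2 * (k + 1 / 4) <= 0.
    rewrite -DE; apply: mulr_ge0_le0; last exact: D0.
    by apply: mulr_ge0; [rewrite ler0n|exact: exprn_ge0 (ltW m0)].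
  rewrite pmulr_lle0; last by lra.
  rewrite le_eqVlt ltNge sqr_ge0 orbF sqrf_eq0 subr_eq0.
  by move/eqP.
have K'4 : K' = 1 / 4.
  move: hI; rewrite Ik k2 (_ : m ^+ 2 * _ = 1 / 3); first by rewrite /invI; lra.
  by field; rewrite gt_eqF.
rewrite K'4 in eq0; have [/eqP] := A_unique (equivalent_sym eq0).
by rewrite oner_eq0.
Qed.

Lemma not_L1_case3 K : equivalent (std_curve 1 K) (std_curve L3 0) -> False.
Proof. by move=> /equivalent_sym /case3_L /andP[_]; rewrite expr1n; lra. Qed.

(** * Ends of the curves with [L = 1] *)

Lemma tq_neq0_L1 K L1 K1 a b : - (25 / 72) <= K <= constU ->
  equivalent (std_curve 1 K) (std_curve L1 K1) -> ends L1 K1 a b ->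
  (forall y, a < y < b -> 0 < tq L1 K1 y) \/ (forall y, a < y < b -> tq L1 K1 y < 0).
Proof.
move=> KU eq1 E; case: (tq_sign L1 K1 a b) => // -[y yab t0].
have [K' eq2] := tq0_equivalent E yab t0.
by case: (no_L0 KU (equivalent_trans eq1 eq2)).
Qed.

Lemma nIJ_L1 K L1 K1 : - (25 / 72) <= K -> equivalent (std_curve 1 K) (std_curve L1 K1) ->
  ~ (invI L1 K1 = 0 /\ invJ L1 K1 = 0).
Proof.
move=> KU eq1; have [a [b E]] := ends_exist 1 K.
have [m [m0 _ -> -> _]] := equivalent_Gq E eq1.
move=> [/eqP + /eqP]; rewrite !mulf_eq0 !(gt_eqF m0) /=.
by rewrite /invI /invJ => /eqP h1 /eqP h2; lra.
Qed.

Lemma one_root_pos L K a b : ends L K a b -> (forall y, a < y < b -> 0 < tq L K y) ->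
  ~ (invI L K = 0 /\ invJ L K = 0) -> ~ equivalent (std_curve L K) (std_curve L3 0) ->
  fq L K a = 0 /\ (0 < fq L K b /\ wq L K b = 0).
Proof.
move=> E tp nIJ n3; split; first by case: (pos_left_root E tp nIJ) => -[].
case: (pos_right_end E tp nIJ) => // -[fb f1b f2b].
by case: n3; exact: (classify_pos_double E tp nIJ).
Qed.

(** [t] has no zero because [L = 0] is not reached; for [t > 0] the left end is a root, and a root
    on the right would make the curve case 3. Reflection settles [t < 0]. *)
Lemma one_root_L1 K L1 K1 a b : - (25 / 72) <= K <= constU ->
  equivalent (std_curve 1 K) (std_curve L1 K1) -> ends L1 K1 a b ->
  (fq L1 K1 a = 0 /\ (0 < fq L1 K1 b /\ wq L1 K1 b = 0)) \/
  (fq L1 K1 b = 0 /\ (0 < fq L1 K1 a /\ wq L1 K1 a = 0)).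
Proof.
move=> KU eq1 E; have [K1' K2'] := andP KU.
have nIJ := nIJ_L1 K1' eq1.
case: (tq_neq0_L1 KU eq1 E) => [tp|tn].
  left; apply: one_root_pos => // /(equivalent_trans eq1); exact: not_L1_case3.
right; have eqN := equivalent_trans eq1 (std_curveN L1 K1).
have := @one_root_pos (- L1) K1 (- b) (- a) (endsN E).
rewrite fqN fqN wqN !opprK; apply.
- move=> y /andP[yb ya]; rewrite tqN oppr_gt0; apply: tn.
  by rewrite ltrNr ltrNl ya yb.
- exact: nIJ_L1 K1' eqN.
- by move=> /(equivalent_trans eqN); exact: not_L1_case3.
Qed.

Lemma not_closed_L1 K : - (25 / 72) <= K <= constU -> ~ closed (std_curve 1 K).
Proof.
move=> KU; have [a [b E]] := ends_exist 1 K.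
move=> /(closed_std_curve E)[fa fb].
case: (one_root_L1 KU (equivalent_refl _) E) => -[_ []]; rewrite ?fa ?fb ltxx //.
Qed.

Lemma fq_L0_gt0 K y : 1 / 4 < K -> 0 < fq 0 K y.
Proof.
move=> K4; rewrite (_ : fq 0 K y = (1 - y ^+ 2 / 2) ^+ 2 + (K - 1 / 4) * y ^+ 4); last first.
  by rewrite /fq; field.
have [->|y0] := eqVneq y 0.
  by rewrite !expr0n mul0r subr0 expr1n mulr0 addr0.
by rewrite ltr_wpDl ?sqr_ge0 // mulr_gt0 ?subr_gt0 // exprn_even_gt0.
Qed.

Lemma not_closed_L0 K : 1 / 4 < K -> ~ closed (std_curve 0 K).
Proof.
move=> K4; have [a [b E]] := ends_exist 0 K.
move=> /(closed_std_curve E)[fa _].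
by have := fq_L0_gt0 a K4; rewrite fa ltxx.
Qed.

(** For [K > 1/4] the form [(x^2 - y^2/2)^2 + (K - 1/4) y^4] is positive definite, a property
    preserved by invertible linear maps. *)
Lemma no_root_L0 K L1 K1 v : 1 / 4 < K -> equivalent (std_curve 0 K) (std_curve L1 K1) ->
  fq L1 K1 v <> 0.
Proof.
move=> K4 /equivalent_pullback[A [Au _ PA]] fv.
have := congr1 (fun h => h (pt 1 v)) PA; rewrite std_quartic1 fv /pullback.
set q := A *m pt 1 v => hq.
have q0 : q = 0.
  have hq' : (q 0 0 ^+ 2 - q 1 0 ^+ 2 / 2) ^+ 2 + (K - 1 / 4) * q 1 0 ^+ 4 = 0.
    by rewrite -hq /std_quartic; field.
  have h5 : 0 <= (K - 1 / 4) * q 1 0 ^+ 4.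
    by apply: mulr_ge0; [rewrite subr_ge0 ltW|exact: exprn_even_ge0].
  move/eqP: hq'; rewrite (paddr_eq0 (sqr_ge0 _) h5).
  move=> /andP[/eqP h /eqP h1].
  move/eqP: h1; rewrite mulf_eq0 subr_eq0 (gt_eqF K4) /= expf_eq0 /= => /eqP h1.
  move/eqP: h; rewrite sqrf_eq0 h1 expr0n mul0r subr0 sqrf_eq0 => /eqP h0.
  rewrite [q]col2P h0 h1.
  by apply/colP => i; rewrite !mxE; case: ifP.
have := mulKmx Au (pt 1 v); rewrite -/q q0 mulmx0 => /(congr1 (fun q : 'cV[R]_2 => q 0 0)).
by rewrite pt0 mxE => /esym/eqP; rewrite oner_eq0.
Qed.

Lemma double_end L K a b v : ends L K a b -> v = a \/ v = b -> fq L K v = 0 -> double_root L K v ->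
  [/\ invJ L K < 0, invI L K != 0 & invI L K ^+ 3 - 27 * invJ L K ^+ 2 = 0].
Proof.
move=> E vE fv [f1 f2]; have [hI hJ] := inv_double_root fv f1.
have f2n : fq2 L K v != 0 by exact/eqP.
have In : invI L K != 0 by rewrite hI mulf_neq0 ?invr_neq0 ?expf_neq0 ?pnatr_eq0.
have f2p : 0 < fq2 L K v.
  case: (end_cases E vE) => [[_]|[]|[I0]|[]] //; first by rewrite f1 eqxx.
    by rewrite I0 eqxx in In.
  by rewrite fv ltxx.
split=> //; last by rewrite hI hJ; field.
by rewrite hJ mulNr oppr_lt0; apply: divr_gt0; [exact: exprn_gt0|rewrite ltr0n].
Qed.

(** * Limit geometries from the type of the root ends *)

Lemma limit_geometries_sub H G : limit_geometries H G -> equivalent G curveA \/ equivalent G curveB.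
Proof.
by move=> /limit_geometries_root[L [K [a [b [v [_ _ _ _ [[_ e]|[_ e]]]]]]]];
   [right|left]; exact: equivalent_sym.
Qed.

Lemma limit_geometries_B L K :
  (forall L1 K1 a b v, equivalent (std_curve L K) (std_curve L1 K1) -> ends L1 K1 a b ->
    v = a \/ v = b -> fq L1 K1 v = 0 -> ~ double_root L1 K1 v) ->
  (forall a b, ends L K a b -> fq L K a = 0 \/ fq L K b = 0) ->
  limit_geometries (std_curve L K) = [set G | equivalent curveB G].
Proof.
move=> Hd Hr; apply/seteqP; split => G.
  move=> /limit_geometries_root[L1 [K1 [a [b [v [e1 E fv vE [[_ //]|[d _]]]]]]]].
  by case: (Hd _ _ _ _ _ e1 E vE fv d).
move=> /= eG; have [a [b E]] := ends_exist L K.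
case: (Hr a b E) => fv.
  apply: (limit_geometries_of_root E fv (or_introl erefl)); left; split; last exact: eG.
  exact: Hd (equivalent_refl _) E (or_introl erefl) fv.
apply: (limit_geometries_of_root E fv (or_intror erefl)); left; split; last exact: eG.
exact: Hd (equivalent_refl _) E (or_intror erefl) fv.
Qed.

Lemma limit_geometries_A L K :
  (forall L1 K1 a b v, equivalent (std_curve L K) (std_curve L1 K1) -> ends L1 K1 a b ->
    v = a \/ v = b -> fq L1 K1 v = 0 -> double_root L1 K1 v) ->
  (forall a b, ends L K a b -> fq L K a = 0 \/ fq L K b = 0) ->
  limit_geometries (std_curve L K) = [set G | equivalent curveA G].
Proof.
move=> Hd Hr; apply/seteqP; split => G.
  move=> /limit_geometries_root[L1 [K1 [a [b [v [e1 E fv vE [[d _]|[_ //]]]]]]]].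
  by case: (d (Hd _ _ _ _ _ e1 E vE fv)).
move=> /= eG; have [a [b E]] := ends_exist L K.
case: (Hr a b E) => fv.
  apply: (limit_geometries_of_root E fv (or_introl erefl)); right; split; last exact: eG.
  exact: Hd (equivalent_refl _) E (or_introl erefl) fv.
apply: (limit_geometries_of_root E fv (or_intror erefl)); right; split; last exact: eG.
exact: Hd (equivalent_refl _) E (or_intror erefl) fv.
Qed.

Lemma closed_limit_directions L K : closed (std_curve L K) -> limit_directions (std_curve L K) 2.
Proof.
move=> C; apply: limit_directions_ends => L1 K1 a b E e1.
have /(closed_std_curve E)[-> ->] := equivalent_closed e1 C.
by rewrite eqxx.
Qed.

Lemma closed_root L K a b : closed (std_curve L K) -> ends L K a b -> fq L K a = 0 \/ fq L K b = 0.
Proof. by move=> C E; have /(closed_std_curve E)[fa _] := C; left. Qed.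

Lemma limit_directions_L1 K : - (25 / 72) <= K <= constU -> limit_directions (std_curve 1 K) 1.
Proof.
move=> KU; apply: limit_directions_ends => L1 K1 a b E e1.
by case: (one_root_L1 KU e1 E) => -[-> [/gt_eqF -> _]]; rewrite eqxx.
Qed.

Lemma root_L1 K a b : - (25 / 72) <= K <= constU -> ends 1 K a b -> fq 1 K a = 0 \/ fq 1 K b = 0.
Proof. by move=> KU E; case: (one_root_L1 KU (equivalent_refl _) E) => -[h _]; [left|right]. Qed.

(** The signs of [I], [J] and the discriminant are thus invariants of equivalence. *)
Lemma equivalent_discr L K L' K' : equivalent (std_curve L K) (std_curve L' K') ->
  exists2 m, 0 < m & [/\ invI L' K' = m ^+ 2 * invI L K, invJ L' K' = m ^+ 3 * invJ L K &
    invI L' K' ^+ 3 - 27 * invJ L' K' ^+ 2 = m ^+ 6 * (invI L K ^+ 3 - 27 * invJ L K ^+ 2)].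
Proof.
have [a [b E]] := ends_exist L K.
move=> /(equivalent_Gq E)[m [m0 _ hI hJ _]]; exists m => //; split => //.
by rewrite hI hJ; ring.
Qed.

(** A double root end needs discriminant [0], but below [U] it is negative in every equivalent
    form. *)
Lemma limit_geometries_L1 K : - (25 / 72) <= K < constU ->
  limit_geometries (std_curve 1 K) = [set G | equivalent curveB G].
Proof.
move=> /andP[K1 K2].
have KU : - (25 / 72) <= K <= constU by rewrite K1 ltW.
apply: limit_geometries_B => [L1 K1' a b v e1 E vE fv d|a b]; last exact: root_L1.
have [_ _ D0] := double_end E vE fv d.
have [m m0 [_ _]] := equivalent_discr e1; rewrite D0 => /esym/eqP.
by rewrite mulf_eq0 expf_eq0 (gt_eqF m0) /= lt_eqF // discr_lt0.
Qed.

Lemma constU_range : (- (25 / 72) : R) <= (@constU R) <= (@constU R).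
Proof. by rewrite lexx ltW // constU_gt. Qed.

(* A simple root end would let [m] take the value at which [Gq] vanishes. *)
Lemma limit_geometries_U : limit_geometries (std_curve 1 constU) = [set G | equivalent curveA G] :> set (set 'cV[R]_2).
Proof.
apply: limit_geometries_A => [L1 K1 a b v e1 E vE fv|a b]; last exact: root_L1 constU_range.
have [K1' _] := andP constU_range.
have nIJ := nIJ_L1 K1' e1.
have [f1|f1] := eqVneq (fq1 L1 K1 v) 0.
  split=> // f2; apply: nIJ; have [-> ->] := inv_double_root fv f1.
  by rewrite f2 !expr0n oppr0 !mul0r.
exfalso; have [_ fw _ _] := E.
have [u [uE fu wu]] : exists u, [/\ u = a \/ u = b, 0 < fq L1 K1 u & wq L1 K1 u = 0].
  by case: (one_root_L1 constU_range e1 E) => -[_ [fu wu]]; [exists b|exists a]; split => //;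
    [right|left].
have [J0 JI _] := Gq_nonroot_end E uE fu wu nIJ.
have [m m0 [_ _]] := equivalent_discr e1; rewrite discr_U mulr0 => D0.
have Jn : invJ L1 K1 < 0.
  rewrite lt_neqAle J0 andbT; apply/eqP => JE; have I0 := JI JE.
  move: D0; rewrite JE expr0n mulr0 subr0 => /eqP; rewrite expf_eq0 /=.
  by rewrite lt_eqF.
have I0 : 0 < invI L1 K1.
  rewrite ltNge; apply/negP => I0; have h : invI L1 K1 ^+ 3 <= 0 by rewrite exprn_odd_le0.
  have h' : 0 < invJ L1 K1 ^+ 2 by rewrite exprn_even_gt0 //= lt_eqF.
  by lra.
(* The critical point of [Gq], also a zero because the discriminant vanishes. *)
pose m1 := invI L1 K1 / (- 9 * invJ L1 K1).
have n9 : 0 < - 9 * invJ L1 K1 by lra.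
have m10 : 0 < m1 by rewrite divr_gt0.
have [z1 z1ab [z1m _]] := mq_near_simple E vE fv f1 m10.
have [z2 z2ab [z2m _]] := mq_near_nonroot m1 E uE fu wu.
have [z zab zm] := mq_ivt E z1ab z2ab z1m z2m.
have [fz wz] := fw z zab.
have tz : tq L1 K1 z = 0.
  apply: Gq_eq0 => //; rewrite zm.
  have -> : Gq L1 K1 m1 = - (8 / 729 / invJ L1 K1 ^+ 2 * (invI L1 K1 ^+ 3 - 27 * invJ L1 K1 ^+ 2)).
    by rewrite /Gq /m1; field; rewrite lt_eqF.
  by rewrite D0 mulr0 oppr0.
have [K' eq2] := tq0_equivalent E zab tz.
exact: no_L0 constU_range (equivalent_trans e1 eq2).
Qed.
End Entries.

(** * The classification *)

Section Main.
Context {R : realType}.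
Implicit Types (L K x y z v a b m : R) (H G : set 'cV[R]_2).

(** The right end [1 / r] is the double root and gives A; the left end [- 1 / (2 r)] is simple and
    gives B. *)
Lemma limit_geometries_3 : limit_geometries (std_curve L3 0) =
  [set G : set 'cV[R]_2 | equivalent curveA G \/ equivalent curveB G].
Proof.
apply/seteqP; split => G.
  by move=> /limit_geometries_sub[] e; [left|right]; exact: equivalent_sym.
have [a [b E]] := ends_exist (L3 : R) 0.
have /(closed_std_curve E)[fa fb] := closed_3 (R := R).
have [/andP[a0 b0] _ _ _] := E.
pose r : R := 3 / 2 * L3.
have r0 : 0 < r by rewrite mulr_gt0 ?divr_gt0 // mulr_gt0 // sqrtr_gt0.
have LE : L3 = 2 / 3 * r by rewrite /r; field.
have f1E y : fq1 L3 0 y = - 2 * y + 2 * y * (r * y) by rewrite /fq1 LE; field.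
have f2E y : fq2 L3 0 y = - 2 + 4 * (r * y) by rewrite /fq2 LE; field.
have fE y : fq L3 0 y = (1 - r * y) ^+ 2 * (1 + 2 * (r * y)).
  by have [-> _] := fqwq_3 y L32; rewrite -/r mulrA.
have ra : r * a = - (1 / 2).
  have h : r * a < 0 by rewrite pmulr_rlt0.
  move: fa; rewrite fE => /eqP; rewrite mulf_eq0 expf_eq0 /= subr_eq0 gt_eqF /=; last by lra.
  by move=> /eqP; lra.
have rb : r * b = 1.
  have h : 0 < r * b by rewrite pmulr_rgt0.
  move: fb; rewrite fE => /eqP; rewrite mulf_eq0 expf_eq0 /= subr_eq0 => /orP[/eqP //|].
  by rewrite gt_eqF //; lra.
move=> /= [e|e].
  apply: (limit_geometries_of_root E fb (or_intror erefl)); right; split; last exact: e.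
  by split; [rewrite f1E rb; ring|rewrite f2E rb; lra].
apply: (limit_geometries_of_root E fa (or_introl erefl)); left; split; last exact: e.
by move=> [+ _]; rewrite f1E ra; lra.
Qed.

(** The discriminant is [K (4 K - 1)^2 / 16]. For [K < 1/4] it vanishes only at [K = 0], where the
    double root is at infinity; this is detected by [J > 0]. *)
Lemma limit_geometries_4 K : K < 1 / 4 ->
  limit_geometries (std_curve 0 K) = [set G | equivalent curveB G].
Proof.
move=> K4; have C := closed_L0 (ltW K4).
apply: limit_geometries_B => [L1 K1 a b v e1 E vE fv d|a b]; last exact: closed_root.
have [J0 _ D0] := double_end E vE fv d.
have [m m0 [_ hJ]] := equivalent_discr e1; rewrite D0 => /esym/eqP.
rewrite mulf_eq0 expf_eq0 (gt_eqF m0) /=.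
rewrite (_ : _ - _ = K * (4 * K - 1) ^+ 2 / 16); last by rewrite /invI /invJ; field.
rewrite !mulf_eq0 invr_eq0 pnatr_eq0 orbF => /orP[/eqP KE|/eqP h]; last by move/eqP: h;
  rewrite orbb => /eqP; lra.
move: J0; rewrite hJ pmulr_rlt0 ?exprn_gt0 // KE /invJ; lra.
Qed.

(** * Homogeneity and the case without limits *)

Lemma homogeneous_A : homogeneous (std_curve 0 (1 / 4) : set 'cV[R]_2).
Proof.
have [a [b E]] := ends_exist (0 : R) (1 / 4); have [_ fw _ _] := E.
refine (homogeneous_std E _) => y /fw[f0 w0].
have wE : wq 0 (1 / 4) y = 8 * fq 0 (1 / 4) y by rewrite wq_L0; field.
have -> : mq 0 (1 / 4) y = 1 by rewrite /mq wE divff // mulf_neq0 // gt_eqF.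
by rewrite !expr1n !mul1r.
Qed.

Lemma homogeneous_B : homogeneous (std_curve Lb (- (1 / 12)) : set 'cV[R]_2).
Proof.
have [a [b E]] := ends_exist (Lb : R) (- (1 / 12)).
have [I0 J0] := @B_inv R _ _ (equivalent_refl _).
by refine (homogeneous_std E _) => y _; rewrite I0 J0 !mulr0.
Qed.

Lemma not_homogeneous_L0 K : K <> 1 / 4 -> ~ homogeneous (std_curve 0 K).
Proof.
move=> K4 /homogeneous_stdP[[]|[_ //]]; rewrite /invI /invJ; lra.
Qed.

Lemma not_homogeneous_L1 K : - (25 / 72) <= K -> ~ homogeneous (std_curve 1 K).
Proof.
move=> K1 /homogeneous_stdP[h|[/eqP + _]]; last by rewrite oner_eq0.
exact: nIJ_L1 K1 (equivalent_refl _) h.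
Qed.

Lemma not_homogeneous_3 : ~ homogeneous (std_curve L3 0 : set 'cV[R]_2).
Proof.
move=> /homogeneous_stdP[[+ _]|[_]]; first by rewrite /invI; lra.
by lra.
Qed.

Lemma limit_geometries_5 K : 1 / 4 < K -> limit_geometries (std_curve 0 K) = set0.
Proof.
move=> K4; rewrite -subset0 => G /limit_geometries_root[L1 [K1 [a [b [v [e1 _ fv _ _]]]]]].
exact: (no_root_L0 K4 e1 fv).
Qed.

Lemma limit_directions_5 K : 1 / 4 < K -> limit_directions (std_curve 0 K) 0.
Proof.
move=> K4; apply: limit_directions_ends => L1 K1 a b _ e1.
by have /eqP/negbTE -> := no_root_L0 (v := a) K4 e1; have /eqP/negbTE -> := no_root_L0 (v :=
  b) K4 e1.
Qed.

(** * No repetition in the list *)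

Lemma entry_closed (e : entry R) : admissible e ->
  closed (entry_curve e) <-> match e with Case1 | Case2 | Case3 | Case4 _ => True | _ => False end.
Proof.
case: e => [|||K|K|K||] ae.
- by split=> // _; exact: (closed_L0 (lexx (1 / 4))).
- by split=> // _; exact: closed_B.
- by split=> // _; exact: closed_3.
- by split=> // _; exact: (closed_L0 (ltW ae)).
- by split=> // C; exact: (not_closed_L0 ae C).
- by split=> // C; move: ae => /= /andP[k1 k2]; apply: (@not_closed_L1 _ K) C; rewrite !ltW.
- by split=> // C; apply: (@not_closed_L1 _ (- (25 / 72))) C; rewrite lexx ltW // constU_gt.
- by split=> // C; exact: (not_closed_L1 constU_range C).
Qed.

Lemma entry_unique (e e' : entry R) : admissible e -> admissible e' ->
  equivalent (entry_curve e) (entry_curve e') -> e = e'.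
Proof.
move=> ae ae' eq1.
have c1 := @entry_closed e ae; have c2 := @entry_closed e' ae'.
have cc : closed (entry_curve e) <-> closed (entry_curve e').
  split; first exact: equivalent_closed eq1.
  exact: equivalent_closed (equivalent_sym eq1).
have U1 : - (25 / 72) <= (- (25 / 72) : R) <= constU by rewrite lexx ltW // constU_gt.
have U2 := @constU_range R.
have A3 : ~ equivalent (std_curve 0 (1 / 4)) (std_curve L3 0 : set 'cV[R]_2).
  by move=> /A_unique[_]; lra.
have A4 K : K < 1 / 4 -> ~ equivalent (std_curve 0 (1 / 4)) (std_curve 0 K).
  by move=> K4 /A_unique[_]; lra.
have B1 : ~ equivalent (std_curve Lb (- (1 / 12))) (std_curve 0 (1 / 4) : set 'cV[R]_2).
  by move=> /B_inv[]; rewrite /invI; lra.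
have B3 : ~ equivalent (std_curve Lb (- (1 / 12))) (std_curve L3 0 : set 'cV[R]_2).
  by move=> /B_inv[]; rewrite /invI; lra.
have B4 K : ~ equivalent (std_curve Lb (- (1 / 12))) (std_curve 0 K).
  by move=> /B_inv[]; rewrite /invI /invJ; lra.
have C4 K : ~ equivalent (std_curve L3 0) (std_curve 0 K).
  by move=> /case3_L; rewrite expr0n ltxx.
have range K : - (25 / 72) < K < constU -> - (25 / 72) <= K <= constU.
  by move=> /andP[k1 k2]; rewrite !ltW.
have s := equivalent_sym eq1.
(* Closedness is preserved by equivalence, which disposes of every pair with one entry among the
   first four and one among the last four. *)
have := conj (fun h => c2.1 (cc.1 (c1.2 h))) (fun h => c1.1 (cc.2 (c2.2 h))).
move: ae ae' eq1 s; clear c1 c2 cc.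
case: e => [|||K|K|K||]; case: e' => [|||K'|K'|K'||] ae ae' eq1 s cl; try reflexivity;
  try solve [case: (cl.1 I)]; try solve [case: (cl.2 I)].
- by case: (B1 s).
- by case: (A3 eq1).
- by case: (A4 _ ae' eq1).
- by case: (B1 eq1).
- by case: (B3 eq1).
- by case: (B4 _ eq1).
- by case: (A3 s).
- by case: (B3 s).
- by case: (C4 _ eq1).
- by case: (A4 _ ae s).
- by case: (B4 _ s).
- by case: (C4 _ s).
- by rewrite (L0_unique (or_introl ae) eq1).
- by rewrite (L0_unique (or_intror ae) eq1).
- by case: (no_L0 (range _ ae') s).
- by case: (no_L0 U1 s).
- by case: (no_L0 U2 s).
- by case: (no_L0 (range _ ae) eq1).
- by have /andP[k _] := range _ ae; rewrite (L1_unique k eq1).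
- have /andP[k _] := range _ ae; have h := L1_unique k eq1.
  by move: ae; rewrite h /= ltxx.
- have /andP[k _] := range _ ae; have h := L1_unique k eq1.
  by move: ae; rewrite h /= ltxx andbF.
- by case: (no_L0 U1 eq1).
- have /andP[k _] := U1; have h := L1_unique k eq1.
  by move: ae'; rewrite -h /= ltxx.
- have /andP[k _] := U1; have h := L1_unique k eq1.
  by have := @constU_gt R; rewrite -h ltxx.
- by case: (no_L0 U2 eq1).
- have /andP[k _] := U2; have h := L1_unique k eq1.
  by move: ae'; rewrite -h /= ltxx andbF.
- have /andP[k _] := U2; have h := L1_unique k eq1.
  by have := @constU_gt R; rewrite h ltxx.
Qed.

Lemma entry_maximal (e : entry R) : maximal_gpsr (entry_curve e).
Proof. by case: e => [|||K|K|K||]; eexists; exact: std_maximal. Qed.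
End Main.

Theorem proposition4p4 (R : realType) :
  (* limit geometries are A or B *)
  (forall H G : set 'cV[R]_2, maximal_gpsr H -> limit_geometries H G ->
     equivalent G curveA \/ equivalent G curveB) /\
  (* the list consists of maximal connected curves, and is a classification *)
  (forall e : entry R, admissible e -> maximal_gpsr (entry_curve e)) /\
  (forall H : set 'cV[R]_2, maximal_gpsr H ->
     exists! e : entry R, admissible e /\ equivalent H (entry_curve e)) /\
  (* (1) *)
  (let H : set 'cV[R]_2 := entry_curve Case1 in
   [/\ closed H, homogeneous H,
       limit_geometries H = [set G | equivalent curveA G] &
       limit_directions H 2]) /\
  (* (2) *)
  (let H : set 'cV[R]_2 := entry_curve Case2 in
   [/\ closed H, homogeneous H,
       limit_geometries H = [set G | equivalent curveB G] &
       limit_directions H 2]) /\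
  (* (3) *)
  (let H : set 'cV[R]_2 := entry_curve Case3 in
   [/\ closed H, ~ homogeneous H,
       limit_geometries H = [set G | equivalent curveA G \/ equivalent curveB G] &
       limit_directions H 2]) /\
  (* (4) *)
  (forall K : R, K < 1 / 4 ->
   let H := entry_curve (Case4 K) in
   [/\ closed H, ~ homogeneous H,
       limit_geometries H = [set G | equivalent curveB G] &
       limit_directions H 2]) /\
  (* (5) *)
  (forall K : R, 1 / 4 < K ->
   let H := entry_curve (Case5 K) in
   [/\ ~ closed H, ~ homogeneous H,
       limit_geometries H = set0 &
       limit_directions H 0]) /\
  (* (6) *)
  (forall K : R, - (25 / 72) < K < constU ->
   let H := entry_curve (Case6 K) in
   [/\ ~ closed H, ~ homogeneous H,
       limit_geometries H = [set G | equivalent curveB G] &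
       limit_directions H 1]) /\
  (* (7) *)
  (let H : set 'cV[R]_2 := entry_curve Case7 in
   [/\ ~ closed H, ~ homogeneous H,
       limit_geometries H = [set G | equivalent curveB G] &
       limit_directions H 1]) /\
  (* (8) *)
  (let H : set 'cV[R]_2 := entry_curve Case8 in
   [/\ ~ closed H, ~ homogeneous H,
       limit_geometries H = [set G | equivalent curveA G] &
       limit_directions H 1]).
Proof.
split; first by move=> H G _; exact: limit_geometries_sub.
split; first by move=> e _; exact: entry_maximal.
split.
  move=> H [h hH]; have [L [K eqH]] := gpsr_standard hH.
  have [e [ae eqe]] := classify L K.
  exists e; split; first by split; [exact: ae|exact: equivalent_trans eqH eqe].
  move=> e' [ae' eqe']; apply: entry_unique ae ae' _.
  apply: equivalent_trans eqe'; apply: equivalent_sym.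
  exact: equivalent_trans eqH eqe.
have U1 : - (25 / 72) <= (- (25 / 72) : R) < constU by rewrite lexx constU_gt.
have U2 : - (25 / 72) <= (- (25 / 72) : R) <= constU by rewrite lexx ltW // constU_gt.
have U3 := @constU_range R.
have range (K : R) : - (25 / 72) < K < constU -> - (25 / 72) <= K <= constU.
  by move=> /andP[k1 k2]; rewrite !ltW.
split.
  have C := closed_L0 (lexx (1 / 4 : R)); split.
  - exact: C.
  - exact: homogeneous_A.
  - apply: limit_geometries_A => [L1 K1 a b v /A_unique[-> ->] E vE fv|a b];
    last exact: closed_root C.
    (* For A, [f = (1 - y^2/2)^2], so every root is double. *)
    have v2 : v ^+ 2 = 2.
      have : (1 - v ^+ 2 / 2) ^+ 2 = 0 by rewrite -fv /fq; field.
      by move=> /eqP; rewrite sqrf_eq0 => /eqP; lra.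
    split; first by rewrite /fq1 (exprS v 2) v2; field.
    by rewrite /fq2 v2; lra.
  - exact: closed_limit_directions C.
split.
  have C := closed_B (R := R); split.
  - exact: C.
  - exact: homogeneous_B.
  - apply: limit_geometries_B => [L1 K1 a b v e1 E vE fv d|a b]; last exact: closed_root C.
    have [_ I0 _] := double_end E vE fv d.
    by have [h _] := B_inv e1; rewrite h eqxx in I0.
  - exact: closed_limit_directions C.
split.
  have C := closed_3 (R := R); split.
  - exact: C.
  - exact: not_homogeneous_3.
  - exact: limit_geometries_3.
  - exact: closed_limit_directions C.
split.
  move=> K K4; have C := closed_L0 (ltW K4); split.
  - exact: C.
  - by apply: not_homogeneous_L0 => h; rewrite h ltxx in K4.
  - exact: limit_geometries_4.
  - exact: closed_limit_directions C.
split.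
  move=> K K4; split.
  - exact: not_closed_L0.
  - by apply: not_homogeneous_L0 => h; rewrite h ltxx in K4.
  - exact: limit_geometries_5.
  - exact: limit_directions_5.
split.
  move=> K KU; have KU' := range K KU; have [K1 K2] := andP KU'; split.
  - exact: not_closed_L1.
  - exact: not_homogeneous_L1.
  - by apply: limit_geometries_L1; rewrite K1; have [_ ->] := andP KU.
  - exact: limit_directions_L1.
split; split.
- exact: not_closed_L1 U2.
- by apply: not_homogeneous_L1; rewrite lexx.
- exact: limit_geometries_L1.
- exact: limit_directions_L1 U2.
- exact: not_closed_L1 U3.
- by apply: not_homogeneous_L1; rewrite ltW // constU_gt.
- exact: limit_geometries_U.
- exact: limit_directions_L1 U3.
Qed.
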